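(* Let $\Omega\subset\mathbb{R}^d$ be a bounded open set with the extension property, $0<s\le1$ with $2s<d$. Let $A\in L^\infty(\mathbb{R}^d)^{d^2}$, $\boldsymbol b,\boldsymbol d\in L^{d/s}(\Omega)^d$ and $c\in L^{d/(2s)}(\Omega)$ be such that, for some $a_*>0$, $$A(x)\boldsymbol\xi\cdot\boldsymbol\xi\ge a_*|\boldsymbol\xi|^2,\quad\forall\boldsymbol\xi\in\mathbb{R}^d,\text{ a.e. }x\in\mathbb{R}^d,$$ and $$\delta:=a_*-C_*\Big(\|\boldsymbol b+\boldsymbol d\|_{L^{d/s}(\Omega)^d}+C_*\|c^-\|_{L^{d/(2s)}(\Omega)}\Big)>0,$$ where $c^-=\max\{0,-c\}$ and $C_*$ is the Sobolev constant of the embedding $H^s_0(\Omega)\hookrightarrow L^{2^*}(\Omega)$, $2^*=\frac{2d}{d-2s}$. Let $g\in L^2_{loc}(\mathbb{R}^d)$ with $g\ge0$ a.e. in $\mathbb{R}^d$. Then, for any $f_\#\in L^{2^\#}(\Omega)$, $2^\#=\frac{2d}{d+2s}$, and $\boldsymbol f\in L^2(\mathbb{R}^d)^d$, there exists a unique solution to the variational inequality $$u\in\mathbb K^s_g:\qquad\mathscr L^s(u,v-u)\ge[F,v-u]_s,\quad\forall v\in\mathbb K^s_g,$$ where $\mathbb K^s_g=\{v\in H^s_0(\Omega):|D^sv|\le g\text{ a.e. in }\mathbb{R}^d\}$ and $$\mathscr L^s(u,v)=\int_{\mathbb{R}^d}AD^su\cdot D^sv+\int_\Omega u\,\boldsymbol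 d\cdot D^sv+\int_\Omega(\boldsymbol b\cdot D^su+cu)v,\qquad[F,v]_s=\int_\Omega f_\#v+\int_{\mathbb{R}^d}\boldsymbol f\cdot D^sv.$$ Moreover, if $\widehat u$ denotes the solution of the same variational inequality with $f_\#,\boldsymbol f$ replaced by $\widehat f_\#\in L^{2^\#}(\Omega)$, $\widehat{\boldsymbol f}\in L^2(\mathbb{R}^d)^d$, then $$\|u-\widehat u\|_{H^s_0(\Omega)}\le\tfrac{C_*}{\delta}\|f_\#-\widehat f_\#\|_{L^{2^\#}(\Omega)}+\tfrac1\delta\|\boldsymbol f-\widehat{\boldsymbol f}\|_{L^2(\mathbb{R}^d)^d}.$$
   Context: Functions defined on $\Omega$ are extended by zero to $\mathbb{R}^d$. For $0<s<1$, $D^s$ is the distributional Riesz fractional gradient $D^su=D(I_{1-s}*u)$, where $I_\alpha(x)=\gamma_{d,\alpha}|x|^{\alpha-d}$, $\gamma_{d,\alpha}=\frac{\Gamma((d-\alpha)/2)}{\pi^{d/2}2^\alpha\Gamma(\alpha/2)}$, $0<\alpha<1$, is the Riesz kernel; for $u\in C^\infty_c(\mathbb{R}^d)$ one has $D^su=I_{1-s}*Du$. $D^1=D$ is the classical gradient, and for $s=1$ all integrals reduce to integrals over $\Omega$. $H^s_0(\Omega)$ is the closure of $C^\infty_c(\Omega)$ (functions extended by zero) for the norm $(\|u\|^2_{L^2(\mathbb{R}^d)}+\|D^su\|^2_{L^2(\mathbb{R}^d)^d})^{1/2}$, equipped with the equivalent norm $\|u\|_{H^s_0(\Omega)}=\|D^su\|_{L^2(\mathbb{R}^d)^d}$.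 $C_*$ is a constant with $\|u\|_{L^{2^*}(\Omega)}\le C_*\|D^su\|_{L^2(\mathbb{R}^d)^d}$ for all $u\in H^s_0(\Omega)$. Extension property: the extension by zero of any $u\in H^s_0(\Omega)$ belongs to $H^s(\mathbb{R}^d)$. *)

(* Defs.v *)
From HB Require Import structures.
From mathcomp Require Import all_boot all_order all_algebra.
From mathcomp Require Import all_classical all_reals all_analysis.

Set Implicit Arguments.
Unset Strict Implicit.
Unset Printing Implicit Defensive.

Import Order.TTheory GRing.Theory Num.Theory.
Import numFieldNormedType.Exports.

Local Open Scope classical_set_scope.
Local Open Scope ring_scope.

Definition measure_rV_display : measure_display -> measure_display.
Proof. exact. Qed.

Section measurable_rV.
Context {d} {T : measurableType d}.
Variable n : nat.

Definition rV_coord (i : 'I_n) (x : 'rV[T]_n) : T := x ord0 i.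

(* The sigma-algebra generated by the coordinates, as for n.-tuple T; for T = R
   it consists of the Borel sets of R^n. *)
HB.instance Definition _ := @isMeasurable.Build (measure_rV_display d)
  'rV[T]_n (g_sigma_preimage rV_coord)
  (@sigma_algebra0 _ _ _) (@sigma_algebraC _ _)
  (@sigma_algebra_bigcup _ _ _).

End measurable_rV.

Section measurable_rV_lemmas.
Context {d} {T : measurableType d}.

Lemma measurable_rV_coord n (i : 'I_n) :
  measurable_fun [set: 'rV[T]_n] (rV_coord i).
Proof.
move=> _ Y mY; rewrite setTI; apply: sub_sigma_algebra => /=.
rewrite -bigcup_seq/=; exists i => /=; first by rewrite mem_index_enum.
by exists Y => //; rewrite setTI.
Qed.

Lemma measurable_fun_rV {d1} {T1 : measurableType d1} n (f : T1 -> 'rV[T]_n) :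
  (forall i, measurable_fun setT (rV_coord i \o f)) -> measurable_fun setT f.
Proof.
move=> fi.
have H : g_sigma_preimage (fun i => rV_coord i \o f) `<=` measurable.
  apply: smallest_sub; first exact: sigma_algebra_measurable.
  case: n f fi => [|n] f fi; first by rewrite big_ord0.
  rewrite -bigcup_mkord_ord; apply: bigcup_sub => i Ii.
  by move=> A [B mB <-]; exact: fi.
move=> _ A mA; apply: H; rewrite g_sigma_preimage_comp.
by exists A.
Qed.

Definition cons_rV n (p : T * 'rV[T]_n) : 'rV[T]_n.+1 :=
  \row_i (if unlift ord0 i is Some j then p.2 ord0 j else p.1).

Definition uncons_rV n (x : 'rV[T]_n.+1) : T * 'rV[T]_n :=
  (x ord0 ord0, \row_j x ord0 (lift ord0 j)).

Lemma cons_rVK n : cancel (@cons_rV n) (@uncons_rV n).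
Proof.
move=> [t x]; rewrite /uncons_rV /cons_rV; congr pair.
  by rewrite mxE unlift_none.
by apply/rowP => j; rewrite !mxE liftK.
Qed.

Lemma measurable_cons_rV n : measurable_fun setT (@cons_rV n).
Proof.
apply: measurable_fun_rV => i; case: (unliftP ord0 i) => [j|] ->.
  rewrite (_ : _ \o _ = rV_coord j \o snd); last first.
    by apply/funext => -[t x]; rewrite /rV_coord /= mxE liftK.
  by apply: measurableT_comp => //; exact: measurable_rV_coord.
rewrite (_ : _ \o _ = fst)//.
by apply/funext => -[t x]; rewrite /rV_coord /= mxE unlift_none.
Qed.

Lemma measurable_uncons_rV n : measurable_fun setT (@uncons_rV n).
Proof.
apply/measurable_fun_pairP; split; first exact: measurable_rV_coord.
apply: measurable_fun_rV => i.
rewrite (_ : _ \o _ = rV_coord (lift ord0 i)).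
  exact: measurable_rV_coord.
by apply/funext => x; rewrite /rV_coord/= mxE.
Qed.

End measurable_rV_lemmas.

Section lebesgue_rV.
Context {R : realType}.

Section step.
Variables (n : nat) (m : {sigma_finite_measure set 'rV[R]_n -> \bar R}).

Definition lebesgue_rV_step : set 'rV[R]_n.+1 -> \bar R :=
  pushforward (lebesgue_measure \x m)%E (@cons_rV _ R n).

HB.instance Definition _ := Measure.copy lebesgue_rV_step
  (measure_function_pushforward__canonical__measure_function_Measure
     (lebesgue_measure \x m)%E (@measurable_cons_rV _ R n)).


Let sigma_finite_step : sigma_finite setT lebesgue_rV_step.
Proof.
have /sigma_finiteP[F [TF ndF Foo]] := sigma_finiteT (@lebesgue_measure R).
have /sigma_finiteP[G [TG ndG Goo]] := sigma_finiteT m.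
exists (fun k => @uncons_rV _ R n @^-1` (F k `*` G k)) => [|k].
  rewrite -preimage_bigcup (_ : \bigcup_k (F k `*` G k) = setT) ?preimage_setT//.
  apply/seteqP; split => // -[x y] _.
  have [i _ Fix] : (\bigcup_k F k) x by rewrite -TF.
  have [j _ Gjy] : (\bigcup_k G k) y by rewrite -TG.
  exists (maxn i j) => //; split.
  - by move: x Fix; exact/subsetPset/ndF/leq_maxl.
  - by move: y Gjy; exact/subsetPset/ndG/leq_maxr.
have [mF Foo_k] := Foo k; have [mG Goo_k] := Goo k; split.
  rewrite -[X in measurable X]setTI; apply: measurable_uncons_rV => //.
  exact: measurableX.
rewrite /lebesgue_rV_step /pushforward -comp_preimage.
rewrite (_ : _ \o _ = id); last by apply/funext => p; exact: cons_rVK.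
by rewrite preimage_id product_measure1E// lte_mul_pinfty// ge0_fin_numE.
Qed.

HB.instance Definition _ := Measure_isSigmaFinite.Build _ _ _
  lebesgue_rV_step sigma_finite_step.

End step.

(* Lebesgue measure on R^n: lambda_0 is the unit mass on the one-point space and
   lambda_(n+1) is the product of the Lebesgue measure of R with lambda_n. *)
Fixpoint lebesgue_rV (n : nat) : {sigma_finite_measure set 'rV[R]_n -> \bar R} :=
  match n with
  | 0 => \d_ (0 : 'rV[R]_0)
  | k.+1 => lebesgue_rV_step (lebesgue_rV k)
  end.

Lemma lebesgue_rV_box n (A : 'I_n -> set R) : (forall i, measurable (A i)) ->
  lebesgue_rV n [set x | forall i, A i (x ord0 i)] =
  (\prod_(i < n) lebesgue_measure (A i))%E.
Proof.
elim: n A => [|n IH] A mA.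
  rewrite big_ord0 /= diracE mem_set//.
  by move=> [].
rewrite big_ord_recl -IH//= /lebesgue_rV_step /pushforward.
have mB : measurable [set x : 'rV[R]_n | forall i, A (lift ord0 i) (x ord0 i)].
  rewrite (_ : [set _ | _] = \bigcap_i
    (if insub i is Some j then
       rV_coord (j : 'I_n) @^-1` A (lift ord0 j) else setT)).
    apply: bigcapT_measurable => i.
    case: insub => [j|]; last exact: measurableT.
    by rewrite -[X in measurable X]setTI; apply: measurable_rV_coord.
  apply/seteqP; split => [x xA i _ /=|x xA i].
    by case: insub => // j; exact: xA.
  by have := xA i I; rewrite /= valK.
rewrite -product_measure1E//; last exact: mA.
congr product_measure1; apply/seteqP; split => [[t x] /= xA|[t x] [/= tA xA] i].
  split => /= [|i]; first by have := xA ord0; rewrite mxE unlift_none.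
  by have := xA (lift ord0 i); rewrite mxE liftK.
case: (unliftP ord0 i) => [j|] ->; rewrite mxE ?liftK ?unlift_none//.
Qed.

End lebesgue_rV.

Section euclidean.
Context {R : realType}.

Definition dotr n (u v : 'rV[R]_n) : R := \sum_i u ord0 i * v ord0 i.

(* The norm `|x| of the library on 'rV[R]_n is the maximum norm. *)
Definition enorm n (u : 'rV[R]_n) : R := Num.sqrt (dotr u u).

(* M applied to a vector stored as a row. *)
Definition mxapp n (M : 'M[R]_n) (v : 'rV[R]_n) : 'rV[R]_n := v *m M^T.

End euclidean.

Section function_spaces.
Context {R : realType} {d : nat}.
Local Notation space := 'rV[R]_d.
Local Notation mu := (@lebesgue_rV R d).
Implicit Types (p : \bar R) (D U : set space) (f u phi : space -> R).

(* A function on D is represented by a function on R^d, whose values outside D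
   are discarded: f \_ D is the extension by zero. *)
Definition Lp p D f : Prop := (f \_ D) \in Lfun mu p.

Definition Lpnorm p D f : R := fine 'N[mu]_p[EFin \o (f \_ D)].

Definition vLp n p D (F : space -> 'rV[R]_n) : Prop :=
  forall i, Lp p D (fun x => F x ord0 i).

Definition vLpnorm n p D (F : space -> 'rV[R]_n) : R :=
  Lpnorm p D (fun x => enorm (F x)).

Definition L1loc f : Prop :=
  forall K, compact K -> mu.-integrable K (EFin \o f).

Definition L2loc f : Prop := forall K, compact K -> Lp 2%:E K f.

Definition partial (i : 'I_d) f : space -> R :=
  fun x => 'D_(delta_mx ord0 i) f x.

Definition partials (l : seq 'I_d) f : space -> R := foldr partial f l.

Definition smooth f : Prop := forall l : seq 'I_d,
  continuous (partials l f) /\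
  (forall i x, derivable (partials l f) x (delta_mx ord0 i)).

Definition support f : set space := closure [set x | f x != 0].

Definition test_function U phi : Prop :=
  [/\ smooth phi, compact (support phi) & support phi `<=` U].

(* The distributional gradient of f is the locally integrable field w. *)
Definition is_weak_gradient f (w : space -> space) : Prop :=
  [/\ L1loc f, forall i, L1loc (fun x => w x ord0 i) &
   forall phi i, test_function setT phi ->
     \int[mu]_x (f x * partial i phi x) = - \int[mu]_x (w x ord0 i * phi x)].

End function_spaces.

Section riesz.
Context {R : realType} {d : nat}.
Local Notation space := 'rV[R]_d.
Local Notation mu := (@lebesgue_rV R d).
Implicit Types (s alpha : R) (U : set space) (u : space -> R).

Definition Gamma (z : R) : R :=
  \int[lebesgue_measure]_(t in `]0, +oo[) (t `^ (z - 1) * expR (- t)).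

Definition riesz_constant alpha : R :=
  Gamma ((d%:R - alpha) / 2) /
  (pi `^ (d%:R / 2) * 2 `^ alpha * Gamma (alpha / 2)).

Definition riesz_kernel alpha (x : space) : R :=
  riesz_constant alpha * enorm x `^ (alpha - d%:R).

Definition riesz_potential alpha u : space -> R :=
  fun x => \int[mu]_y (riesz_kernel alpha (x - y) * u y).

(* I_alpha * u converges absolutely to a locally integrable function, so that
   its distributional derivatives make sense. *)
Definition riesz_convergent alpha u : Prop :=
  forall K : set space, compact K ->
    (\int[mu]_(x in K) \int[mu]_y (`|riesz_kernel alpha (x - y) * u y|)%:E
       < +oo)%E.

(* For s = 1 the kernel I_0 is not a function and D^1 is the gradient. *)
Definition is_riesz_gradient s u (w : space -> space) : Prop :=
  if s == 1 then is_weak_gradient u w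
  else riesz_convergent (1 - s) u /\
       is_weak_gradient (riesz_potential (1 - s) u) w.

(* Determined almost everywhere when it exists; arbitrary otherwise. *)
Definition riesz_gradient s u : space -> space :=
  get [set w | is_riesz_gradient s u w].

Definition has_L2_riesz_gradient s u : Prop :=
  [/\ Lp 2%:E setT u, (exists w, is_riesz_gradient s u w) &
      vLp 2%:E setT (riesz_gradient s u)].

Definition riesz_norm s u : R :=
  Num.sqrt (Lpnorm 2%:E setT u ^+ 2 +
            vLpnorm 2%:E setT (riesz_gradient s u) ^+ 2).

(* H^s_0(U): closure of the test functions on U in the space of the u in L^2
   with D^s u in L^2; elements are functions on R^d, up to null sets. *)
Definition H0 s U u : Prop :=
  has_L2_riesz_gradient s u /\
  forall eps : R, 0 < eps -> exists phi,
    [/\ test_function U phi, has_L2_riesz_gradient s phi &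
        riesz_norm s (u \- phi) < eps].

Definition H0norm s u : R := vLpnorm 2%:E setT (riesz_gradient s u).

(* H^s(R^d): finite Gagliardo seminorm for s < 1, and W^{1,2}(R^d) for s = 1. *)
Definition Hs s u : Prop :=
  Lp 2%:E setT u /\
  if s == 1 then
    exists2 w : space -> space, is_weak_gradient u w & vLp 2%:E setT w
  else
    (\int[mu]_x \int[mu]_y
       ((u x - u y) ^+ 2 / enorm (x - y) `^ (d%:R + 2 * s))%:E < +oo)%E.

Definition extension_property s U : Prop :=
  forall u, H0 s U u -> Hs s (u \_ U).

Definition sobolev_exponent s : R := 2 * d%:R / (d%:R - 2 * s).
Definition sobolev_dual_exponent s : R := 2 * d%:R / (d%:R + 2 * s).

Definition is_sobolev_constant s U (C : R) : Prop :=
  0 <= C /\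
  forall u, H0 s U u ->
    Lp (sobolev_exponent s)%:E U u /\
    Lpnorm (sobolev_exponent s)%:E U u <= C * H0norm s u.

End riesz.

Arguments sobolev_exponent {R} d s.
Arguments sobolev_dual_exponent {R} d s.

Section variational_inequality.
Context {R : realType} {d : nat}.
Local Notation space := 'rV[R]_d.
Local Notation mu := (@lebesgue_rV R d).
Variables (s : R) (Omega : set space).
Implicit Types (u v : space -> R).

(* Domain of the integrals over R^d, which are integrals over Omega if s = 1. *)
Definition grad_domain : set space := if s == 1 then Omega else setT.

Definition bilinear_form (A : space -> 'M[R]_d) (b dd : space -> space)
    (c : space -> R) u v : R :=
  let D := riesz_gradient s in
  \int[mu]_(x in grad_domain) dotr (mxapp (A x) (D u x)) (D v x) +
  \int[mu]_(x in Omega) (u x * dotr (dd x) (D v x)) +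
  \int[mu]_(x in Omega) ((dotr (b x) (D u x) + c x * u x) * v x).

Definition load (f0 : space -> R) (f : space -> space) v : R :=
  \int[mu]_(x in Omega) (f0 x * v x) +
  \int[mu]_(x in grad_domain) dotr (f x) (riesz_gradient s v x).

Definition gradient_constraint (g : space -> R) v : Prop :=
  H0 s Omega v /\ {ae mu, forall x, enorm (riesz_gradient s v x) <= g x}.

Definition is_solution (A : space -> 'M[R]_d) (b dd : space -> space)
    (c g f0 : space -> R) (f : space -> space) u : Prop :=
  gradient_constraint g u /\
  forall v, gradient_constraint g v ->
    bilinear_form A b dd c u (v \- u) >= load f0 f (v \- u).

End variational_inequality.

(* Main.v *)
(** By Hoelder's inequality with the exponents (q, d/s, 2) and (d/(2s), q, q),
    where q = 2d/(d-2s), and by the Sobolev inequality, the form L^s is bounded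
    on H^s_0, and its lower order terms take at most a_* - delta from the
    ellipticity of A: it is coercive with constant delta. The set K_g is convex,
    and it is complete for the norm of D^s: a sequence whose increments decay
    geometrically converges in L^2 and almost everywhere together with its
    gradients, weak gradients pass to L^1_loc limits, and the constraint passes
    to limits almost everywhere. Existence is then Stampacchia's contraction
    argument. Testing the inequality of u with u' and that of u' with u, and
    adding, gives delta |w|^2 <= [F - F', w] for w = u - u', hence the stability
    estimate; if F = F', then D^s w = 0, so that w = 0 by the Poincare
    inequality.

    That D^s is well defined almost everywhere and linear follows from the
    fundamental lemma of the calculus of variations, the required test functions
    being products of the functions exp (- 1 / t) of affine coordinates, and from
    the local integrability of the Riesz kernel. *)
Require Import Defs.
From HB Require Import structures.
From mathcomp Require Import all_boot all_order all_algebra.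
From mathcomp Require Import all_classical all_reals all_analysis measurable_realfun ess_sup_inf.
From mathcomp Require Import ring lra.
Set Implicit Arguments.
Unset Strict Implicit.
Unset Printing Implicit Defensive.
Import Order.TTheory GRing.Theory Num.Theory.
Import numFieldNormedType.Exports.
Local Open Scope classical_set_scope.
Local Open Scope ring_scope.

(** * Stampacchia's theorem *)

(** Elements of H^s_0 are functions, not classes, and [riesz_gradient] picks one representative, so
    the form [gip] is a priori only semidefinite and identities between gradients hold almost
    everywhere. Stampacchia's theorem is therefore proved for a semidefinite form on a subset closed
    under linear combinations, with no quotient and no ambient Hilbert space. Completeness is asked
    of the convex set alone, and only along sequences with geometrically decaying increments: the
    two limits taken, of a minimising sequence and of Banach iterates, come with such rates, and the
    rates give almost everywhere convergence without subsequences.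

    The obstacle for s < 1 is that the gradient is that of a Riesz potential, whose convergence must
    be shown for the limit function. Limits vanish outside the bounded set, hence are integrable,
    and I_(1-s) maps L^1 to L^1_loc. [riesz_lift] lets s < 1 and s = 1 share this argument. For s =
    1 the integrals over Omega extend to R^d because gradients vanish almost everywhere outside
    Omega, which passes from test functions to their closure. *)

Section stampacchia.
Context {R : realType} {V : lmodType R}.
Variables (S : set V) (ip : V -> V -> R).
Hypothesis S_lin : forall k u v, S u -> S v -> S (k *: u + v).
Hypothesis ipC : forall u v, S u -> S v -> ip u v = ip v u.
Hypothesis ip_linl : forall k u v w, S u -> S v -> S w ->
  ip (k *: u + v) w = k * ip u w + ip v w.
Hypothesis ip_ge0 : forall u, S u -> 0 <= ip u u.

Let nrm u := Num.sqrt (ip u u).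

(** Linearity is required on [S] only: outside H^s_0 the gradient may be an arbitrary choice, and
    real integrals of non-integrable functions need not be additive. *)
Definition linear_on (F : V -> R) := forall k u v, S u -> S v ->
  F (k *: u + v) = k * F u + F v.

Let S_sub u v : S u -> S v -> S (u - v).
Proof. by move=> Su Sv; rewrite addrC -scaleN1r; exact: S_lin. Qed.

Let S_add u v : S u -> S v -> S (u + v).
Proof. by move=> Su Sv; rewrite -[u]scale1r; exact: S_lin. Qed.

Lemma linear_onB F u v : linear_on F -> S u -> S v -> F (u - v) = F u - F v.
Proof.
by move=> FL Su Sv; rewrite addrC -scaleN1r FL// mulN1r addrC.
Qed.

Let ip_linr k u v w : S u -> S v -> S w ->
  ip w (k *: u + v) = k * ip w u + ip w v.
Proof. by move=> Su Sv Sw; rewrite ![ip w _]ipC ?ip_linl//; exact: S_lin. Qed.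

Lemma nrm_sqr u : S u -> Num.sqrt (ip u u) ^+ 2 = ip u u.
Proof. by move=> Su; rewrite sqr_sqrtr// ip_ge0. Qed.

Lemma ip_expand k u v : S u -> S v ->
  ip (k *: u + v) (k *: u + v) = k ^+ 2 * ip u u + 2 * k * ip u v + ip v v.
Proof.
move=> Su Sv; have Sw := S_lin k Su Sv.
by rewrite ip_linl// !ip_linr// (ipC Sv Su); ring.
Qed.

(** Since the form is only semidefinite, dividing by [ip u u] fails for null vectors [u]. For these,
    [ip (k *: u + v) (k *: u + v)] is affine in [k] and nonnegative, so its slope [2 * ip u v]
    vanishes. *)
Lemma ip_CS u v : S u -> S v -> `|ip u v| <= nrm u * nrm v.
Proof.
move=> Su Sv; rewrite -ler_sqr ?nnegrE ?mulr_ge0 ?sqrtr_ge0// exprMn !nrm_sqr//.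
rewrite real_normK ?num_real//.
have H k : 0 <= k ^+ 2 * ip u u + 2 * k * ip u v + ip v v.
  by rewrite -ip_expand// ip_ge0//; exact: S_lin.
have [u0|u0] := eqVneq (ip u u) 0; last first.
  have u1 : 0 < ip u u by rewrite lt_neqAle eq_sym u0 ip_ge0.
  have := H (- ip u v / ip u u).
  rewrite (_ : _ + _ = (ip u u * ip v v - ip u v ^+ 2) / ip u u); last by field.
  by rewrite pmulr_lge0 ?invr_gt0// subr_ge0.
rewrite u0 mul0r; have [->|uv0] := eqVneq (ip u v) 0; first by rewrite expr0n.
(* At this [k] the affine function would take the value -1. *)
have := H (- (ip v v + 1) / (2 * ip u v)); rewrite u0 mulr0 add0r.
rewrite (_ : _ + _ = -1); first by rewrite lerNr oppr0 ler10.
by field.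
Qed.

Lemma nrmD u v : S u -> S v -> nrm (u + v) <= nrm u + nrm v.
Proof.
move=> Su Sv; rewrite -ler_sqr ?nnegrE ?addr_ge0 ?sqrtr_ge0//.
rewrite nrm_sqr; last exact: S_add.
have := ip_expand 1 Su Sv; rewrite scale1r => ->.
rewrite sqrrD !nrm_sqr//; have := ip_CS Su Sv.
by move/(le_trans (ler_norm _)); lra.
Qed.

Lemma nrmZ k u : S u -> nrm (k *: u) = `|k| * nrm u.
Proof.
move=> Su; have S0 : S 0 by rewrite -(subrr u); exact: S_sub.
have l0 v : S v -> ip v 0 = 0.
  by move=> Sv; have := ip_linr (-1) Sv Sv Sv; rewrite scaleN1r addNr => ->; ring.
rewrite /nrm -[k *: u]addr0 ip_expand// !l0// mulr0 !addr0.
by rewrite sqrtrM ?sqr_ge0// sqrtr_sqr.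
Qed.

Lemma nrmBC u v : S u -> S v -> nrm (u - v) = nrm (v - u).
Proof.
move=> Su Sv; rewrite (_ : u - v = (-1) *: (v - u)); last by rewrite scaleN1r opprB.
rewrite nrmZ; last exact: S_sub.
by rewrite normrN1 mul1r.
Qed.

Section minimisation.
Variable K : set V.
Hypothesis KS : K `<=` S.
Hypothesis K_convex : forall t u v, K u -> K v -> 0 <= t <= 1 ->
  K (t *: (v - u) + u).
Hypothesis K_neq0 : K !=set0.
Hypothesis K_complete : forall (u : nat -> V) (C k : R), 0 < k < 1 ->
  (forall n, K (u n)) -> (forall n, nrm (u n.+1 - u n) <= C * k ^+ n) ->
  exists2 v, K v & (fun n => nrm (u n - v)) @ \oo --> (0 : R).

(** The direct method for [J v = ip v v / 2 - G v] on [K]: the conclusion is the first order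
    condition at a minimiser. The minimiser plays the role of the projection onto [K] of a vector
    representing [G], but no such vector has to exist. *)
Lemma projection_exists (G : V -> R) (N : R) : linear_on G ->
  (forall v, S v -> `|G v| <= N * nrm v) ->
  exists2 u, K u & forall v, K v -> G (v - u) <= ip u (v - u).
Proof.
move=> GL GN; pose J v := ip v v / 2 - G v.
have GNn v : S v -> `|G v| <= `|N| * nrm v.
  by move=> /GN/le_trans; apply; rewrite ler_wpM2r ?sqrtr_ge0// ler_norm.
have J_lb : has_lbound [set J v | v in K].
  exists (- (N ^+ 2 / 2)) => _ [v /KS Sv <-].
  have := GN _ Sv; move/(le_trans (ler_norm _)); rewrite /J -(nrm_sqr Sv).
  by have := sqr_ge0 (nrm v - N); rewrite sqrrB /nrm; lra.
have J_inf : has_inf [set J v | v in K].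
  by split=> //; case: K_neq0 => v Kv; exists (J v), v.
pose m := inf [set J v | v in K].
have mJ v : K v -> m <= J v by move=> Kv; apply: ge_inf => //; exists v.
have expandJ t u v : S u -> S v -> J (t *: v + u) =
    J u + t * (ip u v - G v) + t ^+ 2 / 2 * ip v v.
  move=> Su Sv; rewrite /J ip_expand// GL// (ipC Sv Su); lra.
(* At a midpoint, [J] is the mean of its two values minus one eighth of the squared distance. As it
   is at least [m] there, the precision [4^-1 ^+ n / 8] forces increments below [2^-1 ^+ n], a rate
   that [K_complete] accepts. *)
have /boolp.choice[x xP] : forall n : nat, exists v,
    K v /\ J v < m + 4^-1 ^+ n / 8.
  move=> n.
  have e0 : 0 < 4^-1 ^+ n / 8 :> R by rewrite divr_gt0// exprn_gt0// invr_gt0.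
  by have [_ [v Kv <-] Jv] := inf_adherent e0 J_inf; exists v.
have xK n : K (x n) by have [] := xP n.
have xS n : S (x n) by apply: KS.
have xm n : J (x n) <= m + 4^-1 ^+ n / 8 by have [_ /ltW] := xP n.
have x_cauchy n : nrm (x n.+1 - x n) <= 1 * 2^-1 ^+ n.
  rewrite mul1r -ler_sqr ?nnegrE ?sqrtr_ge0 ?exprn_ge0 ?invr_ge0//.
  have Sd : S (x n.+1 - x n) by exact: S_sub.
  rewrite nrm_sqr// exprAC.
  have /mJ : K (2^-1 *: (x n.+1 - x n) + x n).
    by apply: K_convex => //; rewrite invr_ge0 ler0n/= invf_le1//; lra.
  rewrite expandJ//.
  have := expandJ 1 _ _ (xS n) Sd; rewrite scale1r subrK => Jn.
  have := xm n; have := xm n.+1; rewrite Jn.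
  rewrite [4^-1 ^+ n.+1]exprS (_ : 2^-1 ^+ 2 = 4^-1); last by field.
  have : 0 <= 4^-1 ^+ n :> R by rewrite exprn_ge0// invr_ge0.
  by lra.
have [u Ku xu] := K_complete (ltac:(lra) : 0 < 2^-1 < 1) xK x_cauchy.
have Su := KS Ku.
have Jum : J u <= m.
  (* Expanding [J (x n)] around [u] and dropping the square leaves this upper bound of [J u], which
     tends to [m]. *)
  pose y n := m + 4^-1 ^+ n / 8 + (nrm u + `|N|) * nrm (x n - u).
  have yn n : J u <= y n.
    have Sd : S (x n - u) by exact: S_sub.
    have := expandJ 1 _ _ Su Sd; rewrite scale1r subrK => Jn.
    have := xm n; rewrite Jn /y.
    have := ip_CS Su Sd; rewrite -normrN => /(le_trans (ler_norm _)).
    have := GNn _ Sd => /(le_trans (ler_norm _)).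
    have := ip_ge0 Sd; lra.
  have yc : y @ \oo --> m.
    rewrite (_ : m = m + 0 / 8 + (nrm u + `|N|) * 0); last by ring.
    apply: cvgD; last by apply: cvgM => //; exact: cvg_cst.
    apply: cvgD; first exact: cvg_cst.
    apply: cvgM; last exact: cvg_cst.
    by apply: cvg_expr; rewrite ger0_norm ?invr_ge0// invf_lt1//; lra.
  rewrite -(cvg_lim (@Rhausdorff R) yc).
  by apply: limr_ge; [apply/cvg_ex; exists m | exact: nearW].
exists u => // v Kv; have Sv := KS Kv.
have Sd : S (v - u) by exact: S_sub.
rewrite leNgt; apply/negP => lt.
pose e := G (v - u) - ip u (v - u); pose q := ip (v - u) (v - u).
have e0 : 0 < e by rewrite subr_gt0.
have q0 : 0 <= q by exact: ip_ge0.
(* This step stays in the unit interval, even if [q = 0], and satisfies [t * q <= e], so that moving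
   from [u] towards [v] lowers [J] by at least [t * e / 2]. *)
pose t := e / (e + q).
have eq0 : 0 < e + q by lra.
have t01 : 0 <= t <= 1.
  by rewrite divr_ge0 ?(ltW e0) ?(ltW eq0)//= ler_pdivrMr// mul1r; lra.
have := le_trans Jum (mJ _ (K_convex Ku Kv t01)); rewrite expandJ// -/q.
have -> : ip u (v - u) - G (v - u) = - e by rewrite /e; ring.
have -> : J u + t * - e + t ^+ 2 / 2 * q = J u - t * (e - t * q / 2).
  by ring.
have tp : 0 < t by rewrite divr_gt0.
have : 0 < t * (e - t * q / 2).
  apply: mulr_gt0 => //; have : t * q <= e; last by lra.
  by rewrite /t mulrAC ler_pdivrMr// ler_wpM2l ?(ltW e0)//; lra.
by lra.
Qed.

Variables (a : V -> V -> R) (F : V -> R) (M N delta : R).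
Hypothesis a_linl : forall w, S w -> linear_on (a ^~ w).
Hypothesis a_linr : forall w, S w -> linear_on (a w).
Hypothesis F_lin : linear_on F.
Hypothesis a_bounded : forall u v, S u -> S v -> `|a u v| <= M * nrm u * nrm v.
Hypothesis F_bounded : forall v, S v -> `|F v| <= N * nrm v.
Hypothesis delta_gt0 : 0 < delta.
Hypothesis M_gt0 : 0 < M.
Hypothesis a_coercive : forall u, S u -> delta * ip u u <= a u u.

(** The minimiser of [(1 - rho * delta) ^+ 2 + (rho * M) ^+ 2], the squared contraction factor found
    below. Its minimum is [M ^+ 2 / (delta ^+ 2 + M ^+ 2)], which lies strictly between 0 and 1
    without any comparison of [delta] with [M]. *)
Let rho := delta / (delta ^+ 2 + M ^+ 2).
Let k := Num.sqrt (1 - delta ^+ 2 / (delta ^+ 2 + M ^+ 2)).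

Let D0 : 0 < delta ^+ 2 + M ^+ 2.
Proof. by rewrite addr_gt0// exprn_gt0. Qed.

Let rho_gt0 : 0 < rho.
Proof. by rewrite divr_gt0. Qed.

Let k01 : 0 < k < 1.
Proof.
have e : 1 - delta ^+ 2 / (delta ^+ 2 + M ^+ 2) = M ^+ 2 / (delta ^+ 2 + M ^+ 2).
  by field; rewrite gt_eqF.
rewrite /k e sqrtr_gt0 divr_gt0 ?exprn_gt0//= -sqrtr1 ltr_sqrt//.
by rewrite ltr_pdivrMr// mul1r ltrDr exprn_gt0.
Qed.

(* This is [|z - rho B z| <= k |z|] for the operator [B] representing [a],
   which by orthogonal decomposition needs no Riesz representation. *)
Let contraction z y : S z -> S y -> ip z y - rho * a z y <= k * nrm z * nrm y.
Proof.
move=> Sz Sy; have /andP[k0 k1] := k01.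
have CS := ip_CS Sz Sy; have ab := a_bounded Sz Sy.
have [z0|z0] := eqVneq (nrm z) 0.
  move: CS ab; rewrite z0 !(mul0r, mulr0).
  by rewrite !normr_le0 => /eqP -> /eqP ->; rewrite mulr0 subr0.
have Z2 := nrm_sqr Sz; rewrite -/(nrm z) in Z2.
have zz0 : ip z z != 0 by rewrite -Z2 sqrf_eq0.
have zp : 0 < nrm z by rewrite lt_neqAle eq_sym z0 sqrtr_ge0.
(* [y'] is the part of [y] orthogonal to [z]. Coercivity acts along [z], while only the bound [M] is
   available for [a z y']. *)
pose al := ip z y / ip z z; pose y' := (- al) *: z + y.
have Sy' : S y' by exact: S_lin.
have yE : y = al *: z + y' by rewrite /y' scaleNr addNKr.
have zy' : ip z y' = 0 by rewrite /y' ip_linr// /al; field.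
have nyE : nrm y ^+ 2 = al ^+ 2 * nrm z ^+ 2 + nrm y' ^+ 2.
  by rewrite !nrm_sqr// {1 2}yE ip_expand// zy'; ring.
rewrite {1 2}yE ip_linr// (a_linr Sz)// zy' addr0.
have az := a_coercive Sz.
have azM := le_trans (ler_norm _) (a_bounded Sz Sz).
have azy' := a_bounded Sz Sy'.
rewrite -mulrA -expr2 Z2 in azM.
(* It gives [rho * a z z <= ip z z], so that the absolute value in [h1] opens with a known sign. *)
have rM : rho * M <= 1.
  rewrite /rho mulrAC ler_pdivrMr// mul1r.
  by have := sqr_ge0 (delta - M); have := sqr_ge0 (delta + M); rewrite sqrrB sqrrD; lra.
have h1 : `|ip z z - rho * a z z| <= (1 - rho * delta) * ip z z.
  have ra1 : rho * (delta * ip z z) <= rho * a z z by rewrite ler_pM2l.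
  have ra2 : rho * a z z <= ip z z.
    rewrite (le_trans (_ : _ <= rho * (M * ip z z)))// ?ler_pM2l//.
    by rewrite mulrA ler_piMl// ip_ge0.
  by rewrite ger0_norm; lra.
have h2 : al * ip z z - rho * (al * a z z + a z y') <=
   nrm z * (`|al| * nrm z * (1 - rho * delta) + rho * M * nrm y').
  rewrite (_ : _ - _ = al * (ip z z - rho * a z z) + rho * - a z y'); last by ring.
  rewrite [leRHS]mulrDr; apply: lerD.
    rewrite (le_trans (ler_norm _))// normrM (_ : nrm z * _ =
      `|al| * ((1 - rho * delta) * (nrm z) ^+ 2)); last by ring.
    by rewrite Z2 ler_wpM2l.
  rewrite (_ : nrm z * _ = rho * (M * nrm z * nrm y')); last by ring.
  by rewrite ler_pM2l// (le_trans (ler_norm _))// normrN.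
apply: (le_trans h2).
rewrite (_ : k * nrm z * nrm y = nrm z * (k * nrm y)); last by ring.
rewrite ler_pM2l//.
have rd : 0 <= 1 - rho * delta.
  have e : 1 - rho * delta = M ^+ 2 / (delta ^+ 2 + M ^+ 2).
    by rewrite /rho; field; rewrite gt_eqF.
  by rewrite e divr_ge0 ?exprn_ge0 ?ltW.
rewrite -ler_sqr ?nnegrE; last 2 first.
- apply: addr_ge0; first by rewrite mulr_ge0// mulr_ge0// sqrtr_ge0.
  by apply: mulr_ge0; [rewrite mulr_ge0// ltW | exact: sqrtr_ge0].
- by rewrite mulr_ge0 ?sqrtr_ge0// ltW.
rewrite exprMn nyE /k sqr_sqrtr; last first.
  rewrite subr_ge0 ler_pdivrMr// mul1r lerDl exprn_ge0// ltW//.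
have -> : 1 - delta ^+ 2 / (delta ^+ 2 + M ^+ 2) =
    (1 - rho * delta) ^+ 2 + (rho * M) ^+ 2.
  by rewrite /rho; field; rewrite gt_eqF.
rewrite -(real_normK (num_real al)).
(* What is left is Cauchy-Schwarz in the plane for the vectors (p |z|, |y'|) and (q, r), whose
   defect is a perfect square. *)
set p := `|al|; set q := 1 - rho * delta; set r := rho * M.
rewrite -subr_ge0 (_ : _ - _ = (p * nrm z * r - q * nrm y') ^+ 2); last by ring.
exact: sqr_ge0.
Qed.

(** [T w] solves the projection problem for [G w = ip w - rho * (a w - F)]. At a fixed point the
    terms in [ip] cancel, and division by [rho] leaves the inequality. Testing the problem of [T w1]
    with [T w2], and conversely, and applying [contraction] to [w1 - w2] and [T w1 - T w2], makes
    [T] a contraction. *)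
Lemma stampacchia : exists2 u, K u & forall v, K v -> F (v - u) <= a u (v - u).
Proof.
have /andP[k0 k1] := k01.
pose G w v := ip w v - rho * (a w v - F v).
have /boolp.choice[T TP] : forall w, exists u, S w -> K u /\
    forall v, K v -> G w (v - u) <= ip u (v - u).
  move=> w.
  have [Sw|nSw] := pselect (S w); last by exists w.
  have [| |u Ku uP] := @projection_exists (G w) (nrm w + rho * (M * nrm w + N)).
  - move=> c u v Su Sv; rewrite /G ip_linr// a_linr// F_lin//; ring.
  - move=> v Sv; rewrite /G (le_trans (ler_normB _ _))// mulrDl lerD ?ip_CS//.
    rewrite normrM gtr0_norm// -mulrA ler_pM2l// (le_trans (ler_normB _ _))//.
    by rewrite mulrDl lerD ?F_bounded// a_bounded.
  by exists u.
have TK w : S w -> K (T w) by move=> /TP[].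
have Tip w v : S w -> K v -> G w (v - T w) <= ip (T w) (v - T w).
  by move=> /TP[_]; exact.
have Tcontr w1 w2 : S w1 -> S w2 -> nrm (T w1 - T w2) <= k * nrm (w1 - w2).
  move=> S1 S2; have K1 := TK _ S1; have K2 := TK _ S2.
  have ST1 := KS K1; have ST2 := KS K2.
  have Sz := S_sub S1 S2; have Sy := S_sub ST1 ST2.
  have := Tip _ _ S1 K2; have := Tip _ _ S2 K1.
  rewrite -[T w2 - T w1]opprB.
  set y := T w1 - T w2; set z := w1 - w2.
  have linN H : linear_on H -> H (- y) = - H y.
    move=> HL; have H0 : H 0 = 0.
      by have := linear_onB HL Sy Sy; rewrite !subrr.
    by have := HL (-1) _ _ Sy (S_sub Sy Sy); rewrite scaleN1r subrr addr0 H0; lra.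
  have ipl w : S w -> linear_on (ip w) by move=> Sw c u v Su Sv; exact: ip_linr.
  rewrite /G !linN//; try by [exact: ipl|exact: a_linr].
  move=> i1 i2.
  have := contraction Sz Sy.
  have -> : ip z y = ip w1 y - ip w2 y.
    by rewrite /z addrC -scaleN1r ip_linl//; ring.
  have -> : a z y = a w1 y - a w2 y.
    by have /linear_onB -> := a_linl Sy.
  move=> i3.
  have yy : ip y y = ip (T w1) y - ip (T w2) y.
    by rewrite {1}/y addrC -scaleN1r ip_linl//; ring.
  have [y0|y0] := eqVneq (nrm y) 0.
    by rewrite y0 mulr_ge0 ?sqrtr_ge0// ltW.
  have yp : 0 < nrm y by rewrite lt_neqAle eq_sym y0 sqrtr_ge0.
  rewrite -(ler_pM2r yp) -expr2 nrm_sqr// yy.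
  by move: i1 i2 i3; lra.
have [w0 Kw0] := K_neq0.
pose x n := iter n T w0.
have xK n : K (x n) by elim: n => [//|n IH]; apply: TK; exact: KS.
have xS n := KS (xK n).
have x_cauchy n : nrm (x n.+1 - x n) <= nrm (x 1 - x 0) * k ^+ n.
  elim: n => [|n IH]; first by rewrite expr0 mulr1.
  rewrite (le_trans (Tcontr _ _ (xS n.+1) (xS n)))// exprS mulrCA.
  by rewrite ler_pM2l.
have [w Kw xw] := K_complete k01 xK x_cauchy.
have Sw := KS Kw; have STw := KS (TK _ Sw).
have Sd := S_sub STw Sw.
have Tw0 : nrm (T w - w) = 0.
  apply/eqP; rewrite eq_le sqrtr_ge0 andbT.
  pose y n := k * nrm (x n - w) + nrm (x n.+1 - w).
  have yn n : nrm (T w - w) <= y n.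
    have Sx : S (x n.+1 - T w) by exact: S_sub.
    have -> : T w - w = (T w - x n.+1) + (x n.+1 - w) by rewrite addrA subrK.
    have STx := S_sub STw (xS n.+1); have Sxw := S_sub (xS n.+1) Sw.
    rewrite (le_trans (nrmD _ _))// lerD//.
    by rewrite nrmBC//; exact: Tcontr.
  have yc : y @ \oo --> (0 : R).
    rewrite (_ : 0 = k * 0 + 0); last by ring.
    apply: cvgD; first by apply: cvgM => //; exact: cvg_cst.
    by rewrite (cvg_shiftS (fun n => nrm (x n - w))).
  rewrite -(cvg_lim (@Rhausdorff R) yc).
  by apply: limr_ge; [apply/cvg_ex; exists 0 | exact: nearW].
(* The limit [w] is a fixed point only up to a null vector. [T w] is the witness because its own
   inequality is at hand, and neither [ip] nor [a] distinguishes it from [w]. *)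
exists (T w); first exact: TK.
move=> v Kv; have Sv := S_sub (KS Kv) STw.
have := Tip _ _ Sw Kv; rewrite /G.
have i0 : ip (T w) (v - T w) - ip w (v - T w) = 0.
  have := ip_CS Sd Sv; rewrite Tw0 mul0r normr_le0 => /eqP.
  by rewrite addrC -scaleN1r ip_linl// mulN1r addrC.
have a0 : a (T w) (v - T w) - a w (v - T w) = 0.
  have := a_bounded Sd Sv; rewrite Tw0 mulr0 mul0r normr_le0 => /eqP <-.
  by have /linear_onB -> := a_linl Sv.
move=> h; have : rho * (F (v - T w) - a w (v - T w)) <= 0 by lra.
by rewrite pmulr_rle0//; lra.
Qed.

End minimisation.
End stampacchia.

(** * Lebesgue spaces *)

Section Lfun_theory.
Context d (T : measurableType d) (R : realType).
Variable mu : {measure set T -> \bar R}.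
Implicit Types (f g : T -> R) (p q r : R).

Local Notation nrm p f := (fine 'N[mu]_p%:E[EFin \o f]).

Lemma LfunE p f : 0 < p -> f \in Lfun mu p%:E <->
  measurable_fun setT f /\ (\int[mu]_x (`|f x| `^ p)%:E < +oo)%E.
Proof.
move=> p0; rewrite inE; split.
- move=> /andP[]; rewrite !inE/= => mf /(poweR_lty p).
  rewrite poweR_Lnorm ?gt_eqF// => h; split => //.
- move=> [mf h]; apply/andP; rewrite !inE/=; split => //.
  by rewrite /finite_norm unlock/=; exact: poweR_lty.
Qed.

Lemma Lfun_measurable (p : \bar R) f : f \in Lfun mu p -> measurable_fun setT f.
Proof. by rewrite inE => /andP[]; rewrite !inE. Qed.

Lemma measurable_powR_norm f p : measurable_fun setT f ->
  measurable_fun setT (fun x => `|f x| `^ p).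
Proof.
move=> mf; apply: (measurableT_comp (measurable_powR _)) => //.
exact: measurableT_comp.
Qed.

Lemma powR_Lnorm_fine p f : 0 < p ->
  nrm p f `^ p = \int[mu]_x (`|f x| `^ p).
Proof.
by move=> p0; rewrite -fine_poweR poweR_Lnorm ?gt_eqF.
Qed.

Lemma Lnorm_fineE p f : nrm p f = (\int[mu]_x (`|f x| `^ p)) `^ p^-1.
Proof. by rewrite unlock/= fine_poweR. Qed.

Lemma Lfun_integrable_powR p f : 0 < p -> f \in Lfun mu p%:E ->
  mu.-integrable setT (fun x => (`|f x| `^ p)%:E).
Proof.
move=> p0 /(LfunE _ p0)[mf lty]; apply/integrableP; split.
  by apply/measurable_EFinP; exact: measurable_powR_norm.
by under eq_integral => x _ do rewrite gee0_abs ?lee_fin ?powR_ge0//.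
Qed.

Lemma Lnorm_fine_ge0 (p : \bar R) f : 0 <= fine 'N[mu]_p[EFin \o f].
Proof. by rewrite fine_ge0// Lnorm_ge0. Qed.

Lemma Lfun_le p f g : 0 < p -> measurable_fun setT f ->
  (forall x, `|f x| <= `|g x|) -> g \in Lfun mu p%:E ->
  f \in Lfun mu p%:E /\ nrm p f <= nrm p g.
Proof.
move=> p0 mf fg Lg; have [mg glt] := (LfunE g p0).1 Lg.
have fgp x : `|f x| `^ p <= `|g x| `^ p by rewrite ge0_ler_powR ?nnegrE// ltW.
have Lf : f \in Lfun mu p%:E.
  apply/(LfunE f p0); split; first exact: mf.
  apply: le_lt_trans glt.
  apply: ge0_le_integral => //.
  - by apply/measurable_EFinP; exact: measurable_powR_norm.
  - by apply/measurable_EFinP; exact: measurable_powR_norm.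
  - by move=> x _; rewrite lee_fin.
split => //; rewrite !Lnorm_fineE ge0_ler_powR ?nnegrE ?invr_ge0 ?(ltW p0)//.
- by apply: Rintegral_ge0 => x _; exact: powR_ge0.
- by apply: Rintegral_ge0 => x _; exact: powR_ge0.
- by apply: le_Rintegral => //; exact: Lfun_integrable_powR.
Qed.

Lemma ae_eq_Rintegral f g : measurable_fun setT f -> measurable_fun setT g ->
  {ae mu, forall x, f x = g x} -> \int[mu]_x f x = \int[mu]_x g x.
Proof.
move=> mf mg fg; congr fine; apply: ae_eq_integral => //.
- exact/measurable_EFinP.
- exact/measurable_EFinP.
- by apply: filterS fg => x fgx _; rewrite fgx.
Qed.

Lemma ae_eq_Lnorm (p : \bar R) f g : measurable_fun setT f -> measurable_fun setT g ->
  {ae mu, forall x, f x = g x} -> p != +oo%E -> p != -oo%E ->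
  ('N[mu]_p[EFin \o f] = 'N[mu]_p[EFin \o g])%E.
Proof.
move=> mf mg fg; case: p => [p| |]; [move=> _ _|by rewrite eqxx|by rewrite eqxx].
rewrite unlock/=; congr (_ `^ _)%E.
apply: ae_eq_integral => //.
- by apply/measurable_EFinP; exact: measurable_powR_norm.
- by apply/measurable_EFinP; exact: measurable_powR_norm.
- by apply: filterS fg => x fgx _; rewrite /= fgx.
Qed.

Lemma ae_eq_Lfun p f g : 0 < p -> measurable_fun setT g ->
  {ae mu, forall x, f x = g x} -> f \in Lfun mu p%:E -> g \in Lfun mu p%:E.
Proof.
move=> p0 mg fg Lf; have mf := Lfun_measurable Lf.
move: Lf; rewrite !inE => /andP[_]; rewrite inE/= => Lf; apply/andP.
by split; rewrite inE//= /finite_norm -(ae_eq_Lnorm mf mg fg).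
Qed.

(** Hoelder's inequality for the conjugate exponents [p / r] and [q / r], applied to [|f| ^ r] and
    [|g| ^ r]. *)
Lemma Lfun_mul p q r f g : 0 < p -> 0 < q -> 0 < r -> p^-1 + q^-1 = r^-1 ->
  f \in Lfun mu p%:E -> g \in Lfun mu q%:E ->
  (f \* g) \in Lfun mu r%:E /\ nrm r (f \* g) <= nrm p f * nrm q g.
Proof.
move=> p0 q0 r0 pqr Lf Lg.
have [mf flt] := (LfunE f p0).1 Lf; have [mg glt] := (LfunE g q0).1 Lg.
pose F x := `|f x| `^ r; pose G x := `|g x| `^ r.
have mpow (h : T -> R) a : measurable_fun setT h ->
    measurable_fun setT (fun x => `|h x| `^ a).
  exact: measurable_powR_norm.
have NF (h : T -> R) a : 0 < a ->
  ('N[mu]_((a / r)%R)%:E[EFin \o (fun x => (`|h x| `^ r)%R)] = 'N[mu]_a%:E[EFin \o h] `^ r)%E.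
  move=> a0; rewrite unlock/= -poweRrM invf_div [(_ * r)%R]mulrC; congr (_ `^ _)%E.
  apply: eq_integral => x _; congr EFin.
  by rewrite ger0_norm ?powR_ge0// -powRrM mulrC divfK ?gt_eqF.
have H := @hoelder _ _ _ mu F G (p / r) (q / r) (mpow _ _ mf) (mpow _ _ mg).
have {}H : ('N[mu]_1[EFin \o (F \* G)%R] <= ('N[mu]_p%:E[EFin \o f] * 'N[mu]_q%:E[EFin \o g]) `^ r)%E.
  rewrite poweRM ?Lnorm_ge0// -!NF//; apply: H; rewrite ?divr_gt0//.
  by rewrite !invf_div -mulrDr pqr divff// gt_eqF.
have Nlt a h : 0 < a -> h \in Lfun mu a%:E -> ('N[mu]_a%:E[EFin \o h] < +oo)%E.
  by move=> a0; rewrite inE => /andP[_]; rewrite inE.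
have Nfin a h : 0 < a -> h \in Lfun mu a%:E -> ('N[mu]_a%:E[EFin \o h])%E \is a fin_num.
  by move=> a0 Lh; rewrite ge0_fin_numE ?Lnorm_ge0// Nlt.
have fgE : ('N[mu]_1[EFin \o (F \* G)%R] = \int[mu]_x (`|(f \* g)%R x| `^ r)%:E)%E.
  rewrite Lnorm1; apply: eq_integral => x _; congr EFin.
  by rewrite [in RHS]/= [in RHS]normrM [RHS]powRM// ger0_norm// mulr_ge0 ?powR_ge0.
rewrite fgE in H.
have Lfg : (f \* g) \in Lfun mu r%:E.
  apply/(LfunE _ r0); split; first exact: measurable_funM.
  apply: (le_lt_trans H); apply: poweR_lty.
  by rewrite lte_mul_pinfty ?Lnorm_ge0// ?Nfin// Nlt.
split => //.
rewrite -fineM ?Nfin//; apply: fine_le; rewrite ?Nfin//.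
  by rewrite fin_numM ?Nfin.
rewrite (_ : 'N[mu]_r%:E[EFin \o (f \* g)%R]%E =
  ((\int[mu]_x (`|(f \* g)%R x| `^ r)%:E) `^ r^-1)%E); last by rewrite unlock.
apply: le_trans (_ : _ <= (('N[mu]_p%:E[EFin \o f] * 'N[mu]_q%:E[EFin \o g]) `^ r) `^ r^-1)%E _.
  apply: gt0_ler_poweR => //; rewrite ?invr_ge0 ?ltW//.
  - rewrite in_itv/= leey andbT; apply: integral_ge0 => x _.
    by rewrite lee_fin powR_ge0.
  - by rewrite in_itv/= leey andbT poweR_ge0.
by rewrite -poweRrM mulfV ?gt_eqF// poweRe1// mule_ge0 ?Lnorm_ge0.
Qed.

Lemma Lfun_mul_integrable p q f g : 0 < p -> 0 < q -> p^-1 + q^-1 = 1 ->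
  f \in Lfun mu p%:E -> g \in Lfun mu q%:E ->
  mu.-integrable setT (EFin \o (f \* g)) /\
  \int[mu]_x `|f x * g x| <= nrm p f * nrm q g.
Proof.
move=> p0 q0 pq Lf Lg.
have [|H1 H2] := @Lfun_mul p q 1 f g p0 q0 ltr01 _ Lf Lg; first by rewrite invr1.
split; first exact/Lfun1_integrable.
by move: H2; rewrite Lnorm1.
Qed.

Lemma sqr_Lnorm2 f : nrm 2 f ^+ 2 = \int[mu]_x (f x ^+ 2).
Proof.
rewrite -powR_mulrn ?Lnorm_fine_ge0// powR_Lnorm_fine//.
by congr fine; apply: eq_integral => x _; rewrite powR_mulrn// real_normK// num_real.
Qed.

Lemma Lnorm2_sqrt f : nrm 2 f = Num.sqrt (\int[mu]_x (f x ^+ 2)).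
Proof. by rewrite -sqr_Lnorm2 sqrtr_sqr ger0_norm// Lnorm_fine_ge0. Qed.

Lemma Lfun2E f : f \in Lfun mu 2%:E <->
  measurable_fun setT f /\ (\int[mu]_x (f x ^+ 2)%:E < +oo)%E.
Proof.
rewrite LfunE//; under eq_integral.
  by move=> x _; rewrite powR_mulrn// real_normK ?num_real//; over.
by [].
Qed.

Lemma Lfun2_mul_integrable f g : f \in Lfun mu 2%:E -> g \in Lfun mu 2%:E ->
  mu.-integrable setT (EFin \o (f \* g)).
Proof.
by move=> Lf Lg; have [] := @Lfun_mul_integrable 2 2 f g; rewrite // [RHS]splitr !div1r.
Qed.

Lemma Lfun2_lin k f g : f \in Lfun mu 2%:E -> g \in Lfun mu 2%:E ->
  (fun x => k * f x + g x) \in Lfun mu 2%:E.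
Proof.
have p1 : (1 <= 2%:E :> \bar R)%E by rewrite lee_fin ler1n.
move=> Lf Lg; have -> : (fun x => k * f x + g x) = k *: f + g by apply/funext.
exact: (Lfun_submod_closed mu p1).2.
Qed.

Lemma ae_eq0_integral_sqr f : measurable_fun setT f ->
  (\int[mu]_x (f x ^+ 2)%:E = 0)%E -> {ae mu, forall x, f x = 0}.
Proof.
move=> mf f0; have /ae_eq_integral_abs : measurable_fun setT (fun x => (f x ^+ 2)%:E).
  by apply/measurable_EFinP; exact: measurable_funX.
move=> /(_ mu measurableT)[H _].
have /H : (\int[mu]_x `|(f x ^+ 2)%:E| = 0)%E.
  by rewrite -f0; apply: eq_integral => x _; rewrite gee0_abs// lee_fin sqr_ge0.
by apply: filterS => x /(_ I) [] /eqP; rewrite sqrf_eq0 => /eqP.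
Qed.

Lemma integrable_lin k f g : mu.-integrable setT (EFin \o f) ->
  mu.-integrable setT (EFin \o g) ->
  mu.-integrable setT (EFin \o (fun x => k * f x + g x)).
Proof.
move=> Lf Lg.
rewrite (_ : EFin \o _ = (fun x => k%:E * (f x)%:E + (g x)%:E)%E)//.
by apply: integrableD => //; apply: integrableZl.
Qed.

Lemma Rintegral_lin k f g : mu.-integrable setT (EFin \o f) ->
  mu.-integrable setT (EFin \o g) ->
  \int[mu]_x (k * f x + g x) = k * \int[mu]_x f x + \int[mu]_x g x.
Proof.
move=> Lf Lg; rewrite -RintegralZl// -RintegralD//.
rewrite (_ : EFin \o _ = (fun x => k%:E * (f x)%:E)%E)//.
exact: integrableZl.
Qed.

Lemma integrable_Rsum (I : Type) (r : seq I) (f_ : I -> T -> R) :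
  (forall i, mu.-integrable setT (EFin \o f_ i)) ->
  mu.-integrable setT (EFin \o (fun x => \sum_(i <- r) f_ i x)).
Proof.
move=> fi; rewrite (_ : EFin \o _ = (fun x => \sum_(i <- r) (f_ i x)%:E)%E).
  by apply: integrable_sum => // i _; exact: fi.
by apply/funext => x; rewrite /= sumEFin.
Qed.

Lemma Rintegral_sum (I : Type) (r : seq I) (f_ : I -> T -> R) :
  (forall i, mu.-integrable setT (EFin \o f_ i)) ->
  \int[mu]_x (\sum_(i <- r) f_ i x) = \sum_(i <- r) \int[mu]_x f_ i x.
Proof.
move=> fi; elim: r => [|i r IH].
  rewrite big_nil; under eq_Rintegral do rewrite big_nil.
  by rewrite Rintegral_cst// mul0r.
rewrite big_cons; under eq_Rintegral do rewrite big_cons.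
by rewrite RintegralD ?IH//; exact: integrable_Rsum.
Qed.

End Lfun_theory.

(** * Almost everywhere and L^2 convergence with a geometric rate *)

Section riesz_fischer.
Context d (T : measurableType d) (R : realType).
Variable mu : {measure set T -> \bar R}.

(* The weights [k ^- n] turn Cauchy-Schwarz into a bound of all the tails by one
   integrable function. *)
Lemma weighted_sum_sqr (h : nat -> R) (k : R) (n m : nat) : 0 < k < 1 ->
  (\sum_(n <= i < n + m) h i) ^+ 2 <=
  k ^+ n / (1 - k) * \sum_(n <= i < n + m) (h i ^+ 2 / k ^+ i).
Proof.
move=> /andP[k0 k1]; have k10 : 0 < 1 - k by rewrite subr_gt0.
elim: m n => [|m IH] n.
  by rewrite addn0 !big_geq// expr0n/= mulr0.
have nm : (n < n.+1 + m)%N by rewrite addSn ltnS leq_addr.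
rewrite addnS -addSn [in leLHS]big_ltn// [in leRHS]big_ltn//.
have {IH} := IH n.+1.
set a := \sum_(_ <= _ < _) h _; set b := \sum_(_ <= _ < _) _.
move=> IH; set x := h n; rewrite mulrDr.
have kn : 0 < k ^+ n by exact: exprn_gt0.
have -> : k ^+ n / (1 - k) * (x ^+ 2 / k ^+ n) = x ^+ 2 / (1 - k).
  by field; rewrite !gt_eqF.
have : a ^+ 2 / k <= k ^+ n / (1 - k) * b.
  rewrite ler_pdivrMr//; apply: (le_trans IH); rewrite exprS; lra.
(* Convexity of the square with the weights [1 - k] and [k]. *)
suff : (x + a) ^+ 2 <= x ^+ 2 / (1 - k) + a ^+ 2 / k by lra.
rewrite -subr_ge0 (_ : _ - _ = (k * x - (1 - k) * a) ^+ 2 / (k * (1 - k))).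
  by rewrite divr_ge0 ?sqr_ge0// ltW// mulr_gt0.
by field; rewrite !gt_eqF.
Qed.

(** [G], the sum of [h n ^+ 2 / k ^+ n], is integrable since the integrals of its terms are at most
    [C * k ^+ n]. By [weighted_sum_sqr] the squared tails from [n] on are at most
    [k ^+ n / (1 - k) * G], which yields the Cauchy property wherever [G] is finite, and the L^2
    rate. One of the two powers of [k ^+ n] in the hypothesis pays for the weights. *)
Lemma riesz_fischer (f : nat -> T -> R) (C k : R) : 0 < k < 1 ->
  (forall n, measurable_fun setT (f n)) ->
  (forall n, \int[mu]_x ((f n.+1 x - f n x) ^+ 2)%:E <= (C * (k ^+ n) ^+ 2)%:E)%E ->
  exists g : T -> R, [/\ measurable_fun setT g,
    {ae mu, forall x, f ^~ x @ \oo --> g x} &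
    exists C', forall n,
      (\int[mu]_x ((f n x - g x) ^+ 2)%:E <= (C' * k ^+ n)%:E)%E].
Proof.
move=> k01 mf hf; have /andP[k0 k1] := k01; have k10 : 0 < 1 - k by rewrite subr_gt0.
pose h n x := f n.+1 x - f n x.
have mh n : measurable_fun setT (h n) by exact: measurable_funB.
pose w n x := (h n x ^+ 2 / k ^+ n)%:E : \bar R.
have w0 n x : (0 <= w n x)%E by rewrite lee_fin divr_ge0 ?sqr_ge0// exprn_ge0// ltW.
have mw n : measurable_fun setT (w n).
  apply/measurable_EFinP; apply: measurable_funM; last exact: measurable_cst.
  exact: measurable_funX.
pose G x := (\sum_(n <oo) w n x)%E.
have mG : measurable_fun setT G.
  by apply: ge0_emeasurable_sum => // n x _ _; exact: w0.
have G0 x : (0 <= G x)%E by exact: nneseries_ge0.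
have C0 : 0 <= C.
  have := hf 0; rewrite expr0 expr1n mulr1 -lee_fin; apply: le_trans.
  by apply: integral_ge0 => x _; rewrite lee_fin sqr_ge0.
have iG : (\int[mu]_x G x <= (C / (1 - k))%:E)%E.
  rewrite integral_nneseries//.
  have wk n : (\int[mu]_x w n x <= (C * k ^+ n)%:E)%E.
    have kn : 0 < k ^+ n by exact: exprn_gt0.
    rewrite /w; under eq_integral do rewrite mulrC EFinM.
    rewrite ge0_integralZl//; last 3 first.
    - by apply/measurable_EFinP; exact: measurable_funX.
    - by move=> x _; rewrite lee_fin sqr_ge0.
    - by rewrite lee_fin invr_ge0 ltW.
    apply: (le_trans (lee_wpmul2l _ (hf n))); first by rewrite lee_fin invr_ge0 ltW.
    by rewrite -EFinM lee_fin [leLHS](_ : _ = C * k ^+ n)//; field; rewrite gt_eqF.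
  apply: (le_trans (lee_nneseries _ _)); [|by move=> n _; exact: wk|].
    by move=> n _ _; apply: integral_ge0.
  apply: lime_le; first by apply: is_cvg_nneseries => n _ _; rewrite lee_fin mulr_ge0// exprn_ge0// ltW.
  apply: nearW => n; rewrite sumEFin lee_fin -mulr_sumr ler_wpM2l//.
  have k1' : k != 1 by rewrite lt_eqF.
  have := @geometric_seriesE _ 1 k k1' => /(congr1 (fun u => u n)).
  rewrite /series/= /geometric/= mul1r; under eq_bigr do rewrite mul1r.
  move=> ->; rewrite -[leRHS]div1r ler_pM2r ?invr_gt0//.
  by rewrite lerBlDr lerDl exprn_ge0// ltW.
have Gfin : {ae mu, forall x, G x \is a fin_num}.
  have : mu.-integrable setT G.
    apply/integrableP; split => //.
    under eq_integral do rewrite gee0_abs//.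
    by apply: (le_lt_trans iG); rewrite ltry.
  by move/integrable_ae => /(_ measurableT); apply: filterS => x; exact.
have key x n m : G x \is a fin_num ->
    (f (n + m)%N x - f n x) ^+ 2 <= k ^+ n / (1 - k) * fine (G x).
  move=> Gx.
  have -> : f (n + m)%N x - f n x = \sum_(n <= i < n + m) h i x.
    by rewrite telescope_sumr// leq_addr.
  apply: (le_trans (weighted_sum_sqr _ _ _ k01)).
  rewrite ler_wpM2l ?divr_ge0 ?exprn_ge0// ?(ltW k0) ?(ltW k10)//.
  rewrite -lee_fin fineK// -sumEFin.
  apply: (@le_trans _ _ (\sum_(0 <= i < n + m) w i x)%E).
    rewrite (@big_cat_nat _ _ _ n 0 (n + m))//= ?leq_addr//.
    by rewrite leeDr// sume_ge0.
  exact: nneseries_lim_ge.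
have fcvg x : G x \is a fin_num -> cvgn (f ^~ x).
  move=> Gx; apply: cauchy_cvg; apply: cauchy_exP => e e0.
  have [N HN] : exists N, k ^+ N / (1 - k) * fine (G x) < e ^+ 2.
    have : (fun n => k ^+ n / (1 - k) * fine (G x)) @ \oo --> 0 / (1 - k) * fine (G x).
      apply: cvgM; last exact: cvg_cst.
      apply: cvgM; last exact: cvg_cst.
      by apply: cvg_expr; rewrite ger0_norm// ltW.
    rewrite !mul0r => /cvgr_lt/(_ (e ^+ 2)); rewrite exprn_gt0//.
    by move=> /(_ isT)[N _ HN]; exists N; exact: HN (leqnn N).
  exists (f N x), N => // i /= Ni.
  rewrite /ball/= distrC -ltr_sqr ?nnegrE ?(ltW e0)//.
  rewrite real_normK ?num_real// -(subnKC Ni); apply: le_lt_trans HN; exact: key.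
(* Setting the functions to 0 where [G] is infinite makes them converge everywhere, whence the
   measurability of the limit. *)
pose f' n x := if G x \is a fin_num then f n x else 0.
pose g x := if G x \is a fin_num then lim (f ^~ x @ \oo) else 0.
have mGfin : measurable_fun setT (fun x => G x \is a fin_num).
  apply: (measurable_fun_bool true); rewrite preimage_true.
  by have := emeasurable_fin_num measurableT mG; rewrite !setTI.
have mg : measurable_fun setT g.
  apply: (@measurable_fun_cvg _ _ _ _ f') => [n|x _].
    by apply: measurable_fun_ifT => //; exact: measurable_cst.
  rewrite /f' /g; case: ifPn => [/fcvg//|_]; exact: cvg_cst.
exists g; split => //.
  by apply: filterS Gfin => x Gx; rewrite /g Gx; exact: fcvg.
exists (C / (1 - k) ^+ 2) => n.
have kn0 : 0 <= k ^+ n / (1 - k).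
  by rewrite divr_ge0 ?exprn_ge0// ?(ltW k0) ?(ltW k10).
apply: (@le_trans _ _ (\int[mu]_x ((k ^+ n / (1 - k))%:E * G x))%E).
  apply: ae_ge0_le_integral => //.
  - by move=> x _; rewrite lee_fin sqr_ge0.
  - apply/measurable_EFinP; apply: measurable_funX; exact: measurable_funB.
  - by move=> x _; rewrite mule_ge0.
  - exact: emeasurable_funM.
  apply: filterS Gfin => x Gx _; rewrite -[G x]fineK// -EFinM lee_fin.
  have Gx' := fcvg _ Gx.
  (* The bound [key] is uniform in the upper index, so it survives the passage to the limit. *)
  have sub0 : (fun m => (f n x - f m x) ^+ 2) @ \oo --> (f n x - g x) ^+ 2.
    rewrite /g Gx; under eq_fun do rewrite expr2.
    rewrite expr2; apply: cvgM; apply: cvgB => //; exact: cvg_cst.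
  rewrite -(cvg_lim (@Rhausdorff R) sub0); apply: limr_le.
    by apply/cvg_ex; eexists; exact: sub0.
  by exists n => // m /= nm; rewrite -opprB sqrrN -(subnKC nm); exact: key.
rewrite ge0_integralZl//.
apply: (le_trans (lee_wpmul2l _ iG)); first by rewrite lee_fin.
by rewrite -EFinM lee_fin [leLHS](_ : _ = C / (1 - k) ^+ 2 * k ^+ n)//; field; rewrite gt_eqF.
Qed.

End riesz_fischer.

(** * Topology and measure of the space of row vectors *)

Section rV_topology.
Context {R : realType} {n : nat}.
Local Notation space := 'rV[R]_n.
Implicit Types (U : set space) (x y : space).

Lemma ball_rVP x (e : R) y : 0 < e ->
  ball x e y <-> forall i, `|x ord0 i - y ord0 i| < e.
Proof.
move=> e0; split=> [[_ xy] i|xy]; first exact: xy.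
by split => // i j; rewrite ord1; exact: xy.
Qed.

Lemma coord_le_norm x i : `|x ord0 i| <= `|x|.
Proof.
apply/ler_addgt0Pr => e e0; have xe : 0 < `|x| + e by rewrite ltr_pwDr.
have : ball (0 : space) (`|x| + e) x.
  by rewrite mx_norm_ball /ball_/= sub0r normrN ltrDl.
by move/(ball_rVP _ _ xe)/(_ i); rewrite mxE sub0r normrN => /ltW.
Qed.

Lemma measurable_box (A : 'I_n -> set R) : (forall i, measurable (A i)) ->
  measurable [set x : space | forall i, A i (x ord0 i)].
Proof.
move=> mA.
rewrite (_ : [set _ | _] = \bigcap_i
    (if insub i is Some j then rV_coord (j : 'I_n) @^-1` A j else setT)).
  apply: bigcapT_measurable => i.
  case: insub => [j|]; last exact: measurableT.
  by rewrite -[X in measurable X]setTI; apply: measurable_rV_coord.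
apply/seteqP; split => [x xA i _ /=|x xA i].
  by case: insub => // j; exact: xA.
by have := xA i I; rewrite /= valK.
Qed.

Definition cube x (r : R) : set space := [set y | forall i, `|y ord0 i - x ord0 i| < r].

Lemma cubeE x r : cube x r =
  [set y | forall i, `]x ord0 i - r, x ord0 i + r[%classic (y ord0 i)].
Proof.
apply/seteqP; split => y /= xy i; have := xy i; rewrite /= in_itv/=.
  by rewrite ltr_distl.
by rewrite ltr_distl.
Qed.

Lemma measurable_cube x r : measurable (cube x r).
Proof. rewrite cubeE; apply: (@measurable_box (fun i => `]x ord0 i - r, x ord0 i + r[%classic)) => i.
exact: measurable_itv. Qed.

Lemma measure_cube x r : 0 < r -> (lebesgue_rV n (cube x r) = ((2 * r) ^+ n)%:E)%E.
Proof.
move=> r0; rewrite cubeE (@lebesgue_rV_box R n (fun i => `]x ord0 i - r, x ord0 i + r[%classic)); last by move=> i; exact: measurable_itv.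
under eq_bigr => i _.
  rewrite lebesgue_measure_itv/= lte_fin (_ : _ < _); last by lra.
  rewrite -EFinB (_ : _ - _ = 2 * r); last by ring.
  over.
by rewrite prodEFin prodr_const card_ord.
Qed.

Lemma open_cube_sub U x : open U -> U x -> exists2 r, 0 < r & cube x r `<=` U.
Proof.
rewrite openE => /(_ x) /[apply] /nbhs_ballP[r /= r0 rU]; exists r => // y xy.
by apply: rU; apply/ball_rVP => // i; rewrite distrC; exact: xy.
Qed.

Definition rat_cube (q : 'rV[rat]_n * rat) : set space :=
  cube (map_mx (@ratr R) q.1) (ratr q.2).

Definition closed_cube x (r : R) : set space :=
  [set y | forall i, `|y ord0 i - x ord0 i| <= r].

Lemma cube_closed_cube x r : cube x r `<=` closed_cube x r.
Proof. by move=> y xy i; exact/ltW/xy. Qed.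

(** A rational centre within [r / 4] of [x] and a rational radius between [r / 4] and [r / 2]
    suffice. The closed cube is controlled as well, because the cutoff functions of an open box are
    supported in the closed box. *)
Lemma rat_cube_basis x (r : R) : 0 < r ->
  exists q, rat_cube q x /\ closed_cube (map_mx ratr q.1) (ratr q.2) `<=` cube x r.
Proof.
move=> r0.
have [e] := rat_in_itvoo (ltac:(lra) : r / 4 < r / 2).
rewrite in_itv/= => /andP[e1 e2].
have /all_sig[q qP] i : {q : rat | `|ratr q - x ord0 i| < r / 4}.
  apply: cid; have [q] := rat_in_itvoo (ltac:(lra) : x ord0 i - r / 4 < x ord0 i + r / 4).
  by rewrite in_itv/= => qx; exists q; rewrite ltr_distl.
exists (\row_i q i, e); rewrite /rat_cube /=; split.
  by move=> i /=; rewrite !mxE distrC; have := qP i; lra.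
move=> y /= yq i; have := yq i; have := qP i; rewrite !mxE !ltr_distl ler_distl; lra.
Qed.

Lemma open_bigcup_cube U : open U ->
  U = \bigcup_(q in [set q | rat_cube q `<=` U]) rat_cube q.
Proof.
move=> oU; apply/seteqP; split => [x Ux|x [q]]; last by move=> /= qU /qU.
have [r r0 rU] := open_cube_sub oU Ux; have [q [qx qr]] := rat_cube_basis x r0.
exists q => //=; apply: subset_trans rU; apply: subset_trans qr.
exact: cube_closed_cube.
Qed.

Lemma measurable_rat_cube q : measurable (rat_cube q).
Proof. exact: measurable_cube. Qed.

(** The sigma-algebra is generated by the coordinates, not by the open sets; the link is that an
    open set is a countable union of rational cubes. *)
Lemma open_measurable_rV U : open U -> measurable U.
Proof.
move/open_bigcup_cube => ->; rewrite bigcup_mkcond.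
apply: countable_bigcupT_measurable => [|q]; first exact: countableP.
by case: ifP => // _; exact: measurable_rat_cube.
Qed.

Lemma closed_measurable_rV U : closed U -> measurable U.
Proof.
by move=> cU; rewrite -[U]setCK; apply: measurableC; apply: open_measurable_rV; exact: closed_openC.
Qed.

Lemma compact_measurable_rV U : compact U -> measurable U.
Proof. by move=> /(compact_closed (@norm_hausdorff _ _))/closed_measurable_rV. Qed.

Lemma continuous_measurable_rV (f : space -> R) : continuous f -> measurable_fun setT f.
Proof.
move=> /continuousP cf mD; apply: (measurability _ (RGenOpens.measurableE R)) => //.
move=> _ [_ [a [b ->] <-]]; rewrite setTI.
by apply: open_measurable_rV; apply: cf; exact: interval_open.
Qed.

Lemma bounded_set_cube U : bounded_set U -> exists2 r, 0 < r & U `<=` cube 0 r.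
Proof.
move=> /pinfty_ex_gt0[M M0 UM]; exists (M + 1); first by rewrite addr_gt0.
move=> x /UM xM i; rewrite mxE subr0; apply: le_lt_trans (coord_le_norm x i) _.
by apply: le_lt_trans xM _; rewrite ltrDl.
Qed.

Lemma bounded_measure_lty U : measurable U -> bounded_set U ->
  (lebesgue_rV n U < +oo)%E.
Proof.
move=> mU /bounded_set_cube[r r0 Ur].
apply: (@le_lt_trans _ _ (lebesgue_rV n (cube 0 r))).
  by apply: le_measure; rewrite ?inE//; exact: measurable_cube.
by rewrite measure_cube// ltry.
Qed.

Lemma compact_measure_lty U : compact U -> (lebesgue_rV n U < +oo)%E.
Proof.
move=> cU; apply: bounded_measure_lty; first exact: compact_measurable_rV.
exact: compact_bounded.
Qed.

Lemma closed_cube_compact x r : compact (closed_cube x r).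
Proof.
have := @rV_compact R n (fun i => `[x ord0 i - r, x ord0 i + r]%classic)
  (fun i => @segment_compact R _ _).
congr compact; apply/seteqP; split => y /= xy i; have := xy i.
  by rewrite /= in_itv/= ler_distl.
by rewrite /= in_itv/= ler_distl.
Qed.

End rV_topology.

(** * Euclidean scalar product and norm *)

Section euclidean.
Context {R : realType} {n : nat}.
Implicit Types (u v w : 'rV[R]_n).

Lemma dotrC u v : dotr u v = dotr v u.
Proof. by apply: eq_bigr => i _; rewrite mulrC. Qed.

Lemma dotr_linl (k : R) u v w : dotr (k *: u + v) w = k * dotr u w + dotr v w.
Proof.
by rewrite /dotr mulr_sumr -big_split/=; apply: eq_bigr => i _; rewrite !mxE; ring.
Qed.

Lemma dotr_linr (k : R) u v w : dotr w (k *: u + v) = k * dotr w u + dotr w v.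
Proof. by rewrite ![dotr w _]dotrC dotr_linl. Qed.

Lemma dotr_ge0 u : 0 <= dotr u u.
Proof. by apply: sumr_ge0 => i _; rewrite -expr2 sqr_ge0. Qed.

Lemma enorm_sqr u : enorm u ^+ 2 = dotr u u.
Proof. by rewrite sqr_sqrtr// dotr_ge0. Qed.

Lemma enorm_ge0 u : 0 <= enorm u.
Proof. exact: sqrtr_ge0. Qed.

Lemma dotr_CS u v : `|dotr u v| <= enorm u * enorm v.
Proof.
apply: (@ip_CS _ _ [set: 'rV[R]_n] (@dotr R n)) => //.
- by move=> *; exact: dotrC.
- by move=> *; exact: dotr_linl.
- by move=> *; exact: dotr_ge0.
Qed.

Lemma enormD u v : enorm (u + v) <= enorm u + enorm v.
Proof.
apply: (@nrmD _ _ [set: 'rV[R]_n] (@dotr R n)) => //.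
- by move=> *; exact: dotrC.
- by move=> *; exact: dotr_linl.
- by move=> *; exact: dotr_ge0.
Qed.

Lemma enormZ (k : R) u : enorm (k *: u) = `|k| * enorm u.
Proof.
rewrite /enorm; have -> : dotr (k *: u) (k *: u) = k ^+ 2 * dotr u u.
  by rewrite /dotr mulr_sumr; apply: eq_bigr => i _; rewrite !mxE; ring.
by rewrite sqrtrM ?sqr_ge0// sqrtr_sqr.
Qed.

Lemma coord_le_enorm u i : `|u ord0 i| <= enorm u.
Proof.
rewrite -ler_sqr ?nnegrE ?enorm_ge0// enorm_sqr real_normK ?num_real//.
by rewrite /dotr (bigD1 i)//= -expr2 lerDl sumr_ge0// => j _; rewrite -expr2 sqr_ge0.
Qed.

Lemma enorm_le_sum u : enorm u <= \sum_i `|u ord0 i|.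
Proof.
rewrite -ler_sqr ?nnegrE ?enorm_ge0 ?sumr_ge0// enorm_sqr expr2 mulr_suml.
apply: ler_sum => i _; apply: (le_trans (ler_norm _)); rewrite normrM ler_wpM2l//.
by rewrite (bigD1 i)//= lerDl sumr_ge0.
Qed.

Lemma enorm0 : enorm (0 : 'rV[R]_n) = 0.
Proof. by rewrite -(scale0r (0 : 'rV[R]_n)) enormZ normr0 mul0r. Qed.

End euclidean.

Section measurable_euclidean.
Context {R : realType} {n : nat} {d : measure_display} {T : measurableType d}.
Implicit Types (F G : T -> 'rV[R]_n).

Definition vmeasurable F := forall i, measurable_fun setT (fun x => F x ord0 i).

Lemma measurable_dotr F G : vmeasurable F -> vmeasurable G ->
  measurable_fun setT (fun x => dotr (F x) (G x)).
Proof. by move=> mF mG; apply: measurable_sum => i; exact: measurable_funM. Qed.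

Lemma measurable_enorm F : vmeasurable F -> measurable_fun setT (fun x => enorm (F x)).
Proof.
move=> mF; apply: (@measurableT_comp _ _ _ _ _ _ (@Num.sqrt R)).
  by apply: continuous_measurable_fun; exact: sqrt_continuous.
exact: measurable_dotr.
Qed.
End measurable_euclidean.

(** * Test functions *)

Section flat_function.
Context {R : realType}.
Implicit Types (P : {poly R}) (t : R).

(** The family P(1/t) exp(-1/t), extended by 0, is stable under derivation: P becomes X^2 (P - P').
    Carrying the polynomial along replaces an induction on the order of the derivatives. *)
Definition flat P t : R := if 0 < t then P.[t^-1] * expR (- t^-1) else 0.

Lemma horner_norm_le P (y : R) : 1 <= y ->
  `|P.[y]| <= (\sum_(i < size P) `|P`_i|) * y ^+ size P.
Proof.
move=> y1; rewrite horner_coef mulr_suml (le_trans (ler_norm_sum _ _ _))//.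
apply: ler_sum => i _; rewrite normrM ler_wpM2l// normrX ger0_norm; last lra.
by rewrite ler_weXn2l// ltnW.
Qed.

(** With y = 1/t >= 1 and n the size of P, |P(y)| is at most a constant times y^n, while exp(y) is
    at least y^(n+2) / (n+2)!. The two spare powers leave t^2, which is what differentiability at 0
    requires. *)
Lemma flat_le_sqr P : exists C, forall t, t <= 1 -> `|flat P t| <= C * t ^+ 2.
Proof.
pose n := size P; pose S : R := \sum_(i < n) `|P`_i|.
have S0 : 0 <= S by apply: sumr_ge0.
exists (S * (n.+2)`!%:R) => t t1; rewrite /flat; case: ifPn => t0; last first.
  by rewrite normr0; apply: mulr_ge0; [exact: mulr_ge0|exact: sqr_ge0].
pose y := t^-1.
have y1 : 1 <= y by rewrite invf_ge1.
have y0 : 0 < y by lra.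
have f0 : 0 < (n.+2)`!%:R :> R by rewrite ltr0n fact_gt0.
rewrite normrM (ger0_norm (expR_ge0 _)) expRN -/y.
rewrite ler_pdivrMr ?expR_gt0// (le_trans (horner_norm_le P y1))// -/S -/n.
have := @expR_ge1Dxn R y n.+1 (ltW y0) => h.
have {h} : y ^+ n.+2 / n.+2`!%:R <= expR y by lra.
rewrite ler_pdivrMr// => h.
have te : t ^+ 2 = y ^- 2 by rewrite /y exprVn invrK.
rewrite te -!mulrA ler_wpM2l// mulrCA mulrC -ler_pdivrMr ?invr_gt0 ?exprn_gt0//.
by rewrite invrK -exprD addn2 mulrC in h *.
Qed.

(** Away from 0 this is the chain rule. At 0 the quadratic bound makes the difference quotient O(h),
    so the derivative is 0, which is also the value there of the claimed derivative. *)
Lemma is_derive_flat P t :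
  is_derive t (1 : R) (flat P) (flat ('X^2 * (P - P^`())) t).
Proof.
have [t0|t0|t0] := ltgtP t 0.
- apply: (@near_eq_is_derive _ _ _ (cst 0)).
    near=> x; rewrite /flat ifN// -leNgt ltW//; near: x.
    exact: lt_nbhsl.
  rewrite /flat ltNge (ltW t0)/=; exact: is_derive_cst.
- have te : t != 0 by rewrite gt_eqF.
  apply: (@near_eq_is_derive _ _ _ ((horner P \o GRing.inv) * (expR \o (-%R \o GRing.inv)))).
    near=> x; rewrite /flat ifT//; near: x.
    exact: lt_nbhsr.
  have dV : is_derive t (1 : R) (@GRing.inv R) (- t^-2).
    have := @is_deriveV R id t 1 1 te (is_derive_id _ _); rewrite scaler1; exact.
  have d1 : is_derive t (1 : R) (horner P \o GRing.inv) (P^`().[t^-1] * - t^-2).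
    exact: is_derive1_comp.
  have d2 : is_derive t (1 : R) (-%R \o GRing.inv) (t^-2).
    by have := is_deriveN dV; rewrite opprK; exact.
  have d3 : is_derive t (1 : R) (expR \o (-%R \o GRing.inv)) (expR (- t^-1) * t^-2).
    exact: is_derive1_comp.
  apply: is_derive_eq; rewrite /flat t0 !hornerE /= /GRing.scale/=.
  by field.
- rewrite t0 {2}/flat ltxx.
  have [C CP] := flat_le_sqr P.
  have C0 : 0 <= C by have := CP 1 (lexx 1); rewrite expr1n mulr1; apply: le_trans.
  have f0 : flat P 0 = 0 by rewrite /flat ltxx.
  have cv : (fun h : R => h^-1 *: ((flat P \o shift 0) (h *: 1) - flat P 0)) @ 0^' --> (0 : R).
    rewrite f0 /=; apply/cvgrPdist_le => e e0; near=> h.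
    rewrite sub0r normrN subr0 addr0 scaler1 /= normrM normfV.
    have h0 : h != 0 by near: h; exact: nbhs_dnbhs_neq.
    have hp : 0 < `|h| by rewrite normr_gt0.
    rewrite ler_pdivrMl//.
    have h1 : `|h| <= 1 by near: h; apply: dnbhs0_le.
    apply: (le_trans (CP _ (le_trans (ler_norm _) h1))).
    rewrite -(real_normK (num_real h)) expr2 mulrCA ler_pM2l//.
    have : `|h| <= e / (C + 1) by near: h; apply: dnbhs0_le; rewrite divr_gt0//; lra.
    rewrite ler_pdivlMr; last lra.
    by move=> ?; lra.
  by apply: DeriveDef; [apply/cvg_ex; exists 0|exact: cvg_lim cv].
Unshelve. all: by end_near. Qed.

Lemma flat_continuous P : continuous (flat P).
Proof.
move=> t; have H := is_derive_flat P t.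
by apply: differentiable_continuous; apply/derivable1_diffP; exact: ex_derive.
Qed.

End flat_function.

Section bump_algebra.
Context {R : realType} {n : nat}.
Local Notation space := 'rV[R]_n.
Implicit Types (f g : space -> R) (x : space).

Lemma is_derive_line {V : normedModType R} (f : V -> R) (x v : V) (l : R) :
  is_derive (0 : R) (1 : R) (fun t : R => f (t *: v + x)) l -> is_derive x v f l.
Proof.
move=> [df <-]; apply: DeriveDef; first exact/derivable1P.
rewrite /derive; under [in RHS]eq_fun => h.
  rewrite /= scale0r add0r addr0 [h *: 1]mulr1; over.
by [].
Qed.

(* Closed under partial derivatives, hence made of smooth functions. *)
Inductive bump_alg : (space -> R) -> Prop :=
| bump_cst c : bump_alg (fun=> c)
| bump_flat P r q i : bump_alg (fun x => flat P (r * x ord0 i + q))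
| bump_add f g : bump_alg f -> bump_alg g -> bump_alg (f + g)
| bump_mul f g : bump_alg f -> bump_alg g -> bump_alg (f * g).

Lemma bump_alg_derive f i : bump_alg f ->
  exists2 g, bump_alg g & forall x, is_derive x (delta_mx ord0 i) f (g x).
Proof.
elim=> {f} [c|P r q j|f g _ [f' bf' df] _ [g' bg' dg]|f g bf [f' bf' df] bg [g' bg' dg]].
- exists (fun=> 0); first exact: bump_cst.
  by move=> x; exact: is_derive_cst.
- exists ((fun x => flat ('X^2 * (P - P^`())) (r * x ord0 j + q)) *
          (fun=> r * (j == i)%:R)).
    by apply: bump_mul; [exact: bump_flat|exact: bump_cst].
  move=> x; apply: is_derive_line.
  pose h (t : R) := (r * (j == i)%:R) * t + (r * x ord0 j + q).
  rewrite (_ : (fun t : R => _) = flat P \o h); last first.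
    by apply/funext => t; rewrite /= /h !mxE eqxx/=; congr flat; ring.
  have -> : (((fun x => flat ('X^2 * (P - P^`())) (r * x ord0 j + q)) *
          (fun=> r * (j == i)%:R)) x : R) = flat ('X^2 * (P - P^`())) (h 0) * (r * (j == i)%:R).
    by rewrite /h mulr0 add0r.
  apply: is_derive1_comp; first exact: is_derive_flat.
  rewrite /h; have h1 := @is_deriveZ R R R id (r * (j == i)%:R) 0 1 1 (is_derive_id _ _).
  have := is_deriveD h1 (is_derive_cst (r * x ord0 j + q) (0 : R) (1 : R)).
  by rewrite addr0 [_ *: 1]mulr1.
- exists (f' + g'); first exact: bump_add.
  by move=> x; exact: is_deriveD.
- exists (f * g' + g * f'); first by apply: bump_add; exact: bump_mul.
  by move=> x; exact: is_deriveM.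
Qed.

Lemma bump_alg_continuous f : bump_alg f -> continuous f.
Proof.
elim=> {f} [c|P r q j|f g _ cf _ cg|f g _ cf _ cg] x.
- exact: cst_continuous.
- apply: (@continuous_comp _ _ _ (fun x : space => r * x ord0 j + q) (flat P)).
    have cj : {for x, continuous (fun x : space => x ord0 j : R)}.
      exact: coord_continuous.
    apply: (@continuousD _ _ _ (fun x : space => r * x ord0 j) (fun=> q)).
      by apply: (@continuousM _ _ (fun=> r)) => //; exact: cst_continuous.
    exact: cst_continuous.
  exact: flat_continuous.
- by apply: continuousD; [exact: cf|exact: cg].
- by apply: continuousM; [exact: cf|exact: cg].
Qed.

Lemma bump_alg_smooth f : bump_alg f -> smooth f.
Proof.
move=> bf.
have bp l : bump_alg (partials l f).
  elim: l => //= i l /(bump_alg_derive i)[g bg dg].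
  rewrite (_ : partial i _ = g)//; apply/funext => x.
  exact: derive_val.
move=> l; split; first exact: bump_alg_continuous.
move=> i x; have [g _ dg] := bump_alg_derive i (bp l).
exact: ex_derive.
Qed.

Lemma bump_alg_prod m (F : 'I_m -> space -> R) : (forall i, bump_alg (F i)) ->
  bump_alg (fun x => \prod_i F i x).
Proof.
elim: m F => [|m IH] F bF.
  by under eq_fun do rewrite big_ord0; exact: bump_cst.
under eq_fun do rewrite big_ord_recl.
by apply: (bump_mul (bF ord0)); exact: IH.
Qed.

Implicit Types (a b : space).

Definition obox a b : set space := [set x | forall i, a ord0 i < x ord0 i < b ord0 i].
Definition cbox a b : set space := [set x | forall i, a ord0 i <= x ord0 i <= b ord0 i].

Lemma obox_cbox a b : obox a b `<=` cbox a b.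
Proof. by move=> x xab i; have /andP[/ltW -> /ltW ->] := xab i. Qed.

Lemma cbox_compact a b : compact (cbox a b).
Proof.
have := @rV_compact R n (fun i => `[a ord0 i, b ord0 i]%classic)
  (fun i => @segment_compact R _ _).
by congr compact; apply/seteqP; split => y /= xy i; have := xy i; rewrite /= in_itv.
Qed.

Lemma measurable_obox a b : measurable (obox a b).
Proof.
rewrite (_ : obox a b = [set x | forall i, `]a ord0 i, b ord0 i[%classic (x ord0 i)]).
  by apply: (@measurable_box R n (fun i => `]a ord0 i, b ord0 i[%classic)).
by apply/seteqP; split => y /= xy i; have := xy i; rewrite /= in_itv.
Qed.

Lemma oboxI a b a' b' : obox a b `&` obox a' b' =
  obox (\row_i Num.max (a ord0 i) (a' ord0 i)) (\row_i Num.min (b ord0 i) (b' ord0 i)).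
Proof.
apply/seteqP; split => [x [xa xb] i|x xab]; last first.
  split => i; have := xab i; rewrite !mxE gt_max lt_min.
    by move=> /andP[/andP[-> _] /andP[-> _]].
  by move=> /andP[/andP[_ ->] /andP[_ ->]].
by have /andP[h1 h2] := xa i; have /andP[h3 h4] := xb i; rewrite !mxE gt_max lt_min h1 h2 h3 h4.
Qed.

Lemma cubeE_obox x r : cube x r = obox (\row_i (x ord0 i - r)) (\row_i (x ord0 i + r)).
Proof.
by apply/seteqP; split => y yx i; have := yx i; rewrite !mxE ltr_distl.
Qed.

Lemma closed_cubeE_cbox x r :
  closed_cube x r = cbox (\row_i (x ord0 i - r)) (\row_i (x ord0 i + r)).
Proof.
by apply/seteqP; split => y yx i; have := yx i; rewrite !mxE ler_distl.
Qed.

(* Since [flat 1 t = exp (- 1 / t)] for [t > 0], the powers [flat 1 ^ (1 / k)]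
   tend to the indicator of the positive reals. *)
Definition cutoff a b (k : nat) x : R :=
  \prod_i (flat 1 (k.+1%:R * (x ord0 i - a ord0 i)) *
           flat 1 (k.+1%:R * (b ord0 i - x ord0 i))).

Lemma flat1_itv01 (t : R) : 0 <= flat 1 t <= 1.
Proof.
rewrite /flat; case: ifPn => t0; rewrite ?lexx ?ler01// hornerC mul1r expR_ge0/=.
by rewrite expR_le1 oppr_le0 invr_ge0 ltW.
Qed.

Lemma cutoff_smooth a b k : smooth (cutoff a b k).
Proof.
apply/bump_alg_smooth/bump_alg_prod => i.
have -> : (fun x => flat 1 (k.+1%:R * (x ord0 i - a ord0 i)) *
           flat 1 (k.+1%:R * (b ord0 i - x ord0 i))) =
  (fun x => flat 1 (k.+1%:R * x ord0 i + - (k.+1%:R * a ord0 i))) *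
  (fun x => flat 1 ((- k.+1%:R) * x ord0 i + (k.+1%:R * b ord0 i))).
  by apply/funext => x /=; congr (flat _ _ * flat _ _); ring.
by apply: bump_mul; exact: bump_flat.
Qed.

Lemma cutoff_itv01 a b k x : 0 <= cutoff a b k x <= 1.
Proof.
apply/andP; split.
  apply: prodr_ge0 => i _.
  by apply: mulr_ge0; [have /andP[] := flat1_itv01 (k.+1%:R * (x ord0 i - a ord0 i))|
    have /andP[] := flat1_itv01 (k.+1%:R * (b ord0 i - x ord0 i))].
rewrite -(_ : \prod_(i < n) (1 : R) = 1); last by rewrite big1.
apply: ler_prod => i _.
have /andP[h1 h2] := flat1_itv01 (k.+1%:R * (x ord0 i - a ord0 i)).
have /andP[h3 h4] := flat1_itv01 (k.+1%:R * (b ord0 i - x ord0 i)).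
by rewrite mulr_ge0// mulr_ile1.
Qed.

Lemma cutoff_eq0 a b k x : ~ obox a b x -> cutoff a b k x = 0.
Proof.
move=> /existsNP[i] /negP; rewrite negb_and -!leNgt => h.
rewrite /cutoff (bigD1 i)//=.
have flat0 (t : R) : t <= 0 -> flat 1 (k.+1%:R * t) = 0.
  by move=> t0; rewrite /flat ltNge mulr_ge0_le0.
case/orP: h => h; first by rewrite (flat0 (x ord0 i - _)) ?subr_le0// !mul0r.
by rewrite (flat0 (b ord0 i - _)) ?subr_le0// mulr0 mul0r.
Qed.

Lemma cutoff_cvg a b x : obox a b x -> (fun k => cutoff a b k x) @ \oo --> (1 : R).
Proof.
move=> xab.
have flat_cvg (c : R) : 0 < c -> (fun k : nat => flat 1 (k.+1%:R * c)) @ \oo --> (1 : R).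
  move=> c0.
  have -> : (fun k : nat => flat 1 (k.+1%:R * c)) = (fun k : nat => expR (- (k.+1%:R^-1 * c^-1))).
    apply/funext => k; rewrite /flat mulr_gt0//.
    by rewrite hornerC mul1r invfM.
  have h1 : (fun k : nat => - (k.+1%:R^-1 * c^-1)) @ \oo --> - (0 * c^-1).
    by apply: cvgN; apply: cvgM; [exact: cvg_harmonic|exact: cvg_cst].
  rewrite [X in _ --> X](_ : _ = expR (- (0 * c^-1))); last by rewrite mul0r oppr0 expR0.
  by apply: continuous_cvg h1; exact: continuous_expR.
rewrite /cutoff [X in _ --> X](_ : _ = \prod_(i < n) (1 : R)); last by rewrite big1.
apply: cvg_big => [|i _].
  exact: mul_continuous.
rewrite -[X in _ --> X]mulr1; apply: cvgM; apply: flat_cvg; rewrite subr_gt0;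
  by have /andP[] := xab i.
Qed.

Lemma support_cutoff a b k : Defs.support (cutoff a b k) `<=` cbox a b.
Proof.
have /(compact_closed (@norm_hausdorff _ _)) := @cbox_compact a b.
rewrite /Defs.support => /closure_id ->; apply: closure_subset => x /= /eqP h.
by apply: contrapT => nx; apply: h; apply: cutoff_eq0 => /obox_cbox.
Qed.

Lemma test_function_cutoff (U : set space) a b k : cbox a b `<=` U ->
  test_function U (cutoff a b k).
Proof.
move=> abU; split; first exact: cutoff_smooth.
- apply: subclosed_compact (@cbox_compact a b) (@support_cutoff a b k).
  exact: closed_closure.
- exact: subset_trans (@support_cutoff _ _ _) abU.
Qed.

End bump_algebra.

(** * The fundamental lemma of the calculus of variations *)

Section local_integrability.
Context {R : realType} {n : nat}.
Local Notation space := 'rV[R]_n.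
Local Notation mu := (@lebesgue_rV R n).
Implicit Types (f w : space -> R) (U K : set space).

Lemma L1loc_measurable f : L1loc f -> measurable_fun setT f.
Proof.
move=> Lf.
have -> : [set: space] = \bigcup_k closed_cube (0 : space) k%:R.
  apply/seteqP; split => // x _.
  exists (Num.bound `|x|) => // i /=; rewrite mxE subr0.
  apply: le_trans (coord_le_norm x i) _; apply: ltW.
  by apply: le_lt_trans (archi_boundP (normr_ge0 x)); exact: lexx.
have cK (k : nat) : compact (closed_cube (0 : space) (k%:R : R)).
  exact: closed_cube_compact.
apply/measurable_fun_bigcup => [k|k].
  exact: compact_measurable_rV.
by apply/measurable_EFinP; exact: measurable_int (Lf _ (cK k)).
Qed.

Lemma compact_support_bounded f K : continuous f -> compact K ->
  (forall x, ~ K x -> f x = 0) -> exists M, forall x, `|f x| <= M.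
Proof.
move=> cf cK f0.
have : compact (f @` K) by apply: continuous_compact => //; exact: continuous_subspaceT.
move=> /compact_bounded /pinfty_ex_gt0[M M0 fM].
exists M => x; have [Kx|nKx] := pselect (K x); first by apply: fM; exists x.
by rewrite f0// normr0 ltW.
Qed.

Lemma L1loc_mul_integrable f (psi : space -> R) K : L1loc f -> continuous psi ->
  compact K -> (forall x, ~ K x -> psi x = 0) ->
  mu.-integrable setT (EFin \o (f \* psi)).
Proof.
move=> Lf cp cK p0; have [M pM] := compact_support_bounded cp cK p0.
have mK := compact_measurable_rV cK.
have mf := L1loc_measurable Lf; have mp := continuous_measurable_rV cp.
have iK : mu.-integrable K (EFin \o (f \* psi)).
  apply: (@le_integrable _ _ _ mu K mK _ (fun x => (M%:E * (f x)%:E)%E)).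
  - by apply/measurable_EFinP; apply: measurable_funTS; exact: measurable_funM.
  - move=> x _ /=; rewrite lee_fin !normrM mulrC ler_wpM2r//.
    exact: le_trans (pM x) (ler_norm _).
  - by apply: integrableZl => //; exact: Lf.
rewrite (integrable_mkcond _ mK) in iK.
apply: eq_integrable iK => // x _; rewrite /patch; case: ifPn => //.
by rewrite notin_setE => /p0 /= ->; rewrite mulr0.
Qed.

Lemma test_function_continuous U f : test_function U f -> continuous f.
Proof. by move=> [sf _ _]; have [] := sf [::]. Qed.

Lemma notin_support_eq0 f x : ~ Defs.support f x -> f x = 0.
Proof.
move=> ns; apply/eqP/negPn/negP => fx; apply: ns; exact: subset_closure.
Qed.

Lemma test_function_partial_continuous U f i : test_function U f -> continuous (partial i f).
Proof. by move=> [sf _ _]; have [] := sf [:: i]. Qed.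

Lemma partial_eq0 f i x : ~ Defs.support f x -> partial i f x = 0.
Proof.
move=> ns; rewrite /partial -(derive_cst (0 : R) x (delta_mx ord0 i)).
apply: near_eq_derive.
have : open (~` Defs.support f) by apply: closed_openC; exact: closed_closure.
rewrite openE => /(_ _ ns); apply: filterS => y.
exact: notin_support_eq0.
Qed.

Lemma L1loc_mul_test_integrable f U phi : L1loc f -> test_function U phi ->
  mu.-integrable setT (EFin \o (f \* phi)).
Proof.
move=> Lf tphi; have [_ cphi _] := tphi.
apply: (L1loc_mul_integrable Lf (test_function_continuous tphi) cphi) => x.
exact: notin_support_eq0.
Qed.

Lemma L1loc_mul_partial_integrable f U phi i : L1loc f -> test_function U phi ->
  mu.-integrable setT (EFin \o (f \* partial i phi)).
Proof.
move=> Lf tphi; have [_ cphi _] := tphi.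
apply: (@L1loc_mul_integrable _ (partial i phi) (Defs.support phi)) => //.
  exact: test_function_partial_continuous tphi.
by move=> x; exact: partial_eq0.
Qed.

End local_integrability.

Section fundamental_lemma.
Context {R : realType} {n : nat}.
Local Notation space := 'rV[R]_n.
Local Notation mu := (@lebesgue_rV R n).
Implicit Types (U : set space) (w : space -> R) (a b : space).

Definition oboxes : set (set space) := [set obox ab.1 ab.2 | ab in [set: space * space]].

(** Open boxes are stable under intersection, so Dynkin's induction can run on this set of
    generators. *)
Lemma measurable_oboxes : @measurable _ space = <<s oboxes >>.
Proof.
apply/seteqP; split; last first.
  apply: smallest_sub; first exact: sigma_algebra_measurable.
  by move=> _ [[a b] _ <-]; exact: measurable_obox.
have openG U : open U -> <<s oboxes >> U.
  move=> /open_bigcup_cube ->; rewrite bigcup_mkcond.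
  apply: (@countable_bigcupT_measurable _ (g_sigma_algebraType oboxes)).
    exact: countableP.
  move=> q; case: ifPn => _; last exact: measurable0.
  apply: sub_sigma_algebra; rewrite /rat_cube cubeE_obox; by eexists (_, _).
have coordG i : measurable_fun (setT : set (g_sigma_algebraType oboxes)) (@rV_coord _ R n i).
  move=> mD; apply: (measurability _ (RGenOpens.measurableE R)) => //.
  move=> _ [_ [a [b ->] <-]]; rewrite setTI.
  apply: openG; apply: open_comp; last exact: interval_open.
  by move=> x _; exact: coord_continuous.
rewrite [X in X `<=` _](_ : _ = g_sigma_preimage (@rV_coord _ R n))//.
apply: smallest_sub; first exact: smallest_sigma_algebra.
move=> A; rewrite -bigcup_seq => -[i _ [B mB <-]].
exact: coordG.
Qed.

Lemma setI_closed_oboxes : setI_closed oboxes.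
Proof. by move=> _ _ [[a b] _ <-] [[a' b'] _ <-]; rewrite /= oboxI; eexists (_, _). Qed.

(** The cutoffs of the box are test functions with values in [0, 1] tending to its indicator.
    Dominated convergence on the compact closed box, where [w] is integrable, does the rest. *)
Lemma obox_integral_eq0 U w a b : L1loc w ->
  (forall phi, test_function U phi -> \int[mu]_x (w x * phi x) = 0) ->
  cbox a b `<=` U -> (\int[mu]_(x in obox a b) (w x)%:E = 0)%E.
Proof.
move=> Lw w0 abU.
have cK := @cbox_compact R n a b; have mK := compact_measurable_rV cK.
have mw := L1loc_measurable Lw.
pose f k x := (w x * cutoff a b k x)%:E.
have tk k := @test_function_cutoff R n U a b k abU.
have mc k := continuous_measurable_rV (test_function_continuous (tk k)).
have fk0 k : (\int[mu]_(x in cbox a b) f k x = 0)%E.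
  have fi := L1loc_mul_test_integrable Lw (tk k).
  have -> : (\int[mu]_(x in cbox a b) f k x = \int[mu]_x f k x)%E.
    rewrite integral_mkcond; apply: eq_integral => x _; rewrite /patch; case: ifPn => //.
    rewrite notin_setE => nx; rewrite /f cutoff_eq0 ?mulr0//.
    by move=> /obox_cbox.
  rewrite -[LHS]fineK; last exact: integrable_fin_num.
  by rewrite [X in X%:E](w0 _ (tk k)).
have mo := @measurable_obox R n a b.
have [] := @dominated_convergence _ _ _ mu (cbox a b) mK f
   ((EFin \o w) \_ (obox a b)) (fun x => `|(w x)%:E|%E).
- by move=> k; apply/measurable_EFinP/measurable_funTS; exact: measurable_funM.
- apply: measurable_funTS; apply/(measurable_restrictT _ _).1 => //.
  by apply/measurable_EFinP; exact: measurable_funTS.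
- apply: aeW => x _; rewrite /patch; case: ifPn => [|/negP]; rewrite inE => xo.
    rewrite /f; apply: cvg_EFin; first exact: nearW.
    rewrite [X in _ --> X](_ : _ = w x * 1); last by rewrite mulr1.
    by apply: cvgM; [exact: cvg_cst|exact: cutoff_cvg].
  rewrite /f; under eq_fun do rewrite cutoff_eq0// mulr0; exact: cvg_cst.
- by apply: integrable_abse; exact: Lw.
- apply: aeW => x k _; rewrite /f lee_fin normrM ler_piMr//.
  by have /andP[c0 c1] := cutoff_itv01 a b k x; rewrite ger0_norm.
move=> _ _; under eq_fun do rewrite fk0.
move=> /(cvg_unique _ (cvg_cst _)) => /(_ (@ereal_hausdorff R)) /esym.
rewrite -integral_mkcondr; rewrite setIidr//; exact: obox_cbox.
Qed.

(** Dynkin's induction carries the vanishing of the integral from boxes to [E] intersected with [B]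
    for every measurable [E]. A function with zero integral on all measurable subsets of [B]
    vanishes almost everywhere on it. *)
Lemma obox_eq0 U w a b : L1loc w ->
  (forall phi, test_function U phi -> \int[mu]_x (w x * phi x) = 0) ->
  cbox a b `<=` U -> {ae mu, forall x, obox a b x -> w x = 0}.
Proof.
move=> Lw w0 abU; pose B := obox a b.
have mB : measurable B by exact: measurable_obox.
have mw := L1loc_measurable Lw.
have iB : mu.-integrable B (EFin \o w).
  apply: integrableS (Lw _ (@cbox_compact R n a b)) => //; last exact: obox_cbox.
  by apply: compact_measurable_rV; exact: cbox_compact.
have iS E : measurable E -> mu.-integrable (E `&` B) (EFin \o w).
  by move=> mE; apply: integrableS iB => //; exact: measurableI.
have key E : measurable E -> (\int[mu]_(x in E `&` B) (w x)%:E = 0)%E.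
  move=> mE; move: (mE); rewrite measurable_oboxes; move: E {mE}.
  apply: (dynkin_induction measurable_oboxes setI_closed_oboxes).
  - by rewrite setTI; exact: obox_integral_eq0 w0 abU.
  - move=> _ [[a' b'] _ <-]; rewrite /= oboxI; apply: obox_integral_eq0 w0 _ => //.
    apply: subset_trans abU => x xab i; have := xab i; rewrite !mxE ge_max le_min.
    by move=> /andP[/andP[_ ->] /andP[_ ->]].
  - move=> E mE E0; have := obox_integral_eq0 Lw w0 abU; rewrite -/B.
    rewrite -[X in (\int[_]_(_ in X) _)%E](setTI B) -(setUv E) setIUl.
    rewrite integral_setU ?E0 ?add0e//.
    + exact: measurableI.
    + by apply: measurableI => //; exact: measurableC.
    + by apply/measurable_funTS/measurable_EFinP.
    + by apply/disj_setPS => x [[? _] []].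
  - move=> F mF tF F0; rewrite setI_bigcupl integral_bigcup.
    + by rewrite eseries0// => k _ _.
    + exact: trivIset_setIr.
    + by move=> k; exact: measurableI.
    + by rewrite -setI_bigcupl; apply: iS; exact: bigcup_measurable.
have := @integral_ae_eq _ _ _ mu B mB (cst 0%E) (EFin \o w) iB.
case=> [//|E EB mE|N [mN N0 BN]].
  by rewrite integral0 -[X in (\int[_]_(_ in X) _)%E](setIidl EB) key.
exists N; split => // x /= h; apply: BN => /= h2; apply: h => Bx.
by case: (h2 Bx).
Qed.

(** The set [U] is covered by the countably many rational cubes whose closed cubes lie in it. It is
    a general open set because the lemma also serves on the complement of a support. *)
Lemma fundamental_lemma U w : open U -> L1loc w ->
  (forall phi, test_function U phi -> \int[mu]_x (w x * phi x) = 0) ->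
  {ae mu, forall x, U x -> w x = 0}.
Proof.
move=> oU Lw w0.
pose I q := closed_cube (map_mx (@ratr R) q.1) (ratr q.2) `<=` U.
have h (q : 'rV[rat]_n * rat) : {ae mu, forall x, I q -> rat_cube q x -> w x = 0}.
  have [Iq|nIq] := pselect (I q); last by apply: aeW.
  rewrite /rat_cube cubeE_obox; apply: filterS (obox_eq0 Lw w0 _).
    by move=> x /[swap] _; exact.
  by rewrite -closed_cubeE_cbox.
have {}h : {ae mu, forall x, forall k : nat,
    if unpickle k is Some q then I q -> rat_cube q x -> w x = 0 else True}.
  apply: ae_foralln => k; case: unpickle => [q|]; first exact: h.
  exact: aeW.
apply: filterS h => x hx Ux.
have [r r0 rU] := open_cube_sub oU Ux.
have [q [qx qr]] := rat_cube_basis x r0.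
have := hx (pickle q); rewrite pickleK; apply => //.
exact: subset_trans rU.
Qed.

End fundamental_lemma.

(** * Riesz potentials and weak gradients *)

Section riesz_kernel.
Context {R : realType} {n : nat}.
Local Notation space := 'rV[R]_n.
Local Notation mu := (@lebesgue_rV R n).
Implicit Types (x y : space) (K : set space) (alpha : R).

Lemma measurable_riesz_kernel alpha :
  measurable_fun setT (fun p : space * space => riesz_kernel alpha (p.1 - p.2)).
Proof.
apply: measurable_funM; first exact: measurable_cst.
apply: (measurableT_comp (measurable_powR _)) => //.
apply: measurable_enorm => i; under eq_fun do rewrite !mxE.
apply: measurable_funB.
- exact: (measurableT_comp (measurable_rV_coord i) measurable_fst).
- exact: (measurableT_comp (measurable_rV_coord i) measurable_snd).
Qed.

Lemma measurable_riesz_kernel_l alpha y :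
  measurable_fun setT (fun x : space => riesz_kernel alpha (x - y)).
Proof.
exact: (measurableT_comp (measurable_riesz_kernel alpha) (measurable_pair2 y)).
Qed.

Let half (j : nat) : R := 2^-1 ^+ j.

(** Shells are cut out by cubes, whose volume is explicit. The first cube that [x] leaves bounds one
    coordinate of [x - y] from below, hence also the Euclidean norm. *)
Lemma dyadic_shell x y : x != y -> cube y 1 x ->
  exists2 j, cube y (half j) x & half j.+1 <= enorm (x - y).
Proof.
move=> xy xy1.
have half_cvg : half @ \oo --> (0 : R).
  by apply: cvg_expr; rewrite ger0_norm ?invr_ge0// invf_lt1//; lra.
pose P j := ~~ `[< cube y (half j.+1) x >].
have exP : exists j, P j.
  have /rV0Pn[i xyi] : x - y != 0 by rewrite subr_eq0.
  move: half_cvg => /cvgr_lt/(_ `|(x - y) ord0 i|).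
  rewrite normr_gt0 => /(_ xyi)[N _ HN].
  exists N; apply/negP => /asboolP/(_ i); rewrite ltNge => /negP; apply.
  by have := HN N.+1 (leqnSn N) => /ltW; rewrite !mxE.
have := ex_minnP exP; case=> j /negP Pj minj.
exists j.
  case: j Pj minj => [|j] Pj minj; first by rewrite /half expr0.
  apply: contrapT => nc; suff : (j.+1 <= j)%N by rewrite ltnn.
  by apply: minj; apply/negP => /asboolP.
have /existsNP[i] : ~ cube y (half j.+1) x by move=> c; apply: Pj; apply/asboolP.
move=> /negP; rewrite -leNgt => h; apply: (le_trans h).
by have := coord_le_enorm (x - y) i; rewrite !mxE.
Qed.

(** Outside the unit cube around [y] the kernel is at most its constant [c]; inside, it is at most a
    sum of multiples of indicators of dyadic cubes. The integral of this sum is the same for all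
    [y], so the bound is uniform, as Tonelli's exchange will need. *)
Lemma riesz_kernel_locally_bounded alpha K : (0 < n)%N -> 0 < alpha < 1 ->
  measurable K -> (mu K < +oo)%E ->
  exists2 C, 0 <= C & forall y,
    (\int[mu]_(x in K) (`|riesz_kernel alpha (x - y)|)%:E <= C%:E)%E.
Proof.
move=> n0 /andP[a0 a1] mK Kfin.
pose c := `|riesz_constant (d := n) alpha|.
pose be := n%:R - alpha.
have be0 : 0 < be.
  by rewrite subr_gt0; apply: (lt_le_trans a1); rewrite ler1n.
have kE x : `|riesz_kernel alpha x| = c * enorm x `^ (- be).
  by rewrite /riesz_kernel normrM (ger0_norm (powR_ge0 _ _)) opprB.
have half0 j : 0 < half j by rewrite exprn_gt0// invr_gt0.
pose w j := half j.+1 `^ (- be).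
have w0 j : 0 <= w j by exact: powR_ge0.
pose S y x := (\sum_(j <oo) (c * w j * \1_(cube y (half j)) x)%:E)%E.
have t0 y x j : (0 <= (c * w j * \1_(cube y (half j)) x)%:E)%E.
  by rewrite lee_fin !mulr_ge0// normr_ge0.
have S0 y x : (0 <= S y x)%E by apply: nneseries_ge0 => j _ _; exact: t0.
have mt y j : measurable_fun setT (fun x => (c * w j * \1_(cube y (half j)) x)%:E).
  apply/measurable_EFinP; apply: measurable_funM; first exact: measurable_cst.
  by apply: measurable_indic; exact: measurable_cube.
have le_kS y x : ((`|riesz_kernel alpha (x - y)|)%:E <= c%:E + S y x)%E.
  rewrite kE; have [xy1|nxy1] := pselect (cube y 1 x); last first.
    apply: (@le_trans _ _ (c%:E + 0)%E); last by rewrite leeD2l.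
    rewrite adde0 lee_fin ler_piMr ?normr_ge0//.
    have /existsNP[i] := nxy1; move=> /negP; rewrite -leNgt => h.
    have e1 : 1 <= enorm (x - y).
      by apply: (le_trans h); have := coord_le_enorm (x - y) i; rewrite !mxE.
    rewrite -(powRr0 (enorm (x - y))) ler_powR//; lra.
  apply: (@le_trans _ _ (0 + S y x)%E); last by rewrite leeD2r// lee_fin normr_ge0.
  (* At the singularity the real power of 0 with a nonzero exponent is 0 by convention, so the bound
     is trivial there. *)
  rewrite add0e; have [->|xy] := eqVneq x y.
    by rewrite subrr enorm0 powR0 ?mulr0// oppr_eq0 gt_eqF.
  have [j cj ej] := dyadic_shell xy xy1.
  apply: (@le_trans _ _ (c * w j * \1_(cube y (half j)) x)%:E).
    rewrite indicE mem_set// mulr1 lee_fin ler_wpM2l ?normr_ge0//.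
    rewrite /w !powRN lef_pV2 ?posrE ?powR_gt0//; last first.
      exact: lt_le_trans (half0 _) ej.
    apply: ge0_ler_powR => //; rewrite ?nnegrE; [exact: ltW|exact/ltW/half0|].
    exact: enorm_ge0.
  apply: le_trans (nneseries_lim_ge j.+1 _); last by move=> i _ _; exact: t0.
  rewrite big_nat_recr//= leeDr// sume_ge0//.
have mS y : measurable_fun setT (S y).
  by apply: ge0_emeasurable_sum => // j x _ _; exact: t0.
(* The weight of the cube of index [j] grows like 2^(j (n - alpha)) and its volume decays like 2^(-
   j n), which leaves a geometric series of ratio 2^(- alpha). *)
pose r := 2 `^ (- alpha) : R.
have r0 : 0 < r by exact: powR_gt0.
have r1 : r < 1.
  rewrite /r powRN invf_lt1 ?powR_gt0//.
  have := @gt0_ltr_powR R alpha a0 1 2; rewrite powR1 !nnegrE.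
  by apply; [exact: ler01|exact: ler0n|rewrite ltr1n].
pose C1 := c * (2 `^ be * 2 ^+ n) / (1 - r).
have C10 : 0 <= C1.
  rewrite !mulr_ge0 ?normr_ge0 ?powR_ge0 ?exprn_ge0// invr_ge0; lra.
have iS y : (\int[mu]_x S y x <= C1%:E)%E.
  rewrite integral_nneseries//.
  have it j : (\int[mu]_x (c * w j * \1_(cube y (half j)) x)%:E =
     (c * (2 `^ be * 2 ^+ n) * r ^+ j)%:E)%E.
    under eq_integral do rewrite EFinM.
    rewrite ge0_integralZl//; last 2 first.
    - by apply/measurable_EFinP; apply: measurable_indic; exact: measurable_cube.
    - by rewrite lee_fin mulr_ge0// normr_ge0.
    rewrite integral_indic//; last exact: measurable_cube.
    rewrite setIT [X in (_ * X)%E](_ : _ = ((2 * half j) ^+ n)%:E); last exact: measure_cube.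
    rewrite -EFinM; congr EFin.
    suff e : w j * half j ^+ n = 2 `^ be * r ^+ j.
      rewrite exprMn [LHS](_ : _ = c * (2 ^+ n * (w j * half j ^+ n))); last by ring.
      by rewrite e; ring.
    rewrite /w /half /r.
    have h2 (m : nat) : 2^-1 ^+ m = 2 `^ (- m%:R) :> R.
      by rewrite powRN powR_mulrn// exprVn.
    rewrite -[(2^-1 ^+ j) ^+ n]exprM !h2 -(powR_mulrn j (powR_ge0 2 (- alpha))).
    rewrite -(powRrM 2 _ (- be)) -(powRrM 2 _ j%:R).
    have n2 (e : bool) : e ==> (2 != 0 :> R) by rewrite pnatr_eq0 implybT.
    rewrite -(powRD (n2 _)) -(powRD (n2 _)).
    by congr (_ `^ _); rewrite /be -natr1 natrM; ring.
  under eq_eseriesr do rewrite it.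
  apply: lime_le.
    apply: is_cvg_nneseries => j _ _.
    by rewrite lee_fin !mulr_ge0 ?normr_ge0 ?powR_ge0 ?exprn_ge0// ltW.
  apply: nearW => N; rewrite sumEFin lee_fin -mulr_sumr /C1 ler_wpM2l//.
    by rewrite !mulr_ge0 ?normr_ge0 ?powR_ge0 ?exprn_ge0.
  have r1' : r != 1 by rewrite lt_eqF.
  have := @geometric_seriesE _ 1 r r1' => /(congr1 (fun u => u N)).
  rewrite /series/= /geometric/= mul1r; under eq_bigr do rewrite mul1r.
  move=> ->; rewrite -[leRHS]div1r ler_pM2r ?invr_gt0 ?subr_gt0//.
  by rewrite lerBlDr lerDl exprn_ge0// ltW.
exists (c * fine (mu K) + C1).
  by rewrite addr_ge0// mulr_ge0 ?normr_ge0 ?fine_ge0.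
move=> y; apply: (@le_trans _ _ (\int[mu]_(x in K) (c%:E + S y x))%E).
  apply: ge0_le_integral => //.
  - apply/measurable_funTS/measurable_EFinP/measurableT_comp => //.
    exact: measurable_riesz_kernel_l.
  - apply: measurable_funTS; apply: emeasurable_funD => //.
rewrite ge0_integralD//; last exact: measurable_funTS.
rewrite integral_cst// EFinD; apply: leeD.
  by rewrite EFinM fineK// ge0_fin_numE.
apply: le_trans (iS y); apply: ge0_subset_integral => //.
by move=> x _; rewrite lee_fin normr_ge0.
Qed.

End riesz_kernel.

Section L2_local.
Context {R : realType} {n : nat}.
Local Notation space := 'rV[R]_n.
Local Notation mu := (@lebesgue_rV R n).
Implicit Types (f g : space -> R) (K : set space).

Lemma indic_Lfun2 K : measurable K -> (mu K < +oo)%E ->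
  (\1_K : space -> R) \in Lfun mu 2%:E /\
  fine 'N[mu]_2%:E[EFin \o \1_K] = Num.sqrt (fine (mu K)).
Proof.
move=> mK Kfin.
have e : (\int[mu]_x ((\1_K x : R) ^+ 2)%:E = mu K)%E.
  transitivity (\int[mu]_x (\1_K x)%:E)%E; last by rewrite integral_indic// setIT.
  apply: eq_integral => x _; congr EFin; rewrite indicE.
  by case: (x \in K); rewrite ?expr1n ?expr0n.
have mi : measurable_fun setT (\1_K : space -> R) by exact: measurable_indic.
split; first by apply/Lfun2E; split; rewrite ?e.
by rewrite Lnorm2_sqrt; congr Num.sqrt; rewrite /Rintegral e.
Qed.

Lemma L2_L1_bound K f : measurable K -> (mu K < +oo)%E -> f \in Lfun mu 2%:E ->
  (\int[mu]_(x in K) (`|f x|)%:E <=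
   (Num.sqrt (fine (mu K)) * fine 'N[mu]_2%:E[EFin \o f])%:E)%E.
Proof.
move=> mK Kfin Lf; have [Li <-] := indic_Lfun2 mK Kfin.
have h2 : 2^-1 + 2^-1 = 1 :> R by rewrite [RHS]splitr !div1r.
have [int le] := Lfun_mul_integrable (ltr0Sn _ _) (ltr0Sn _ _) h2 Li Lf.
rewrite integral_mkcond.
have -> : (\int[mu]_x ((fun x => (`|f x|)%:E) \_ K) x =
   \int[mu]_x (`|(\1_K x : R) * f x|)%:E)%E.
  apply: eq_integral => x _; rewrite /patch indicE; case: (x \in K).
    by rewrite mul1r.
  by rewrite mul0r normr0.
rewrite -[leLHS]fineK ?lee_fin//.
have /integrable_abse/integrable_fin_num := int.
by apply.
Qed.

Lemma Lfun2_L1loc f : f \in Lfun mu 2%:E -> L1loc f.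
Proof.
move=> Lf K cK; have mK := compact_measurable_rV cK.
apply/integrableP; split.
  by apply/measurable_EFinP/measurable_funTS; exact: Lfun_measurable Lf.
apply: le_lt_trans (L2_L1_bound mK (compact_measure_lty cK) Lf) _.
exact: ltry.
Qed.

Lemma L1loc_lin k f g : L1loc f -> L1loc g -> L1loc (fun x => k * f x + g x).
Proof.
move=> Lf Lg K cK; have mK := compact_measurable_rV cK.
rewrite (_ : EFin \o _ = (fun x => k%:E * (f x)%:E + (g x)%:E)%E)//.
by apply: integrableD => //; [apply: integrableZl => //; exact: Lf|exact: Lg].
Qed.

Lemma L1loc_ae f g : L1loc f -> measurable_fun setT g ->
  {ae mu, forall x, f x = g x} -> L1loc g.
Proof.
move=> Lf mg fg K cK; have mK := compact_measurable_rV cK.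
have /integrableP[mf flt] := Lf K cK.
have mg' : measurable_fun K (EFin \o g) by apply/measurable_funTS/measurable_EFinP.
apply/integrableP; split => //; apply: le_lt_trans flt.
rewrite le_eqVlt; apply/orP; left; apply/eqP.
apply: ae_eq_integral => //; try exact: measurableT_comp.
by apply: filterS fg => x fgx _; rewrite /= fgx.
Qed.

End L2_local.

(** * Weak gradients: uniqueness, linearity and passage to the limit *)

Section weak_gradient.
Context {R : realType} {n : nat}.
Local Notation space := 'rV[R]_n.
Local Notation mu := (@lebesgue_rV R n).
Implicit Types (f g : space -> R) (w z : space -> space) (K : set space).

(** The local form, on an open set, is what shows that the gradient of a test function vanishes off
    its support. *)
Lemma weak_gradient_unique_on U w z : open U ->
  (forall i, L1loc (fun x => w x ord0 i)) -> (forall i, L1loc (fun x => z x ord0 i)) ->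
  (forall phi i, test_function U phi ->
     \int[mu]_x (w x ord0 i * phi x) = \int[mu]_x (z x ord0 i * phi x)) ->
  {ae mu, forall x, U x -> w x = z x}.
Proof.
move=> oU Lw Lz wz.
have h i : {ae mu, forall x, U x -> (-1) * z x ord0 i + w x ord0 i = 0}.
  apply: (@fundamental_lemma R n U (fun x => (-1) * z x ord0 i + w x ord0 i)) => //.
    exact: L1loc_lin.
  move=> phi tphi.
  have iw := L1loc_mul_test_integrable (Lw i) tphi.
  have iz := L1loc_mul_test_integrable (Lz i) tphi.
  under eq_Rintegral do rewrite mulN1r mulrDl addrC mulNr.
  by rewrite RintegralB// wz// subrr.
have {}h : {ae mu, forall x (k : nat), if insub k is Some i then
    U x -> (-1) * z x ord0 (i : 'I_n) + w x ord0 i = 0 else True}.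
  apply: ae_foralln => k; case: insub => [i|]; last exact: aeW.
  exact: h.
apply: filterS h => x hx Ux; apply/rowP => i.
by have := hx i; rewrite valK => /(_ Ux)/eqP; rewrite mulN1r addrC subr_eq0 => /eqP.
Qed.

Lemma weak_gradient_unique f w z :
  is_weak_gradient f w -> is_weak_gradient f z -> {ae mu, forall x, w x = z x}.
Proof.
move=> [Lf Lw fw] [_ Lz fz].
have := @weak_gradient_unique_on setT w z openT Lw Lz.
case=> [phi i tphi|N [mN N0 NE]].
  by apply: oppr_inj; rewrite -fw// -fz.
exists N; split => // x /= h; apply: NE => /= h2; apply: h; exact: h2.
Qed.

Lemma weak_gradient_lin k f g w z : is_weak_gradient f w -> is_weak_gradient g z ->
  is_weak_gradient (fun x => k * f x + g x) (fun x => k *: w x + z x).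
Proof.
move=> [Lf Lw fw] [Lg Lz gz]; split; first exact: L1loc_lin.
  by move=> i; under eq_fun do rewrite !mxE; exact: L1loc_lin.
move=> phi i tphi.
have if' := L1loc_mul_partial_integrable i Lf tphi.
have ig' := L1loc_mul_partial_integrable i Lg tphi.
have iw := L1loc_mul_test_integrable (Lw i) tphi.
have iz := L1loc_mul_test_integrable (Lz i) tphi.
under eq_Rintegral do rewrite mulrDl -mulrA.
rewrite Rintegral_lin// fw// gz//.
under [in RHS]eq_Rintegral do rewrite !mxE mulrDl -mulrA.
by rewrite Rintegral_lin//; ring.
Qed.

Lemma weak_gradient_ae f g w : is_weak_gradient f w -> measurable_fun setT g ->
  {ae mu, forall x, f x = g x} -> is_weak_gradient g w.
Proof.
move=> [Lf Lw fw] mg fg; split => //; first exact: L1loc_ae fg.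
move=> phi i tphi; rewrite -fw//; apply: ae_eq_Rintegral.
- apply: measurable_funM => //; apply: continuous_measurable_rV.
  exact: test_function_partial_continuous tphi.
- apply: measurable_funM; first exact: L1loc_measurable.
  apply: continuous_measurable_rV; exact: test_function_partial_continuous tphi.
- by apply: filterS fg => x ->.
Qed.

Definition L1loc_cvg (f_ : nat -> space -> R) f := forall K, compact K ->
  exists2 e : nat -> R, e @ \oo --> (0 : R) &
    forall m, (\int[mu]_(x in K) (`|f_ m x - f x|)%:E <= (e m)%:E)%E.

Lemma L1loc_cvg_mul (f_ : nat -> space -> R) f psi K : (forall m, L1loc (f_ m)) ->
  L1loc f -> L1loc_cvg f_ f -> continuous psi -> compact K ->
  (forall x, ~ K x -> psi x = 0) ->
  (fun m => \int[mu]_x (f_ m x * psi x)) @ \oo --> \int[mu]_x (f x * psi x).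
Proof.
move=> Lfm Lf fmf cp cK p0; have [M pM] := compact_support_bounded cp cK p0.
have M0 : 0 <= M by apply: le_trans (pM 0); exact: normr_ge0.
have mK := compact_measurable_rV cK.
have [e e0 fme] := fmf _ cK.
have im m := L1loc_mul_integrable (Lfm m) cp cK p0.
have iF := L1loc_mul_integrable Lf cp cK p0.
apply/subr_cvg0.
apply: (@squeeze_cvgr _ _ _ _ (fun m => - (M * e m)) (fun m => M * e m)); last 2 first.
- by rewrite -oppr0 -(mulr0 M); apply: cvgN; apply: cvgM => //; exact: cvg_cst.
- by rewrite -(mulr0 M); apply: cvgM => //; exact: cvg_cst.
apply: nearW => m; rewrite -ler_norml -RintegralB//; last exact: im.
have iD : mu.-integrable setT (EFin \o (fun x => f_ m x * psi x - f x * psi x)).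
  exact: (integrableB measurableT (im m) iF).
apply: (le_trans (le_normr_Rintegral measurableT iD)).
have /integrableP[_ ilt] := iD.
rewrite -lee_fin /Rintegral fineK; last by rewrite ge0_fin_numE// integral_ge0.
have mD := measurable_funB (L1loc_measurable (Lfm m)) (L1loc_measurable Lf).
apply: (@le_trans _ _ (\int[mu]_(x in K) (M%:E * (`|f_ m x - f x|)%:E))%E).
  rewrite [leRHS]integral_mkcond; apply: ge0_le_integral => //.
  - apply/measurable_EFinP; apply: measurableT_comp => //.
    by apply: measurable_funB; apply: measurable_funM; try exact: continuous_measurable_rV; exact: L1loc_measurable.
  - apply/(measurable_restrictT _ _).1 => //; apply: measurable_funTS.
    by apply/measurable_EFinP; apply: measurable_funM => //; exact: measurableT_comp.
  - move=> x _; rewrite /patch; case: ifPn => [_|].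
      by rewrite -EFinM lee_fin -mulrBl normrM mulrC ler_wpM2r.
    by rewrite notin_setE => /p0 ->; rewrite !mulr0 subrr normr0.
rewrite ge0_integralZl//; last by apply/measurable_funTS/measurable_EFinP/measurableT_comp.
by rewrite EFinM; apply: lee_wpmul2l => //; exact: fme.
Qed.

Lemma weak_gradient_limit (f_ : nat -> space -> R) (w_ : nat -> space -> space) f w :
  (forall m, is_weak_gradient (f_ m) (w_ m)) -> L1loc f ->
  (forall i, L1loc (fun x => w x ord0 i)) -> L1loc_cvg f_ f ->
  (forall i, L1loc_cvg (fun m x => w_ m x ord0 i) (fun x => w x ord0 i)) ->
  is_weak_gradient f w.
Proof.
move=> fw Lf Lw ff ww; split => // phi i tphi; have [_ cphi _] := tphi.
have Lfm m : L1loc (f_ m) by have [] := fw m.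
have Lwm m : L1loc (fun x => w_ m x ord0 i) by have [] := fw m.
have c1 := @L1loc_cvg_mul f_ f (partial i phi) _ Lfm Lf ff
  (test_function_partial_continuous (i := i) tphi) cphi (@partial_eq0 _ _ phi i).
have c2 := @L1loc_cvg_mul _ _ phi _ Lwm (Lw i) (ww i)
  (test_function_continuous tphi) cphi (@notin_support_eq0 _ _ phi).
move/cvgN : c2 => c2.
apply: (cvg_unique _ c1) => //.
rewrite /= (_ : (fun m => _) = - (fun m => \int[mu]_x (w_ m x ord0 i * phi x)))//.
by apply/funext => m; have [_ _ ->] := fw m.
Qed.

End weak_gradient.

(** * Measurability, convergence and linearity of Riesz potentials *)

Section riesz_potential.
Context {R : realType} {n : nat}.
Local Notation space := 'rV[R]_n.
Local Notation mu := (@lebesgue_rV R n).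
Implicit Types (u v : space -> R) (K : set space) (alpha : R).

Definition riesz_abs alpha u (x : space) : \bar R :=
  (\int[mu]_y (`|riesz_kernel alpha (x - y) * u y|)%:E)%E.

Lemma measurable_riesz_integrand alpha u : measurable_fun setT u ->
  measurable_fun setT (fun p : space * space => riesz_kernel alpha (p.1 - p.2) * u p.2).
Proof.
move=> mu_; apply: measurable_funM; first exact: measurable_riesz_kernel.
exact: (measurableT_comp mu_ measurable_snd).
Qed.

Lemma measurable_riesz_integrand_r alpha u x : measurable_fun setT u ->
  measurable_fun setT (fun y : space => riesz_kernel alpha (x - y) * u y).
Proof.
move=> mu_.
exact: (measurableT_comp (measurable_riesz_integrand alpha mu_) (measurable_pair1 x)).
Qed.

Lemma measurable_riesz_abs alpha u : measurable_fun setT u ->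
  measurable_fun setT (riesz_abs alpha u).
Proof.
move=> mu_; pose f (p : space * space) := (`|riesz_kernel alpha (p.1 - p.2) * u p.2|)%:E.
have mf : measurable_fun setT f.
  by apply/measurable_EFinP/measurableT_comp => //; exact: measurable_riesz_integrand.
have f0 p : (0 <= f p)%E by rewrite lee_fin.
exact: (measurable_fun_fubini_tonelli_F (m2 := mu) f mf f0).
Qed.

(** Measurability of partial integrals comes from Tonelli, for nonnegative functions; the positive
    and negative parts are treated apart, so no convergence of the potential is assumed. *)
Lemma measurable_riesz_potential alpha u : measurable_fun setT u ->
  measurable_fun setT (riesz_potential alpha u).
Proof.
move=> mu_; pose f (p : space * space) := (riesz_kernel alpha (p.1 - p.2) * u p.2)%:E.
have mf : measurable_fun setT f by apply/measurable_EFinP; exact: measurable_riesz_integrand.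
apply: (measurableT_comp (fine_measurable measurableT)).
under eq_fun do rewrite integralE.
have fp0 p : (0 <= (f^\+) p)%E by exact: funepos_ge0.
have fn0 p : (0 <= (f^\-) p)%E by exact: funeneg_ge0.
apply: emeasurable_funB.
- have := measurable_fun_fubini_tonelli_F (m2 := mu) (f^\+)%E (measurable_funepos mf) fp0.
  by apply: eq_measurable_fun => x _; apply: eq_integral => y _; rewrite !funeposE.
- have := measurable_fun_fubini_tonelli_F (m2 := mu) (f^\-)%E (measurable_funeneg mf) fn0.
  by apply: eq_measurable_fun => x _; apply: eq_integral => y _; rewrite !funenegE.
Qed.

(** The real integral is 0 when the extended one is infinite, so the bound holds at every point,
    convergent or not. *)
Lemma riesz_potential_le alpha u x : measurable_fun setT u ->
  ((`|riesz_potential alpha u x|)%:E <= riesz_abs alpha u x)%E.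
Proof.
move=> mu_.
have mg : measurable_fun setT (fun y : space => (riesz_kernel alpha (x - y) * u y)%:E).
  by apply/measurable_EFinP; exact: measurable_riesz_integrand_r.
apply: le_trans (le_abse_integral mu measurableT mg).
rewrite /riesz_potential /Rintegral.
by case: (\int[mu]_y _)%E => //=; rewrite normr0 leey.
Qed.

(** Tonelli puts the integral over [K] inside, where the kernel is bounded uniformly in [y]. This is
    the continuity of I_alpha from L^1 to L^1_loc. *)
Lemma riesz_abs_bound alpha K : (0 < n)%N -> 0 < alpha < 1 ->
  measurable K -> (mu K < +oo)%E ->
  exists2 C, 0 <= C & forall u, measurable_fun setT u ->
    (\int[mu]_(x in K) riesz_abs alpha u x <= C%:E * \int[mu]_y (`|u y|)%:E)%E.
Proof.
move=> n0 a01 mK Kfin.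
have [C C0 HC] := riesz_kernel_locally_bounded n0 a01 mK Kfin.
exists C => // u mu_.
pose f (p : space * space) := ((\1_K p.1 : R)%:E * (`|riesz_kernel alpha (p.1 - p.2) * u p.2|)%:E)%E.
have mf : measurable_fun setT f.
  apply: emeasurable_funM.
    apply/measurable_EFinP; apply: (measurableT_comp _ measurable_fst).
    exact: measurable_indic.
  by apply/measurable_EFinP/measurableT_comp => //; exact: measurable_riesz_integrand.
have f0 p : (0 <= f p)%E by rewrite mule_ge0 ?lee_fin.
have mau : measurable_fun setT (fun y => (`|u y|)%:E).
  by apply/measurable_EFinP; exact: measurableT_comp.
have -> : (\int[mu]_(x in K) riesz_abs alpha u x = \int[mu]_x \int[mu]_y f (x, y))%E.
  rewrite integral_mkcond; apply: eq_integral => x _.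
  rewrite /f /= ge0_integralZl//; last first.
    apply/measurable_EFinP/measurableT_comp => //; exact: measurable_riesz_integrand_r.
  rewrite /patch indicE; case: (x \in K); first by rewrite mul1e.
  by rewrite mul0e.
have -> : (\int[mu]_x \int[mu]_y f (x, y) = \int[mu]_y \int[mu]_x f (x, y))%E.
  have h1 := fubini_tonelli1 (m1 := mu) (m2 := mu) f mf f0.
  exact: etrans (esym h1) (fubini_tonelli2 f mf f0).
rewrite -ge0_integralZl//.
apply: ge0_le_integral => //.
- by move=> y _; exact: integral_ge0.
- exact: (measurable_fun_fubini_tonelli_G (m1 := mu) f mf f0).
- exact: measurable_funeM.
move=> y _; rewrite muleC.
have -> : (\int[mu]_x f (x, y) = (`|u y|)%:E * \int[mu]_(x in K) (`|riesz_kernel alpha (x - y)|)%:E)%E.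
  rewrite -ge0_integralZl//.
    rewrite [RHS]integral_mkcond.
    apply: eq_integral => x _; rewrite /f /= /patch indicE normrM EFinM.
    by case: (x \in K); [rewrite mul1e muleC|rewrite mul0e].
  apply/measurable_funTS/measurable_EFinP.
  by apply: measurableT_comp => //; exact: measurable_riesz_kernel_l.
by apply: lee_wpmul2l => //; exact: HC.
Qed.

(** Local integrability of the absolute potential makes it finite almost everywhere on each closed
    cube of integer radius, and these cubes exhaust the space. *)
Lemma riesz_convergent_ae alpha u : measurable_fun setT u -> riesz_convergent alpha u ->
  {ae mu, forall x, mu.-integrable setT (fun y => (riesz_kernel alpha (x - y) * u y)%:E)}.
Proof.
move=> mu_ cu.
have h (k : nat) : {ae mu, forall x, closed_cube 0 k%:R x -> (riesz_abs alpha u x < +oo)%E}.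
  have cK : compact (closed_cube (0 : space) (k%:R : R)) by exact: closed_cube_compact.
  have mK := compact_measurable_rV cK.
  have : mu.-integrable (closed_cube 0 k%:R) (riesz_abs alpha u).
    apply/integrableP; split; first by apply: measurable_funTS; exact: measurable_riesz_abs.
    under eq_integral do rewrite gee0_abs ?integral_ge0//.
    exact: cu.
  move/integrable_ae => /(_ mK); apply: filterS => x /[apply].
  by rewrite ge0_fin_numE// integral_ge0.
have := ae_foralln h; apply: filterS => x hx.
apply/integrableP; split.
  by apply/measurable_EFinP; exact: measurable_riesz_integrand_r.
apply: (hx (Num.bound `|x|)) => i /=; rewrite mxE subr0.
apply: le_trans (coord_le_norm x i) _; apply: ltW.
by apply: le_lt_trans (archi_boundP (normr_ge0 x)); exact: lexx.
Qed.

Lemma riesz_convergent_lin alpha (k : R) u v : measurable_fun setT u ->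
  measurable_fun setT v -> riesz_convergent alpha u -> riesz_convergent alpha v ->
  riesz_convergent alpha (fun x => k * u x + v x).
Proof.
move=> mu_ mv cu cv K cK; have mK := compact_measurable_rV cK.
have mabs (w : space -> R) (x : space) : measurable_fun setT w ->
    measurable_fun setT (fun y : space => (`|riesz_kernel alpha (x - y) * w y|)%:E).
  by move=> mw; apply/measurable_EFinP/measurableT_comp => //; exact: measurable_riesz_integrand_r.
have le x : (riesz_abs alpha (fun x => k * u x + v x)%R x <=
    `|k|%:E * riesz_abs alpha u x + riesz_abs alpha v x)%E.
  rewrite /riesz_abs -ge0_integralZl//; last exact: mabs.
  rewrite -ge0_integralD//; last 2 first.
  - by apply: measurable_funeM; exact: mabs.
  - exact: mabs.
  apply: ge0_le_integral => //.
  - by apply: mabs; apply: measurable_funD => //; exact: measurable_funM.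
  - by apply: emeasurable_funD; [apply: measurable_funeM|]; exact: mabs.
  - move=> y _; rewrite -EFinM -EFinD lee_fin mulrDr mulrCA (le_trans (ler_normD _ _))//.
    by rewrite normrM.
apply: (@le_lt_trans _ _ (\int[mu]_(x in K) (`|k|%:E * riesz_abs alpha u x + riesz_abs alpha v x))%E).
  apply: ge0_le_integral => //.
  - by move=> x _; exact: integral_ge0.
  - apply: measurable_funTS; apply: measurable_riesz_abs.
    by apply: measurable_funD => //; exact: measurable_funM.
  - apply: measurable_funTS; apply: emeasurable_funD; last exact: measurable_riesz_abs.
    by apply: measurable_funeM; exact: measurable_riesz_abs.
  - by move=> x _; exact: le.
have r0 w x : (0 <= riesz_abs alpha w x)%E by exact: integral_ge0.
rewrite ge0_integralD//; last 3 first.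
- by move=> x _; rewrite mule_ge0.
- by apply: measurable_funTS; apply: measurable_funeM; exact: measurable_riesz_abs.
- by apply: measurable_funTS; exact: measurable_riesz_abs.
rewrite ge0_integralZl//; last by apply: measurable_funTS; exact: measurable_riesz_abs.
apply: lte_add_pinfty; last exact: cv.
by apply: lte_mul_pinfty => //; exact: cu.
Qed.

Lemma riesz_potential_lin alpha (k : R) u v : measurable_fun setT u ->
  measurable_fun setT v -> riesz_convergent alpha u -> riesz_convergent alpha v ->
  {ae mu, forall x, riesz_potential alpha (fun x => k * u x + v x) x =
    k * riesz_potential alpha u x + riesz_potential alpha v x}.
Proof.
move=> mu_ mv cu cv.
apply: filterS2 (riesz_convergent_ae mu_ cu) (riesz_convergent_ae mv cv) => x iu iv.
rewrite /riesz_potential; under eq_Rintegral do rewrite mulrDr mulrCA.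
exact: Rintegral_lin.
Qed.

End riesz_potential.

Section riesz_lift.
Context {R : realType} {n : nat}.
Local Notation space := 'rV[R]_n.
Local Notation mu := (@lebesgue_rV R n).
Implicit Types (u v : space -> R) (w z : space -> space) (K : set space) (s : R).

(* [D^s u] is the weak gradient of [riesz_lift s u] for all [0 < s <= 1]. *)
Definition riesz_lift s u := if s == 1 then u else riesz_potential (1 - s) u.

Definition riesz_liftable s u := s != 1 -> riesz_convergent (1 - s) u.

Lemma is_riesz_gradientE s u w : is_riesz_gradient s u w <->
  riesz_liftable s u /\ is_weak_gradient (riesz_lift s u) w.
Proof.
rewrite /is_riesz_gradient /riesz_liftable /riesz_lift; case: eqP => _; last first.
  by split=> -[h1 h2]; split => //; exact: h1.
by split => [h|[]].
Qed.

Lemma measurable_riesz_lift s u : measurable_fun setT u -> measurable_fun setT (riesz_lift s u).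
Proof. by rewrite /riesz_lift; case: ifP => // _; exact: measurable_riesz_potential. Qed.

Lemma riesz_liftable_lin s k u v : measurable_fun setT u -> measurable_fun setT v ->
  riesz_liftable s u -> riesz_liftable s v ->
  riesz_liftable s (fun x => k * u x + v x).
Proof.
by move=> mu_ mv lu lv s1; apply: riesz_convergent_lin => //; [exact: lu|exact: lv].
Qed.

Lemma riesz_lift_lin s k u v : measurable_fun setT u -> measurable_fun setT v ->
  riesz_liftable s u -> riesz_liftable s v ->
  {ae mu, forall x, riesz_lift s (fun x => k * u x + v x) x =
    k * riesz_lift s u x + riesz_lift s v x}.
Proof.
rewrite /riesz_lift /riesz_liftable; case: eqP => [_ *|s1 mu_ mv lu lv]; first exact: aeW.
by apply: riesz_potential_lin => //; [exact: lu|exact: lv].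
Qed.

Lemma riesz_lift_bound s K : (0 < n)%N -> 0 < s <= 1 -> compact K ->
  exists2 C, 0 <= C & forall u, measurable_fun setT u ->
    (\int[mu]_(x in K) (`|riesz_lift s u x|)%:E <= C%:E * \int[mu]_x (`|u x|)%:E)%E.
Proof.
move=> n0 /andP[s0 s1] cK; have mK := compact_measurable_rV cK.
have mabs u : measurable_fun setT u -> measurable_fun setT (fun x => (`|u x|)%:E).
  by move=> mu_; apply/measurable_EFinP; exact: measurableT_comp.
rewrite /riesz_lift; case: (eqVneq s 1) => [_|ns1].
  exists 1 => // u mu_; rewrite mul1e; apply: ge0_subset_integral => //.
  exact: mabs.
have a01 : 0 < 1 - s < 1 by rewrite subr_gt0 lt_neqAle ns1 s1/= ltrBlDr ltrDl.
have [C C0 HC] := riesz_abs_bound n0 a01 mK (compact_measure_lty cK).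
exists C => // u mu_; apply: le_trans (HC u mu_); apply: ge0_le_integral => //.
- by apply: measurable_funTS; apply: mabs; exact: measurable_riesz_potential.
- by apply: measurable_funTS; exact: measurable_riesz_abs.
- by move=> x _; exact: riesz_potential_le.
Qed.

(** It provides the convergence of the potential for a function known only as a limit, before any
    gradient of it has been found. *)
Lemma integrable_riesz_liftable s u : (0 < n)%N -> 0 < s <= 1 ->
  mu.-integrable setT (EFin \o u) -> riesz_liftable s u /\ L1loc (riesz_lift s u).
Proof.
move=> n0 s01 /[dup] iu /integrableP[/measurable_EFinP mu_ ult].
split; last first.
  move=> K cK; apply/integrableP; split.
    by apply/measurable_EFinP/measurable_funTS; exact: measurable_riesz_lift.
  have [C C0 HC] := riesz_lift_bound n0 s01 cK.
  by apply: (le_lt_trans (HC u mu_)); exact: lte_mul_pinfty.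
move=> ns1 K cK; have mK := compact_measurable_rV cK.
have /andP[s0 s1] := s01.
have a01 : 0 < 1 - s < 1 by rewrite subr_gt0 lt_neqAle ns1 s1/= ltrBlDr ltrDl.
have [C C0 HC] := riesz_abs_bound n0 a01 mK (compact_measure_lty cK).
by apply: (le_lt_trans (HC u mu_)); exact: lte_mul_pinfty.
Qed.

End riesz_lift.

(** * The Riesz gradient *)

Section test_functions.
Context {R : realType} {n : nat}.
Local Notation space := 'rV[R]_n.
Implicit Types (U : set space) (f g phi psi : space -> R).

Lemma partials_lin k phi psi l : smooth phi -> smooth psi ->
  partials l (k *: phi + psi) = k *: partials l phi + partials l psi.
Proof.
move=> sp sq; elim: l => [//|i l IH] /=; rewrite IH; apply/funext => x.
have [_ dp] := sp l; have [_ dq] := sq l.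
rewrite /partial deriveD//; last exact: derivableZ.
by rewrite deriveZ.
Qed.

Lemma smooth_lin k phi psi : smooth phi -> smooth psi -> smooth (k *: phi + psi).
Proof.
move=> sp sq l; rewrite partials_lin//.
have [cp dp] := sp l; have [cq dq] := sq l; split.
  move=> x; apply: continuousD; last exact: cq.
  by apply: (@continuousM _ _ (fun=> k)); [exact: cst_continuous|exact: cp].
by move=> i x; apply: derivableD => //; exact: derivableZ.
Qed.

Lemma test_function_lin U k phi psi : test_function U phi -> test_function U psi ->
  test_function U (k *: phi + psi).
Proof.
move=> [sp cp pU] [sq cq qU].
have sub : Defs.support (k *: phi + psi) `<=` Defs.support phi `|` Defs.support psi.
  rewrite /Defs.support -closureU; apply: closure_subset => x /=.
  apply: contraPP => /not_orP[/negP/negPn/eqP p0 /negP/negPn/eqP q0].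
  by apply/negP/negPn/eqP; rewrite !fctE p0 q0 scaler0 addr0.
split; first exact: smooth_lin.
  apply: subclosed_compact sub; first exact: closed_closure.
  exact: compactU.
by apply: subset_trans sub _ => x [/pU|/qU].
Qed.

Lemma test_function0 U : test_function U (0 : space -> R).
Proof.
have s0 : Defs.support (0 : space -> R) = set0.
  rewrite /Defs.support (_ : [set _ | _] = set0) ?closure0//.
  by apply/seteqP; split => // x /=; rewrite eqxx.
split.
- by apply: bump_alg_smooth; exact: (bump_cst 0).
- by rewrite s0; exact: compact0.
- by rewrite s0; exact: sub0set.
Qed.

End test_functions.

Section vector_L2.
Context {R : realType} {n : nat}.
Local Notation space := 'rV[R]_n.
Local Notation mu := (@lebesgue_rV R n).
Implicit Types (F G H : space -> space) (f : space -> R).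

Definition vL2 F := forall i, (fun x => F x ord0 i) \in Lfun mu 2%:E.

Lemma LpT p f : Lp p setT f <-> f \in Lfun mu p.
Proof. by rewrite /Lp patch_setT. Qed.

Lemma vLpT F : vLp 2%:E setT F <-> vL2 F.
Proof. by split => h i; have := h i; rewrite LpT. Qed.

Lemma vL2_measurable F : vL2 F -> vmeasurable F.
Proof. by move=> LF i; exact: Lfun_measurable (LF i). Qed.

Lemma integrable_dotr F G : vL2 F -> vL2 G ->
  mu.-integrable setT (EFin \o (fun x => dotr (F x) (G x))).
Proof.
move=> LF LG.
rewrite (_ : EFin \o _ = (fun x => \sum_i (F x ord0 i * G x ord0 i)%:E)%E); last first.
  by apply/funext => x; rewrite /= /dotr sumEFin.
apply: integrable_sum => // i _.
exact: (Lfun2_mul_integrable (LF i) (LG i)).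
Qed.

Lemma vLpnorm2_sqrt F : vLpnorm 2%:E setT F = Num.sqrt (\int[mu]_x dotr (F x) (F x)).
Proof.
rewrite /vLpnorm /Lpnorm patch_setT Lnorm2_sqrt; congr Num.sqrt.
by apply: eq_Rintegral => x _; rewrite enorm_sqr.
Qed.

Lemma enorm_Lfun2 F : vL2 F -> (fun x => enorm (F x)) \in Lfun mu 2%:E.
Proof.
move=> LF; apply/Lfun2E; split; first by apply: measurable_enorm; exact: vL2_measurable.
have /integrableP[_] := integrable_dotr LF LF; apply: le_lt_trans.
rewrite le_eqVlt; apply/orP; left; apply/eqP; apply: eq_integral => x _.
by rewrite enorm_sqr /= ger0_norm// dotr_ge0.
Qed.

Lemma vL2_lin (k : R) F G : vL2 F -> vL2 G -> vL2 (fun x => k *: F x + G x).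
Proof. by move=> LF LG i; under eq_fun do rewrite !mxE; exact: Lfun2_lin. Qed.

Lemma ae_vL2 F G : (forall i, measurable_fun setT (fun x => G x ord0 i)) ->
  {ae mu, forall x, F x = G x} -> vL2 F -> vL2 G.
Proof.
move=> mG FG LF i; apply: (ae_eq_Lfun _ (mG i) _ (LF i)) => //.
by apply: filterS FG => x ->.
Qed.

End vector_L2.

Section riesz_gradient_theory.
Context {R : realType} {n : nat} (s : R).
Local Notation space := 'rV[R]_n.
Local Notation mu := (@lebesgue_rV R n).
Local Notation D := (riesz_gradient s).
Local Notation hasL2 := (has_L2_riesz_gradient s).
Implicit Types (u v : space -> R) (w : space -> space).

Lemma riesz_gradientP u : hasL2 u -> is_riesz_gradient s u (D u).
Proof. by move=> [_ ex _]; exact: (@getPex _ [set w | is_riesz_gradient s u w] ex). Qed.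

Lemma hasL2_Lfun u : hasL2 u -> u \in Lfun mu 2%:E.
Proof. by move=> [/LpT]. Qed.

Lemma hasL2_measurable u : hasL2 u -> measurable_fun setT u.
Proof. by move/hasL2_Lfun/Lfun_measurable. Qed.

Lemma hasL2_vL2 u : hasL2 u -> vL2 (D u).
Proof. by move=> [_ _ /vLpT]. Qed.

Lemma is_riesz_gradient_unique u w : hasL2 u -> is_riesz_gradient s u w ->
  {ae mu, forall x, D u x = w x}.
Proof.
move=> /riesz_gradientP/is_riesz_gradientE[_ gu] /is_riesz_gradientE[_ gw].
exact: weak_gradient_unique gu gw.
Qed.

Lemma is_riesz_gradient_lin (k : R) u v w z : measurable_fun setT u ->
  measurable_fun setT v -> is_riesz_gradient s u w -> is_riesz_gradient s v z ->
  is_riesz_gradient s (k *: u + v) (fun x => k *: w x + z x).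
Proof.
move=> mu_ mv /is_riesz_gradientE[lu gu] /is_riesz_gradientE[lv gv].
apply/is_riesz_gradientE; split; first exact: riesz_liftable_lin.
apply: (weak_gradient_ae (weak_gradient_lin k gu gv)).
  apply: measurable_riesz_lift; apply: measurable_funD => //; exact: measurable_funM.
by apply: filterS (riesz_lift_lin k mu_ mv lu lv) => x /esym.
Qed.

(* [D] is a choice among the almost everywhere equal gradients. *)
Lemma hasL2_intro u w : u \in Lfun mu 2%:E -> is_riesz_gradient s u w -> vL2 w ->
  hasL2 u /\ {ae mu, forall x, D u x = w x}.
Proof.
move=> Lu gw Lw.
have gD : is_riesz_gradient s u (D u).
  by apply: (@getPex _ [set w | is_riesz_gradient s u w]); exists w.
have /is_riesz_gradientE[_ gw'] := gw.
have /is_riesz_gradientE[_ gD'] := gD.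
have ae := weak_gradient_unique gw' gD'.
split; last by apply: filterS ae => x ->.
split; [exact/LpT|by exists w|apply/vLpT].
apply: ae_vL2 ae Lw => i; have [_ /(_ i) + _] := gD'.
exact: L1loc_measurable.
Qed.

Lemma hasL2_lin (k : R) u v : hasL2 u -> hasL2 v -> hasL2 (k *: u + v).
Proof.
move=> hu hv.
have gw := is_riesz_gradient_lin k (hasL2_measurable hu) (hasL2_measurable hv)
  (riesz_gradientP hu) (riesz_gradientP hv).
have Lw := vL2_lin k (hasL2_vL2 hu) (hasL2_vL2 hv).
have Luv := Lfun2_lin k (hasL2_Lfun hu) (hasL2_Lfun hv).
exact: (hasL2_intro Luv gw Lw).1.
Qed.

Lemma hasL2_sub u v : hasL2 u -> hasL2 v -> hasL2 (u - v).
Proof. by move=> hu hv; rewrite addrC -scaleN1r; exact: hasL2_lin. Qed.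

(** The multiple is written as [(k - 1) *: u + u], since membership of the zero function is proved
    only under conditions on [n] and [s]. *)
Lemma hasL2_scale (k : R) u : hasL2 u -> hasL2 (k *: u).
Proof.
by move=> hu; rewrite -(subrK u (k *: u)) -{2}(scale1r u) -scalerBl; exact: hasL2_lin.
Qed.

Lemma riesz_gradient_lin (k : R) u v : hasL2 u -> hasL2 v ->
  {ae mu, forall x, D (k *: u + v) x = k *: D u x + D v x}.
Proof.
move=> hu hv.
apply: is_riesz_gradient_unique; first exact: hasL2_lin.
exact: is_riesz_gradient_lin (hasL2_measurable hu) (hasL2_measurable hv)
  (riesz_gradientP hu) (riesz_gradientP hv).
Qed.

Definition gip u v : R := \int[mu]_x dotr (D u x) (D v x).

Lemma H0norm_sqrt u : H0norm s u = Num.sqrt (gip u u).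
Proof. exact: vLpnorm2_sqrt. Qed.

Lemma gipC u v : gip u v = gip v u.
Proof. by apply: eq_Rintegral => x _; exact: dotrC. Qed.

Lemma gip_linl (k : R) u v (w : space -> R) : hasL2 u -> hasL2 v -> hasL2 w ->
  gip (k *: u + v) w = k * gip u w + gip v w.
Proof.
move=> hu hv hw; have := hasL2_lin k hu hv => huv.
have [Lu Lv Lw Luv] := And4 (hasL2_vL2 hu) (hasL2_vL2 hv) (hasL2_vL2 hw) (hasL2_vL2 huv).
rewrite /gip -(Rintegral_lin k (integrable_dotr Lu Lw) (integrable_dotr Lv Lw)).
apply: ae_eq_Rintegral.
- by apply: measurable_dotr; exact: vL2_measurable.
- apply: measurable_funD; last by apply: measurable_dotr; exact: vL2_measurable.
  by apply: measurable_funM => //; apply: measurable_dotr; exact: vL2_measurable.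
- by apply: filterS (riesz_gradient_lin k hu hv) => x ->; rewrite dotr_linl.
Qed.

Lemma gip_ge0 u : 0 <= gip u u.
Proof. by apply: Rintegral_ge0 => x _; exact: dotr_ge0. Qed.

(** The inner product behind [riesz_norm]. It serves for approximation by test functions, whereas
    [gip] is the form of the variational problem. *)
Definition rip u v : R := \int[mu]_x (u x * v x) + gip u v.

Lemma ripC u v : rip u v = rip v u.
Proof. by rewrite /rip gipC; congr (_ + _); apply: eq_Rintegral => x _; rewrite mulrC. Qed.

Lemma rip_linl (k : R) u v (w : space -> R) : hasL2 u -> hasL2 v -> hasL2 w ->
  rip (k *: u + v) w = k * rip u w + rip v w.
Proof.
move=> hu hv hw; rewrite /rip gip_linl//.
have -> : \int[mu]_x ((k *: u + v) x * w x) = \int[mu]_x (k * (u x * w x) + v x * w x).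
  by apply: eq_Rintegral => x _; rewrite !fctE mulrDl -mulrA.
have iu := Lfun2_mul_integrable (hasL2_Lfun hu) (hasL2_Lfun hw).
have iv := Lfun2_mul_integrable (hasL2_Lfun hv) (hasL2_Lfun hw).
have -> : \int[mu]_x (k * (u x * w x) + v x * w x) =
    k * (\int[mu]_x (u x * w x)) + \int[mu]_x (v x * w x).
  exact: (Rintegral_lin k iu iv).
by rewrite mulrDr addrACA.
Qed.

Lemma rip_ge0 u : 0 <= rip u u.
Proof. by rewrite addr_ge0 ?gip_ge0// Rintegral_ge0// => x _; rewrite -expr2 sqr_ge0. Qed.

Lemma riesz_norm_sqrt u : riesz_norm s u = Num.sqrt (rip u u).
Proof.
rewrite /riesz_norm; congr Num.sqrt; congr (_ + _).
  by rewrite /Lpnorm patch_setT sqr_Lnorm2; apply: eq_Rintegral => x _; rewrite expr2.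
by rewrite vLpnorm2_sqrt sqr_sqrtr// gip_ge0.
Qed.

Lemma riesz_normD u v : hasL2 u -> hasL2 v ->
  riesz_norm s (u + v) <= riesz_norm s u + riesz_norm s v.
Proof.
rewrite !riesz_norm_sqrt => hu hv.
exact: (@nrmD R (space -> R) hasL2 rip (fun k u v => @hasL2_lin k u v)
  (fun u v _ _ => ripC u v) (fun k u v t => @rip_linl k u v t)
  (fun u _ => rip_ge0 u) u v hu hv).
Qed.

Lemma riesz_normZ (k : R) u : hasL2 u -> riesz_norm s (k *: u) = `|k| * riesz_norm s u.
Proof.
rewrite !riesz_norm_sqrt => hu.
exact: (@nrmZ R (space -> R) hasL2 rip (fun k u v => @hasL2_lin k u v)
  (fun u v _ _ => ripC u v) (fun k u v t => @rip_linl k u v t) k u hu).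
Qed.

Lemma hasL2_0 : (0 < n)%N -> 0 < s <= 1 -> hasL2 (0 : space -> R).
Proof.
move=> n0 s01.
have L0 : (0 : space -> R) \in Lfun mu 2%:E.
  apply/Lfun2E; split; first exact: measurable_cst.
  by under eq_integral do rewrite expr0n; rewrite integral0.
have i0 : mu.-integrable setT (EFin \o (0 : space -> R)) by exact: integrable0.
have [l0 Ll0] := integrable_riesz_liftable n0 s01 i0.
have lE : riesz_lift s (0 : space -> R) = 0.
  rewrite /riesz_lift; case: ifP => // _; apply/funext => x.
  rewrite /riesz_potential; under eq_Rintegral do rewrite mulr0.
  by rewrite Rintegral_cst// mul0r.
have g0 : is_riesz_gradient s (0 : space -> R) (fun=> 0).
  apply/is_riesz_gradientE; split => //; split => //.
    by move=> i K cK; under eq_fun do rewrite mxE; exact: integrable0.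
  move=> phi i _; rewrite lE.
  under eq_Rintegral do rewrite mul0r.
  by under [in RHS]eq_Rintegral do rewrite mxE mul0r; rewrite Rintegral_cst// mul0r oppr0.
apply: (hasL2_intro L0 g0 _).1 => i.
by under eq_fun do rewrite mxE; exact: L0.
Qed.

End riesz_gradient_theory.

(** * The space H^s_0 *)

Section H0_space.
Context {R : realType} {n : nat} (s : R) (U : set 'rV[R]_n).
Local Notation space := 'rV[R]_n.
Local Notation mu := (@lebesgue_rV R n).
Local Notation D := (riesz_gradient s).
Local Notation hasL2 := (has_L2_riesz_gradient s).
Local Notation nrm2 f := (fine 'N[mu]_2%:E[EFin \o f]).
Implicit Types (u v f phi : space -> R) (w : space -> space).

Lemma H0_hasL2 u : H0 s U u -> hasL2 u.
Proof. by case. Qed.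

Lemma H0_lin (k : R) u v : H0 s U u -> H0 s U v -> H0 s U (k *: u + v).
Proof.
move=> [hu au] [hv av]; split; first exact: hasL2_lin.
move=> eps eps0; have k1 : 0 < `|k| + 1 by rewrite ltr_wpDl.
have [|phi [tp hp lp]] := au (eps / 2 / (`|k| + 1)); first by rewrite !divr_gt0.
have [|psi [tq hq lq]] := av (eps / 2); first by rewrite divr_gt0.
exists (k *: phi + psi); split; [exact: test_function_lin|exact: hasL2_lin|].
have h1 : hasL2 (u - phi) by exact: hasL2_sub.
have h2 : hasL2 (v - psi) by exact: hasL2_sub.
have h3 : hasL2 (k *: (u - phi)) by exact: hasL2_scale.
have e : (k *: u + v) \- (k *: phi + psi) = k *: (u - phi) + (v - psi).
  by apply/funext => x; rewrite !fctE /GRing.scale/=; ring.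
rewrite e; apply: (le_lt_trans (riesz_normD h3 h2)); rewrite riesz_normZ//.
have -> : eps = eps / 2 + eps / 2 by field.
apply: ler_ltD => //; apply: (@le_trans _ _ ((`|k| + 1) * riesz_norm s (u - phi))).
  by rewrite ler_wpM2r ?sqrtr_ge0// lerDl.
by rewrite mulrC -ler_pdivlMr// ltW.
Qed.

Lemma H0_sub u v : H0 s U u -> H0 s U v -> H0 s U (u - v).
Proof. by move=> hu hv; rewrite addrC -scaleN1r; exact: H0_lin. Qed.

Lemma H0_0 : (0 < n)%N -> 0 < s <= 1 -> H0 s U (0 : space -> R).
Proof.
move=> n0 s01; have h0 := hasL2_0 n0 s01; split=> // eps eps0.
exists 0; split => //; first exact: test_function0.
have e : (0 : space -> R) \- 0 = 0 *: (0 : space -> R).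
  by apply/funext => x; rewrite !fctE /GRing.scale/= subr0 mulr0.
by rewrite e riesz_normZ// normr0 mul0r.
Qed.

(** For functions approximated by test functions: off the set carrying the approximant [phi], the
    function coincides with its distance to [phi], whose L^2 norm is as small as desired. *)
Lemma ae_eq0_on (C : set space) f : measurable C -> f \in Lfun mu 2%:E ->
  (forall e : R, 0 < e -> exists h, [/\ h \in Lfun mu 2%:E, \int[mu]_x (h x ^+ 2) < e &
     {ae mu, forall x, C x -> `|f x| <= `|h x|}]) ->
  {ae mu, forall x, C x -> f x = 0}.
Proof.
move=> mC Lf fh; have mf := Lfun_measurable Lf.
pose fC : space -> R := f \_ C.
have mfC : measurable_fun setT fC.
  by apply/(measurable_restrictT _ _).1 => //; exact: measurable_funTS.
have LfC : fC \in Lfun mu 2%:E.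
  apply: (Lfun_le _ mfC _ Lf).1 => // x.
  by rewrite /fC /patch; case: ifP => // _; rewrite normr0.
have ifC : mu.-integrable setT (EFin \o (fun x => fC x ^+ 2)) by exact: Lfun2_integrable_sqr.
have : \int[mu]_x (fC x ^+ 2) <= 0.
  apply/ler_addgt0Pr => e e0; rewrite add0r.
  have [h [Lh he hC]] := fh e e0; apply: le_trans (ltW he).
  have ih := Lfun2_integrable_sqr Lh.
  apply: fine_le; [exact: integrable_fin_num|exact: integrable_fin_num|].
  apply: ae_ge0_le_integral => //.
  - by move=> x _; rewrite lee_fin sqr_ge0.
  - by apply/measurable_EFinP; exact: measurable_funX.
  - by move=> x _; rewrite lee_fin sqr_ge0.
  - by apply/measurable_EFinP; apply: measurable_funX; exact: Lfun_measurable Lh.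
  - apply: filterS hC => x hC _; rewrite lee_fin /fC /patch.
    case: ifPn; last by rewrite expr0n sqr_ge0.
    rewrite inE => /hC fhx; rewrite -[leLHS]real_normK ?num_real//.
    by rewrite -[leRHS]real_normK ?num_real// ler_sqr ?nnegrE.
move=> le0.
have eq0 : (\int[mu]_x (fC x ^+ 2)%:E = 0)%E.
  rewrite -[LHS]fineK; last exact: (integrable_fin_num measurableT ifC).
  by congr EFin; apply/eqP; rewrite eq_le le0 Rintegral_ge0// => x _; rewrite sqr_ge0.
have := ae_eq0_integral_sqr mfC eq0; apply: filterS => x + Cx.
by rewrite /fC /patch mem_set.
Qed.

Hypothesis oU : open U.

Let mU : measurable U.
Proof. exact: open_measurable_rV. Qed.

Let mCU : measurable (~` U).
Proof. exact: measurableC. Qed.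

Lemma H0_eq0_off u : H0 s U u -> {ae mu, forall x, ~ U x -> u x = 0}.
Proof.
move=> [hu au]; apply: (@ae_eq0_on (~` U)) => //; first exact: hasL2_Lfun hu.
move=> e e0; have [|phi [tp hp lp]] := au (Num.sqrt e); first by rewrite sqrtr_gt0.
have h1 : hasL2 (u - phi) by exact: hasL2_sub.
exists (u - phi); split; first exact: hasL2_Lfun h1.
  have : riesz_norm s (u - phi) ^+ 2 < e.
    by rewrite -[ltRHS]sqr_sqrtr ?ltW// ltr_sqr ?nnegrE ?sqrtr_ge0//.
  rewrite riesz_norm_sqrt sqr_sqrtr ?rip_ge0//; apply: le_lt_trans.
  rewrite /rip (_ : \int[mu]_x ((u - phi) x * (u - phi) x) = \int[mu]_x ((u - phi) x ^+ 2)).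
    by rewrite lerDl gip_ge0.
  by apply: eq_Rintegral => x _; rewrite expr2.
apply: aeW => x Ux; have [_ _ sU] := tp.
rewrite !fctE (@notin_support_eq0 _ _ phi) ?subr0// => /sU.
exact: Ux.
Qed.

(** A property of the local case: for s < 1 the Riesz gradient is not local. By uniqueness of weak
    gradients on the complement of the support of [phi], it is enough to integrate against test
    functions supported there. *)
Lemma test_function_gradient_eq0 phi : s = 1 -> test_function U phi -> hasL2 phi ->
  {ae mu, forall x, ~ U x -> D phi x = 0}.
Proof.
move=> s1 tphi hphi; have := riesz_gradientP hphi.
move=> /is_riesz_gradientE[_]; rewrite /riesz_lift s1 eqxx => -[_ Lw fw].
have oS : open (~` Defs.support phi) by apply: closed_openC; exact: closed_closure.
have L0 i : L1loc (fun x : space => (0 : space) ord0 i).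
  by move=> K cK; under eq_fun do rewrite mxE; exact: integrable0.
have := @weak_gradient_unique_on R n _ (riesz_gradient 1 phi) (fun=> 0) oS Lw L0.
have h : forall psi i, test_function (~` Defs.support phi) psi ->
    \int[mu]_x (riesz_gradient 1 phi x ord0 i * psi x) = \int[mu]_x ((0 : space) ord0 i * psi x).
  move=> psi i tpsi; apply: oppr_inj; rewrite -fw//; last first.
    by have [? ? _] := tpsi; split.
  under [in RHS]eq_Rintegral do rewrite mxE mul0r.
  rewrite [RHS](_ : _ = 0); last by rewrite Rintegral_cst// mul0r oppr0.
  (* The supports of [phi] and [psi] are disjoint, so at each point [phi] or the partial derivative
     of [psi] vanishes. *)
  under eq_Rintegral => x _.
    rewrite [_ * _](_ : _ = 0); last first.
      have [sx|/notin_support_eq0 ->] := pselect (Defs.support phi x); last by rewrite mul0r.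
      rewrite partial_eq0 ?mulr0// => sx'.
      by have [_ _ /(_ _ sx')] := tpsi; apply.
    over.
  by rewrite Rintegral_cst// mul0r.
move=> /(_ h); apply: filterS => x hx Ux; apply: hx => sx; apply: Ux.
by have [_ _] := tphi; apply.
Qed.

(** It reconciles the integrals over Omega prescribed for s = 1 with integrals over the whole
    space. *)
Lemma H0_gradient_eq0_off u : s = 1 -> H0 s U u -> {ae mu, forall x, ~ U x -> D u x = 0}.
Proof.
move=> s1 [hu au].
have h i : {ae mu, forall x, ~ U x -> D u x ord0 i = 0}.
  apply: (@ae_eq0_on (~` U) (fun x => D u x ord0 i)) => //; first exact: hasL2_vL2 hu i.
  move=> e e0; have [|phi [tp hp lp]] := au (Num.sqrt e); first by rewrite sqrtr_gt0.
  have h1 : hasL2 ((-1) *: phi + u) by exact: hasL2_lin.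
  have e1 : u \- phi = (-1) *: phi + u.
    by rewrite scaleN1r addrC.
  rewrite e1 in lp.
  exists (fun x => enorm (D ((-1) *: phi + u) x)); split.
  - exact/enorm_Lfun2/hasL2_vL2.
  - have : riesz_norm s ((-1) *: phi + u) ^+ 2 < e.
      by rewrite -[ltRHS]sqr_sqrtr ?ltW// ltr_sqr ?nnegrE ?sqrtr_ge0//.
    rewrite riesz_norm_sqrt sqr_sqrtr ?rip_ge0//; apply: le_lt_trans.
    under eq_Rintegral do rewrite enorm_sqr.
    by rewrite /rip lerDr Rintegral_ge0// => x _; rewrite -expr2 sqr_ge0.
  - apply: filterS2 (riesz_gradient_lin (-1) hp hu) (test_function_gradient_eq0 s1 tp hp).
    move=> x -> + nU => /(_ nU) ->; rewrite scaler0 add0r [leRHS]ger0_norm ?enorm_ge0//.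
    exact: coord_le_enorm.
have {}h : {ae mu, forall x (k : nat), if insub k is Some i then
    ~ U x -> D u x ord0 (i : 'I_n) = 0 else True}.
  apply: ae_foralln => k; case: insub => [i|]; last exact: aeW.
  exact: h.
apply: filterS h => x hx Ux; apply/rowP => i.
by have := hx i; rewrite valK mxE => /(_ Ux).
Qed.

End H0_space.

(** * Poincare inequality and completeness of H^s_0 *)

Section completeness.
Context {R : realType} {n : nat} (s : R) (U : set 'rV[R]_n).
Local Notation space := 'rV[R]_n.
Local Notation mu := (@lebesgue_rV R n).
Local Notation D := (riesz_gradient s).
Local Notation hasL2 := (has_L2_riesz_gradient s).
Local Notation nrm2 f := (fine 'N[mu]_2%:E[EFin \o f]).
Implicit Types (u v f phi : space -> R) (w : space -> space).

Hypothesis n_gt0 : (0 < n)%N.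
Hypothesis s01 : 0 < s <= 1.
Hypothesis s_lt : 2 * s < n%:R.
Hypothesis oU : open U.
Hypothesis bU : bounded_set U.
Variable Cs : R.
Hypothesis sobolev : is_sobolev_constant s U Cs.

Let mU : measurable U.
Proof. exact: open_measurable_rV. Qed.

Let Ufin : (mu U < +oo)%E.
Proof. exact: bounded_measure_lty. Qed.

Let s0 : 0 < s. Proof. by have /andP[] := s01. Qed.

Let nR0 : 0 < n%:R :> R. Proof. by rewrite ltr0n. Qed.

Lemma indic_Lfun (p : R) (A : set space) : 0 < p -> measurable A -> (mu A < +oo)%E ->
  (\1_A : space -> R) \in Lfun mu p%:E.
Proof.
move=> p0 mA Afin; apply/(LfunE _ _ p0); split; first exact: measurable_indic.
apply: le_lt_trans Afin; rewrite le_eqVlt; apply/orP; left; apply/eqP.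
transitivity (\int[mu]_x (\1_A x)%:E)%E; last by rewrite integral_indic// setIT.
apply: eq_integral => x _; congr EFin; rewrite indicE.
by case: (x \in A); rewrite ?normr1 ?powR1// normr0 powR0// gt_eqF.
Qed.

Lemma patchE_indic f : f \_ U = \1_U \* (f \_ U).
Proof.
apply/funext => x; rewrite /patch /= indicE; case: (x \in U); first by rewrite mul1r.
by rewrite mulr0.
Qed.

Lemma sobolev_exponent_gt0 : 0 < sobolev_exponent n s.
Proof. by rewrite divr_gt0 ?mulr_gt0// subr_gt0. Qed.

(* Hoelder between the Sobolev bound and the indicator of the bounded set [U]. *)
Lemma poincare : exists2 P, 0 <= P & forall u, H0 s U u -> nrm2 u <= P * H0norm s u.
Proof.
have [Cs0 sob] := sobolev.
have p0 : 0 < n%:R / s by rewrite divr_gt0.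
have q0 := sobolev_exponent_gt0.
have pq : (n%:R / s)^-1 + (sobolev_exponent n s)^-1 = 2^-1.
  by rewrite /sobolev_exponent; field; rewrite !gt_eqF// subr_gt0.
pose N := fine 'N[mu]_(n%:R / s)%:E[EFin \o (\1_U : space -> R)]%E.
exists (N * Cs); first by rewrite mulr_ge0// Lnorm_fine_ge0.
move=> u Hu; have [Lu le] := sob u Hu.
have [L2 le2] := Lfun_mul p0 q0 (ltr0Sn R 1) pq (indic_Lfun p0 mU Ufin) Lu.
have -> : nrm2 u = nrm2 (\1_U \* (u \_ U)).
  congr fine; apply: ae_eq_Lnorm => //.
  - exact: (hasL2_measurable (H0_hasL2 Hu)).
  - exact: Lfun_measurable L2.
  - apply: filterS (H0_eq0_off oU Hu) => x hx; rewrite -patchE_indic /patch.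
    by case: ifPn => //; rewrite notin_setE => /hx.
apply: (le_trans le2); rewrite -mulrA ler_wpM2l// Lnorm_fine_ge0//.
Qed.

Lemma cvg_geometric_bound (k C : R) (a : nat -> R) : 0 < k < 1 ->
  (forall m, 0 <= a m) -> (forall m, a m <= C * k ^+ m) -> a @ \oo --> (0 : R).
Proof.
move=> /andP[k0 k1] a0 ak.
apply: (@squeeze_cvgr _ _ _ _ (fun=> 0) (fun m => C * k ^+ m)); last 2 first.
- exact: cvg_cst.
- rewrite -(mulr0 C); apply: cvgM; first exact: cvg_cst.
  by apply: cvg_expr; rewrite ger0_norm// ltW.
by apply: nearW => m; rewrite a0 ak.
Qed.

Lemma cvg_scale0 (c : R) (a : nat -> R) : a @ \oo --> (0 : R) ->
  (fun m => c * a m) @ \oo --> (0 : R).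
Proof.
by move=> a0; rewrite -[X in _ --> X](mulr0 c); apply: cvgM => //; exact: cvg_cst.
Qed.

Lemma cvg_sqrt0 (a : nat -> R) : a @ \oo --> (0 : R) ->
  (fun m => Num.sqrt (a m)) @ \oo --> (0 : R).
Proof.
move=> a0; rewrite -[X in _ --> X](@sqrtr0 R).
by apply: continuous_cvg a0; exact: sqrt_continuous.
Qed.

Lemma Lnorm2_le_sqrt f (C : R) : measurable_fun setT f ->
  (\int[mu]_x (f x ^+ 2)%:E <= C%:E)%E -> f \in Lfun mu 2%:E /\ nrm2 f <= Num.sqrt C.
Proof.
move=> mf fC; have Lf : f \in Lfun mu 2%:E.
  by apply/Lfun2E; split => //; exact: le_lt_trans fC (ltry _).
split => //; rewrite Lnorm2_sqrt ler_wsqrtr// -lee_fin fineK//.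
exact: (integrable_fin_num measurableT (Lfun2_integrable_sqr Lf)).
Qed.

Lemma integral_sqr_fine f : f \in Lfun mu 2%:E ->
  (\int[mu]_x (f x ^+ 2)%:E = (nrm2 f ^+ 2)%:E)%E.
Proof.
move=> Lf; rewrite sqr_Lnorm2 fineK//.
exact: (integrable_fin_num measurableT (Lfun2_integrable_sqr Lf)).
Qed.

(** Poincare transfers the rate of the gradients to the functions, and [riesz_fischer] applies to
    the functions and to each coordinate of the gradients. It remains to identify the limit of the
    gradients as the gradient of the limit, for which the lifts must converge in L^1_loc. The almost
    everywhere convergence in the conclusion is meant for the pointwise constraint. *)
Lemma H0_complete (u_ : nat -> space -> R) (C k : R) : 0 < k < 1 ->
  (forall m, H0 s U (u_ m)) ->
  (forall m, H0norm s (u_ m.+1 - u_ m) <= C * k ^+ m) ->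
  exists v, [/\ H0 s U v, (fun m => H0norm s (u_ m - v)) @ \oo --> (0 : R) &
    {ae mu, forall x, forall i, (fun m => D (u_ m) x ord0 i) @ \oo --> D v x ord0 i}].
Proof.
move=> k01 Hu uC; have /andP[k0 k1] := k01.
have hu m := H0_hasL2 (Hu m).
have C0 : 0 <= C by have := uC 0; rewrite expr0 mulr1; apply: le_trans; exact: Lnorm_fine_ge0.
have Hd m := H0_sub (Hu m.+1) (Hu m).
have hd m := H0_hasL2 (Hd m).
have [P P0 poin] := poincare.
have [g [mg _ [C1 gC1]]] : exists g : space -> R, [/\ measurable_fun setT g,
    {ae mu, forall x, u_ ^~ x @ \oo --> g x} &
    exists C', forall m, (\int[mu]_x ((u_ m x - g x) ^+ 2)%:E <= (C' * k ^+ m)%:E)%E].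
  apply: (@riesz_fischer _ _ _ mu _ ((P * C) ^+ 2) k k01).
    by move=> m; exact: hasL2_measurable.
  move=> m; have := integral_sqr_fine (hasL2_Lfun (hd m)) => /= ->.
  rewrite lee_fin -exprMn ler_sqr ?nnegrE ?Lnorm_fine_ge0//; last first.
    by rewrite !mulr_ge0// exprn_ge0// ltW.
  by apply: (le_trans (poin _ (Hd m))); rewrite -mulrA ler_wpM2l.
(* Truncation changes no limit, since the [u_ m] vanish almost everywhere outside [U], and it makes
   [v] integrable, hence liftable. *)
pose v : space -> R := g \_ U.
have mv : measurable_fun setT v.
  by apply/(measurable_restrictT _ _).1 => //; exact: measurable_funTS.
have uoff m := H0_eq0_off oU (Hu m).
have muv m : measurable_fun setT (u_ m - v).
  by apply: measurable_funB => //; exact: hasL2_measurable.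
have uv m : (\int[mu]_x ((u_ m - v) x ^+ 2)%:E <= (C1 * k ^+ m)%:E)%E.
  apply: le_trans (gC1 m); apply: ae_ge0_le_integral => //.
  - by move=> x _; rewrite lee_fin sqr_ge0.
  - by apply/measurable_EFinP; exact: measurable_funX.
  - by move=> x _; rewrite lee_fin sqr_ge0.
  - apply/measurable_EFinP; apply: measurable_funX; apply: measurable_funB => //.
    exact: hasL2_measurable.
  - apply: filterS (uoff m) => x ux _; rewrite lee_fin !fctE /v /patch.
    by case: ifPn => //; rewrite notin_setE => /ux ->; rewrite subr0 expr0n sqr_ge0.
have Luv m : (u_ m - v) \in Lfun mu 2%:E /\ nrm2 (u_ m - v) <= Num.sqrt (C1 * k ^+ m).
  exact: Lnorm2_le_sqrt.
have uv0 : (fun m => Num.sqrt (C1 * k ^+ m)) @ \oo --> (0 : R).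
  apply: cvg_sqrt0; rewrite -(mulr0 C1); apply: cvgM; first exact: cvg_cst.
  by apply: cvg_expr; rewrite ger0_norm// ltW.
have Lv : v \in Lfun mu 2%:E.
  have := Lfun2_lin (-1) (Luv 0).1 (hasL2_Lfun (hu 0)).
  rewrite (_ : (fun x => _) = v)//; apply/funext => x.
  by rewrite !fctE mulN1r opprB subrK.
have grad_lin m := riesz_gradient_lin (-1) (hu m) (hu m.+1).
have dE m : u_ m.+1 - u_ m = (-1) *: u_ m + u_ m.+1 by rewrite scaleN1r addrC.
(* The limit and the constant of its rate are chosen together, coordinate by coordinate. *)
have /boolp.choice[W WP] : forall i : 'I_n, exists gC : (space -> R) * R,
    [/\ measurable_fun setT gC.1,
    {ae mu, forall x, (fun m => D (u_ m) x ord0 i) @ \oo --> gC.1 x} &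
    forall m, (\int[mu]_x ((D (u_ m) x ord0 i - gC.1 x) ^+ 2)%:E <= (gC.2 * k ^+ m)%:E)%E].
  move=> i.
  have [||h [mh hae [C' hC']]] := @riesz_fischer _ _ _ mu (fun m x => D (u_ m) x ord0 i) (C ^+ 2) k k01.
  - by move=> m; exact: Lfun_measurable (hasL2_vL2 (hu m) i).
  - move=> m; apply: (@le_trans _ _ (\int[mu]_x (dotr (D (u_ m.+1 - u_ m) x) (D (u_ m.+1 - u_ m) x))%:E)%E).
      apply: ae_ge0_le_integral => //.
      + by move=> x _; rewrite lee_fin sqr_ge0.
      + apply/measurable_EFinP; apply: measurable_funX; apply: measurable_funB => //.
          exact: Lfun_measurable (hasL2_vL2 (hu m.+1) i).
        exact: Lfun_measurable (hasL2_vL2 (hu m) i).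
      + by move=> x _; rewrite lee_fin dotr_ge0.
      + apply/measurable_EFinP; apply: measurable_dotr; apply: vL2_measurable; exact: hasL2_vL2.
      + apply: filterS (grad_lin m) => x ex _; rewrite lee_fin dE ex.
        rewrite -enorm_sqr -[leLHS]real_normK ?num_real// ler_sqr ?nnegrE ?enorm_ge0//.
        have := coord_le_enorm (-1 *: D (u_ m) x + D (u_ m.+1) x) i.
        by rewrite !mxE mulN1r addrC.
    have id := integrable_dotr (hasL2_vL2 (hd m)) (hasL2_vL2 (hd m)).
    rewrite -[leLHS]fineK; last exact: (integrable_fin_num measurableT id).
    rewrite lee_fin -exprMn; have := uC m; rewrite H0norm_sqrt => h.
    rewrite -[leLHS](@sqr_sqrtr R); last exact: gip_ge0.
    by rewrite ler_sqr ?nnegrE ?sqrtr_ge0 ?mulr_ge0 ?exprn_ge0// ltW.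
  by exists (h, C').
pose w x : space := \row_i (W i).1 x.
have mW i : measurable_fun setT (W i).1 by have [] := WP i.
have wE i : (fun x => w x ord0 i) = (W i).1 by apply/funext => x; rewrite mxE.
have mDW m i : measurable_fun setT (fun x => D (u_ m) x ord0 i - (W i).1 x).
  by apply: measurable_funB => //; exact: Lfun_measurable (hasL2_vL2 (hu m) i).
have DW m i : (fun x => D (u_ m) x ord0 i - (W i).1 x) \in Lfun mu 2%:E /\
    nrm2 (fun x => D (u_ m) x ord0 i - (W i).1 x) <= Num.sqrt ((W i).2 * k ^+ m).
  by apply: Lnorm2_le_sqrt => //; have [_ _] := WP i; exact.
have DW0 i : (fun m => Num.sqrt ((W i).2 * k ^+ m)) @ \oo --> (0 : R).
  apply: cvg_sqrt0; rewrite -(mulr0 (W i).2); apply: cvgM; first exact: cvg_cst.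
  by apply: cvg_expr; rewrite ger0_norm// ltW.
have Lw : vL2 w.
  move=> i; rewrite wE; have := Lfun2_lin (-1) (DW 0 i).1 (hasL2_vL2 (hu 0) i).
  rewrite (_ : (fun x => _) = (W i).1)//; apply/funext => x.
  by rewrite mulN1r opprB subrK.
(* Cauchy-Schwarz on the bounded set turns the L^2 rates of the functions into L^1 rates, as
   [riesz_lift_bound] demands. Gradients may be nonzero outside [U] when s < 1 and are compared on
   compact sets only. *)
have L1U f : f \in Lfun mu 2%:E -> {ae mu, forall x, ~ U x -> f x = 0} ->
   (\int[mu]_x (`|f x|)%:E <= (Num.sqrt (fine (mu U)) * nrm2 f)%:E)%E.
  move=> Lf f0; apply: le_trans (L2_L1_bound mU Ufin Lf).
  rewrite [leRHS]integral_mkcond; apply: ae_ge0_le_integral => //.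
  - apply/measurable_EFinP; apply: measurableT_comp => //; exact: Lfun_measurable Lf.
  - by move=> x _; rewrite /patch; case: ifPn.
  - apply/(measurable_restrictT _ _).1 => //; apply/measurable_funTS/measurable_EFinP.
    apply: measurableT_comp => //; exact: Lfun_measurable Lf.
  - apply: filterS f0 => x f0 _; rewrite /patch; case: ifPn => //.
    by rewrite notin_setE => /f0 ->; rewrite normr0.
have voff x : ~ U x -> v x = 0 by move=> nU; rewrite /v /patch memNset.
have iv : mu.-integrable setT (EFin \o v).
  apply/integrableP; split; first exact/measurable_EFinP.
  by apply: le_lt_trans (L1U v Lv (aeW _ voff)) _; exact: ltry.
have [lv Llv] := integrable_riesz_liftable n_gt0 s01 iv.
have lu m : riesz_liftable s (u_ m) /\ is_weak_gradient (riesz_lift s (u_ m)) (D (u_ m)).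
  by apply/is_riesz_gradientE; exact: riesz_gradientP.
have gw : is_riesz_gradient s v w.
  apply/is_riesz_gradientE; split => //.
  apply: (@weak_gradient_limit _ _ (fun m => riesz_lift s (u_ m)) (fun m => D (u_ m))) => //.
  - by move=> m; exact: (lu m).2.
  - by move=> i; apply: Lfun2_L1loc; exact: Lw.
  - move=> K cK; have mK := compact_measurable_rV cK.
    have [CK CK0 HK] := riesz_lift_bound n_gt0 s01 cK.
    exists (fun m => CK * (Num.sqrt (fine (mu U)) * Num.sqrt (C1 * k ^+ m))).
      exact: (cvg_scale0 CK (cvg_scale0 (Num.sqrt (fine (mu U))) uv0)).
    move=> m; have ae := riesz_lift_lin (-1) mv (hasL2_measurable (hu m)) lv (lu m).1.
    have e : (fun x => -1 * v x + u_ m x) = u_ m - v.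
      by apply/funext => x; rewrite !fctE; ring.
    rewrite e in ae.
    apply: (@le_trans _ _ (\int[mu]_(x in K) (`|riesz_lift s (u_ m - v) x|)%:E)%E).
      have mlu := measurable_riesz_lift s (hasL2_measurable (hu m)).
      have mlv := measurable_riesz_lift s mv.
      have mluv := measurable_riesz_lift s (muv m).
      apply: ae_ge0_le_integral => //.
      + by apply/measurable_funTS/measurable_EFinP/measurableT_comp => //; exact: measurable_funB.
      + by apply/measurable_funTS/measurable_EFinP/measurableT_comp.
      + by apply: filterS ae => x -> _; rewrite lee_fin mulN1r addrC.
    apply: (le_trans (HK _ (muv m))); rewrite EFinM; apply: lee_wpmul2l => //.
    apply: (le_trans (L1U _ (Luv m).1 _)).
      by apply: filterS (uoff m) => x ux nU; rewrite !fctE ux// voff// subr0.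
    by rewrite lee_fin ler_wpM2l ?sqrtr_ge0//; exact: (Luv m).2.
  - move=> i K cK; have mK := compact_measurable_rV cK.
    exists (fun m => Num.sqrt (fine (mu K)) * Num.sqrt ((W i).2 * k ^+ m)).
      exact: (cvg_scale0 (Num.sqrt (fine (mu K))) (DW0 i)).
    move=> m; under eq_integral do rewrite mxE.
    apply: le_trans (L2_L1_bound mK (compact_measure_lty cK) (DW m i).1) _.
    by rewrite lee_fin ler_wpM2l ?sqrtr_ge0//; exact: (DW m i).2.
have [hv Dv] := hasL2_intro Lv gw Lw.
have huv m : hasL2 (u_ m - v) := hasL2_sub (hu m) hv.
have gipuv m : gip s (u_ m - v) (u_ m - v) = \sum_i nrm2 (fun x => D (u_ m) x ord0 i - (W i).1 x) ^+ 2.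
  under eq_bigr do rewrite sqr_Lnorm2.
  have i2 (i : 'I_n) := Lfun2_integrable_sqr (DW m i).1.
  rewrite -(Rintegral_sum _ i2).
  apply: ae_eq_Rintegral.
  - have mD := vL2_measurable (hasL2_vL2 (huv m)).
    exact: (measurable_dotr mD mD).
  - by apply: measurable_sum => i; apply: measurable_funX; exact: mDW.
  have := riesz_gradient_lin (-1) hv (hu m).
  have -> : (-1) *: v + u_ m = u_ m - v by rewrite scaleN1r addrC.
  apply: filterS2 Dv => x ->; rewrite /dotr => ->; apply: eq_bigr => i _.
  by rewrite !mxE; ring.
have gip0 : (fun m => gip s (u_ m - v) (u_ m - v)) @ \oo --> (0 : R).
  apply: (@cvg_geometric_bound k (\sum_i `|(W i).2|)) => //.
    by move=> m; exact: gip_ge0.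
  move=> m; rewrite gipuv mulr_suml; apply: ler_sum => i _.
  have kn : 0 <= k ^+ m by rewrite exprn_ge0// ltW.
  apply: (@le_trans _ _ (Num.sqrt (`|(W i).2| * k ^+ m) ^+ 2)).
    rewrite ler_sqr ?nnegrE ?sqrtr_ge0 ?Lnorm_fine_ge0//.
    apply: (le_trans (DW m i).2); rewrite ler_wsqrtr// ler_wpM2r// ler_norm//.
  by rewrite sqr_sqrtr// mulr_ge0.
have uv_cvg : (fun m => H0norm s (u_ m - v)) @ \oo --> (0 : R).
  by under eq_fun do rewrite H0norm_sqrt; exact: cvg_sqrt0.
exists v; split => //; last first.
  have {}WP : {ae mu, forall x (j : nat), if insub j is Some i then
      (fun m => D (u_ m) x ord0 (i : 'I_n)) @ \oo --> (W i).1 x else True}.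
    apply: ae_foralln => j; case: insub => [i|]; last exact: aeW.
    by have [] := WP i.
  apply: filterS2 Dv WP => x -> hx i.
  by have := hx i; rewrite valK mxE.
split=> // eps eps0.
have rn0 : (fun m => riesz_norm s (u_ m - v)) @ \oo --> (0 : R).
  under eq_fun do rewrite riesz_norm_sqrt.
  apply: cvg_sqrt0; rewrite -[X in _ --> X](addr0 0); apply: cvgD => //.
  apply: (@cvg_geometric_bound k C1) => //.
    by move=> m; apply: Rintegral_ge0 => x _; rewrite -expr2 sqr_ge0.
  move=> m; have -> : \int[mu]_x ((u_ m - v) x * (u_ m - v) x) = nrm2 (u_ m - v) ^+ 2.
    by rewrite sqr_Lnorm2; apply: eq_Rintegral => x _; rewrite expr2.
  rewrite -lee_fin -(integral_sqr_fine (Luv m).1); exact: uv.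
(* Closure is inherited: a test function close to [u_ m], for a late [m], is close to [v]. *)
have [m um] : exists m, riesz_norm s (u_ m - v) < eps / 2.
  move: rn0 => /cvgr_lt/(_ (eps / 2)); rewrite divr_gt0// => /(_ isT)[N _ HN].
  by exists N; exact: HN (leqnn N).
have [|phi [tp hp lp]] := (Hu m).2 (eps / 2); first by rewrite divr_gt0.
exists phi; split => //.
have e : v \- phi = (-1) *: (u_ m - v) + (u_ m - phi).
  by apply/funext => x; rewrite !fctE /GRing.scale/=; ring.
have h1 : hasL2 ((-1) *: (u_ m - v)) := hasL2_scale (-1) (huv m).
have h2 : hasL2 (u_ m - phi) := hasL2_sub (hu m) hp.
rewrite e; apply: (le_lt_trans (riesz_normD h1 h2)).
rewrite (riesz_normZ (-1) (huv m)) normrN1 mul1r.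
by rewrite [ltRHS]splitr; exact: (ltrD um lp).
Qed.

End completeness.

(** * The bilinear form and the load *)

Section integral_bounds.
Context d (T : measurableType d) (R : realType).
Variable mu : {measure set T -> \bar R}.
Implicit Types (f g h : T -> R) (p q r : R).

Local Notation nrm p f := (fine 'N[mu]_p%:E[EFin \o f]).

Lemma Linfty_bounded f : f \in Lfun mu +oo%E -> exists2 M, 0 <= M &
  {ae mu, forall x, `|f x| <= M}.
Proof.
rewrite inE => /andP[_]; rewrite inE/= /finite_norm unlock /=.
(* When [mu] is the zero measure the norm is 0 by convention, and the whole space serves as the
   exceptional set. *)
case: ifPn => [mu0|]; last first.
  rewrite -leNgt => mu0 _; exists 0 => //; exists setT; split => //.
  by apply/eqP; rewrite eq_le mu0 measure_ge0.
move=> lty; have [M HM] : exists M : R, {ae mu, forall x, `|f x| <= M}.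
  exact: (@ess_supr_bounded _ _ _ mu (fun x => `|f x|)).
exists `|M| => //; apply: filterS HM => x /le_trans; apply; exact: ler_norm.
Qed.

Lemma Linfty_mul f g M : f \in Lfun mu +oo%E -> 0 <= M ->
  {ae mu, forall x, `|f x| <= M} -> g \in Lfun mu 2%:E ->
  (f \* g) \in Lfun mu 2%:E /\ nrm 2 (f \* g) <= M * nrm 2 g.
Proof.
move=> Lf M0 fM Lg; have mf := Lfun_measurable Lf; have mg := Lfun_measurable Lg.
have mfg := measurable_funM mf mg.
have LMg : (fun x => M * g x) \in Lfun mu 2%:E.
  have L0 : (fun=> 0 : R) \in Lfun mu 2%:E.
    apply/Lfun2E; split; first exact: measurable_cst.
    by under eq_integral do rewrite expr0n; rewrite integral0.
  by have := Lfun2_lin M Lg L0; rewrite (_ : (fun x => _) = (fun x => M * g x))//;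
    apply/funext => x; rewrite addr0.
have le : (\int[mu]_x ((f x * g x) ^+ 2)%:E <= \int[mu]_x ((M * g x) ^+ 2)%:E)%E.
  apply: ae_ge0_le_integral => //.
  - by move=> x _; rewrite lee_fin sqr_ge0.
  - by apply/measurable_EFinP; exact: measurable_funX.
  - by move=> x _; rewrite lee_fin sqr_ge0.
  - apply/measurable_EFinP; apply: measurable_funX.
    exact: Lfun_measurable LMg.
  - apply: filterS fM => x fM _; rewrite lee_fin !exprMn ler_wpM2r ?sqr_ge0//.
    by rewrite -[leLHS]real_normK ?num_real// ler_sqr ?nnegrE.
have Lfg : (f \* g) \in Lfun mu 2%:E.
  by apply/Lfun2E; split => //; apply: (le_lt_trans le); have /Lfun2E[] := LMg.
split => //.
have -> : M * nrm 2 g = nrm 2 (fun x => M * g x).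
  rewrite !Lnorm2_sqrt; under [in RHS]eq_Rintegral do rewrite exprMn.
  rewrite RintegralZl//; last exact: Lfun2_integrable_sqr.
  by rewrite sqrtrM ?sqr_ge0// sqrtr_sqr ger0_norm.
rewrite !Lnorm2_sqrt ler_wsqrtr//; apply: fine_le => //.
- exact: (integrable_fin_num measurableT (Lfun2_integrable_sqr Lfg)).
- exact: (integrable_fin_num measurableT (Lfun2_integrable_sqr LMg)).
Qed.

Lemma integrable_dominated f g : measurable_fun setT f -> (forall x, `|f x| <= `|g x|) ->
  mu.-integrable setT (EFin \o g) ->
  mu.-integrable setT (EFin \o f) /\ `|\int[mu]_x f x| <= \int[mu]_x `|g x|.
Proof.
move=> mf fg ig.
have if' : mu.-integrable setT (EFin \o f).
  apply: le_integrable ig => //; first exact/measurable_EFinP.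
  by move=> x _; rewrite /= lee_fin.
split => //; apply: le_trans (le_normr_Rintegral measurableT if') _.
apply: le_Rintegral => //.
- exact: (integrable_abse if').
- exact: (integrable_abse ig).
Qed.

Lemma Lfun_addr p f g : 1 <= p -> f \in Lfun mu p%:E -> g \in Lfun mu p%:E ->
  (fun x => f x + g x) \in Lfun mu p%:E.
Proof.
move=> p1 Lf Lg.
have p1' : (1 <= p%:E)%E by rewrite lee_fin.
exact: ((Lfun_addr_closed mu p1').2 _ _ Lf Lg).
Qed.

Lemma Lfun0_real p : 0 < p -> (fun=> 0 : R) \in Lfun mu p%:E.
Proof.
move=> p0; apply/(LfunE _ _ p0); split; first exact: measurable_cst.
under eq_integral do rewrite normr0 powR0 ?gt_eqF//.
by rewrite integral0.
Qed.

Lemma Lfun_Rsum p (I : Type) (s : seq I) (F : I -> T -> R) : 1 <= p ->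
  (forall i, F i \in Lfun mu p%:E) -> (fun x => \sum_(i <- s) F i x) \in Lfun mu p%:E.
Proof.
move=> p1 LF; elim: s => [|i s IH].
  by under eq_fun do rewrite big_nil; apply: Lfun0_real; exact: lt_le_trans p1.
by under eq_fun do rewrite big_cons; exact: Lfun_addr.
Qed.

Lemma Lfun_abs p f : 0 < p -> f \in Lfun mu p%:E -> (fun x => `|f x|) \in Lfun mu p%:E.
Proof.
move=> p0 Lf; apply: (Lfun_le p0 _ _ Lf).1.
  by apply: measurableT_comp => //; exact: Lfun_measurable Lf.
by move=> x; rewrite normr_id.
Qed.

Lemma Lfun_mul3 p q t f g h : 0 < p -> 0 < q -> 0 < t -> p^-1 + q^-1 + t^-1 = 1 ->
  f \in Lfun mu p%:E -> g \in Lfun mu q%:E -> h \in Lfun mu t%:E ->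
  mu.-integrable setT (EFin \o (fun x => f x * g x * h x)) /\
  \int[mu]_x `|f x * g x * h x| <= nrm p f * nrm q g * nrm t h.
Proof.
move=> p0 q0 t0 pqt Lf Lg Lh; pose r := p^-1 + q^-1.
have ri0 : 0 < r^-1 by rewrite invr_gt0 addr_gt0// invr_gt0.
have pqr : p^-1 + q^-1 = r^-1^-1 by rewrite invrK.
have [Lfg le1] := Lfun_mul p0 q0 ri0 pqr Lf Lg.
have e1 : r^-1^-1 + t^-1 = 1 by rewrite invrK.
have [int le2] := Lfun_mul_integrable ri0 t0 e1 Lfg Lh.
by split => //; apply: (le_trans le2); rewrite ler_wpM2r// Lnorm_fine_ge0.
Qed.

Lemma Rintegral_ge0_ae f : measurable_fun setT f -> {ae mu, forall x, 0 <= f x} ->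
  0 <= \int[mu]_x f x.
Proof.
move=> mf f0; rewrite (_ : \int[mu]_x f x = \int[mu]_x `|f x|).
  by apply: Rintegral_ge0 => x _; exact: normr_ge0.
apply: ae_eq_Rintegral => //; first exact: measurableT_comp.
by apply: filterS f0 => x /ger0_norm.
Qed.

End integral_bounds.

Section restriction.
Context {R : realType} {n : nat} (U : set 'rV[R]_n).
Local Notation space := 'rV[R]_n.
Local Notation mu := (@lebesgue_rV R n).
Implicit Types (f : space -> R) (F : space -> space).

Definition vrestrict F : space -> space := fun x => (\1_U x : R) *: F x.

Lemma patch_indic f x : (f \_ U) x = \1_U x * f x.
Proof. by rewrite /patch indicE; case: (x \in U); rewrite ?mul1r ?mul0r. Qed.

Lemma vrestrict_coord F i : (fun x => vrestrict F x ord0 i) = (fun x => F x ord0 i) \_ U.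
Proof. by apply/funext => x; rewrite patch_indic mxE. Qed.

Lemma enorm_vrestrict F : (fun x => enorm (vrestrict F x)) = (fun x => enorm (F x)) \_ U.
Proof.
by apply/funext => x; rewrite patch_indic enormZ indicE ger0_norm.
Qed.

Lemma enorm_Lfun (p : R) F : 1 <= p -> (forall i, (fun x => F x ord0 i) \in Lfun mu p%:E) ->
  (fun x => enorm (F x)) \in Lfun mu p%:E.
Proof.
move=> p1 LF; have p0 : 0 < p by exact: lt_le_trans p1.
have LS : (fun x => \sum_i `|F x ord0 i|) \in Lfun mu p%:E.
  by apply: Lfun_Rsum => // i; exact: Lfun_abs.
apply: (Lfun_le p0 _ _ LS).1.
  by apply: measurable_enorm => i; exact: Lfun_measurable (LF i).
move=> x; rewrite !ger0_norm ?enorm_ge0 ?sumr_ge0//; exact: enorm_le_sum.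
Qed.

End restriction.

Section ellipticity.
Context {R : realType} {n : nat}.
Local Notation space := 'rV[R]_n.
Local Notation mu := (@lebesgue_rV R n).

Lemma quadratic_continuous (M : 'M[R]_n) : continuous (fun xi : space => dotr (mxapp M xi) xi).
Proof.
have cc i : continuous (fun xi : space => xi ord0 i : R).
  by move=> x; exact: coord_continuous.
have csum (I : Type) (r : seq I) (F : I -> space -> R) :
    (forall i, continuous (F i)) -> continuous (fun x => \sum_(i <- r) F i x).
  move=> cF; elim: r => [|i r IH] x.
    by under eq_fun do rewrite big_nil; exact: cst_continuous.
  under eq_fun do rewrite big_cons.
  by apply: continuousD; [exact: cF|exact: IH].
apply: (csum _ _) => i x; apply: continuousM; last exact: cc.
rewrite (_ : (fun x0 : space => mxapp M x0 ord0 i) = (fun x0 => \sum_j x0 ord0 j * M i j)).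
  apply: csum => j y; apply: continuousM; first exact: cc.
  exact: cst_continuous.
by apply/funext => y; rewrite mxE; apply: eq_bigr => j _; rewrite mxE.
Qed.

(* The exceptional null set may be chosen independently of [xi], since it is
   enough to check the inequality at rational vectors. *)
Lemma elliptic_ae (A : space -> 'M[R]_n) (a : R) : (0 < n)%N ->
  (forall xi : space, {ae mu, forall x, a * enorm xi ^+ 2 <= dotr (mxapp (A x) xi) xi}) ->
  {ae mu, forall x, forall xi : space, a * enorm xi ^+ 2 <= dotr (mxapp (A x) xi) xi}.
Proof.
move=> n0 H.
have {}H : {ae mu, forall x, forall k : nat, if unpickle k is Some q then
    a * enorm (map_mx (@ratr R) (q : 'rV[rat]_n)) ^+ 2 <=
    dotr (mxapp (A x) (map_mx (@ratr R) q)) (map_mx (@ratr R) q) else true}.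
  by apply: ae_foralln => k; case: unpickle => [q|]; [exact: H|apply: aeW].
apply: filterS H => x Hx xi; rewrite leNgt; apply/negP => lt.
(* A vector violating the inequality lies in the open set where this quadratic form, that of A(x) -
   a I, is negative. That set then contains a rational vector, against [Hx]. *)
pose g (y : space) := dotr (mxapp (A x) y) y - a * dotr y y.
have gE : g = fun y : space => dotr (mxapp (A x - a%:M) y) y.
  apply/funext => y; rewrite /g /mxapp linearB/= tr_scalar_mx mulmxBr mul_mx_scalar.
  have -> : y *m (A x)^T - a *: y = (- a) *: y + y *m (A x)^T.
    by rewrite scaleNr addrC.
  by rewrite dotr_linl mulNr addrC.
have cg : continuous g by rewrite gE; exact: quadratic_continuous.
have og : open (g @^-1` [set t | t < 0]).
  by apply: open_comp; [move=> y _; exact: cg|exact: open_lt].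
have gxi : (g @^-1` [set t | t < 0]) xi by rewrite /= /g subr_lt0 -enorm_sqr.
have [r r0 rg] := open_cube_sub og gxi.
have [q [qxi qr]] := rat_cube_basis xi r0.
have : (g @^-1` [set t | t < 0]) (map_mx ratr q.1).
  apply: rg; apply: qr => i; rewrite subrr normr0.
  by have := qxi i => /(le_lt_trans (normr_ge0 _))/ltW.
rewrite /= /g subr_lt0 -enorm_sqr ltNge => /negP; apply.
by have := Hx (pickle q.1); rewrite pickleK.
Qed.

End ellipticity.

(** * The load: linearity and bound *)

Section forms.
Context {R : realType} {n : nat} (s : R) (U : set 'rV[R]_n).
Local Notation space := 'rV[R]_n.
Local Notation mu := (@lebesgue_rV R n).
Local Notation D := (riesz_gradient s).
Local Notation nrm p f := (fine 'N[mu]_p%:E[EFin \o f]).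
Implicit Types (u v f phi : space -> R) (w : space -> space).

Hypothesis n_gt0 : (0 < n)%N.
Hypothesis s01 : 0 < s <= 1.
Hypothesis s_lt : 2 * s < n%:R.
Hypothesis oU : open U.
Variable Cs : R.
Hypothesis sobolev : is_sobolev_constant s U Cs.

Let mU : measurable U.
Proof. exact: open_measurable_rV. Qed.

Let s0 : 0 < s. Proof. by have /andP[] := s01. Qed.

Let nR0 : 0 < n%:R :> R. Proof. by rewrite ltr0n. Qed.

Local Notation q := (sobolev_exponent n s).

Let q0 : 0 < q. Proof. by rewrite divr_gt0 ?mulr_gt0// subr_gt0. Qed.

Let ns0 : n%:R - 2 * s != 0. Proof. by rewrite gt_eqF// subr_gt0. Qed.

Lemma H0norm_enorm u : H0norm s u = nrm 2 (fun x => enorm (D u x)).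
Proof. by rewrite /H0norm /vLpnorm /Lpnorm patch_setT. Qed.

Lemma H0norm_ge0 u : 0 <= H0norm s u.
Proof. by rewrite H0norm_enorm Lnorm_fine_ge0. Qed.

Lemma H0_vL2 u : H0 s U u -> vL2 (D u).
Proof. by move/H0_hasL2/hasL2_vL2. Qed.

Lemma H0_coord_norm u i : H0 s U u -> nrm 2 (fun x => D u x ord0 i) <= H0norm s u.
Proof.
move=> Hu; have LD := H0_vL2 Hu; rewrite H0norm_enorm.
apply: (Lfun_le _ (Lfun_measurable (LD i)) _ (enorm_Lfun2 LD)).2 => // x.
by rewrite [leRHS]ger0_norm ?enorm_ge0//; exact: coord_le_enorm.
Qed.

Lemma H0_sobolev u : H0 s U u -> u \_ U \in Lfun mu q%:E /\
  nrm q (u \_ U) <= Cs * H0norm s u.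
Proof. by have [_] := sobolev; exact. Qed.

Lemma patch_lin (k : R) u v x : ((k *: u + v) \_ U) x = k * (u \_ U) x + (v \_ U) x.
Proof.
by rewrite !patch_indic !fctE /GRing.scale/=; ring.
Qed.

Lemma H0_grad_lin (k : R) u v : H0 s U u -> H0 s U v ->
  {ae mu, forall x, D (k *: u + v) x = k *: D u x + D v x}.
Proof. by move=> /H0_hasL2 hu /H0_hasL2 hv; exact: riesz_gradient_lin. Qed.

Section load.
Variables (f0 : space -> R) (f : space -> space).
Hypothesis f0_Lp : Lp (sobolev_dual_exponent n s)%:E U f0.
Hypothesis f_L2 : vLp 2%:E setT f.

Local Notation gd := (grad_domain s U).

Let mgd : measurable gd.
Proof. by rewrite /grad_domain; case: ifP. Qed.

Let fg := vrestrict gd f.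

Let LfgL2 : vL2 fg.
Proof.
move=> i; rewrite vrestrict_coord; have Lf := (vLpT f).1 f_L2 i.
apply: (Lfun_le _ _ _ Lf).1 => //.
  by apply/(measurable_restrictT _ _).1 => //; apply: measurable_funTS; exact: Lfun_measurable Lf.
by move=> x; rewrite /patch; case: ifP => // _; rewrite normr0.
Qed.

Let q'0 : 0 < sobolev_dual_exponent n s.
Proof. by rewrite divr_gt0 ?mulr_gt0// addr_gt0// mulr_gt0. Qed.

Let qq' : (sobolev_dual_exponent n s)^-1 + q^-1 = 1.
Proof.
rewrite /sobolev_dual_exponent /sobolev_exponent; field.
by rewrite ns0 !gt_eqF// addr_gt0// mulr_gt0.
Qed.

Lemma load_integrable v : H0 s U v ->
  mu.-integrable setT (EFin \o (fun x => (f0 \_ U) x * (v \_ U) x)).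
Proof.
by move=> Hv; have [Lv _] := H0_sobolev Hv; have [] := Lfun_mul_integrable q'0 q0 qq' f0_Lp Lv.
Qed.

Lemma load_grad_integrable v : H0 s U v ->
  mu.-integrable setT (EFin \o (fun x => dotr (vrestrict gd f x) (D v x))).
Proof. by move=> Hv; apply: integrable_dotr => //; exact: H0_vL2. Qed.

(** With the data extended by zero all integrals run over the whole space, where the Hoelder and
    linearity lemmas are stated. *)
Lemma loadE v : load s U f0 f v =
  \int[mu]_x ((f0 \_ U) x * (v \_ U) x) + \int[mu]_x dotr (vrestrict gd f x) (D v x).
Proof.
rewrite /load Rintegral_mkcond [X in _ + X]Rintegral_mkcond; congr (_ + _).
  apply: eq_Rintegral => x _; rewrite !patch_indic !indicE.
  by case: (x \in U); rewrite ?mul1r ?mul0r.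
apply: eq_Rintegral => x _; rewrite patch_indic /vrestrict indicE.
case: (x \in gd); first by rewrite mul1r scale1r.
by rewrite mul0r scale0r /dotr big1// => i _; rewrite mxE mul0r.
Qed.

Lemma load_lin (k : R) u v : H0 s U u -> H0 s U v ->
  load s U f0 f (k *: u + v) = k * load s U f0 f u + load s U f0 f v.
Proof.
move=> Hu Hv; rewrite !loadE.
have e1 : \int[mu]_x ((f0 \_ U) x * ((k *: u + v) \_ U) x) =
    k * \int[mu]_x ((f0 \_ U) x * (u \_ U) x) + \int[mu]_x ((f0 \_ U) x * (v \_ U) x).
  rewrite -(Rintegral_lin k (load_integrable Hu) (load_integrable Hv)); apply: eq_Rintegral => x _.
  by rewrite patch_lin; ring.
have e2 : \int[mu]_x dotr (fg x) (D (k *: u + v) x) =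
    k * \int[mu]_x dotr (fg x) (D u x) + \int[mu]_x dotr (fg x) (D v x).
  rewrite -(Rintegral_lin k (load_grad_integrable Hu) (load_grad_integrable Hv)).
  have mf := vL2_measurable LfgL2.
  have mDu := vL2_measurable (H0_vL2 Hu); have mDv := vL2_measurable (H0_vL2 Hv).
  have mDuv := vL2_measurable (H0_vL2 (H0_lin k Hu Hv)).
  apply: ae_eq_Rintegral.
  - exact: (measurable_dotr mf mDuv).
  - apply: measurable_funD; last exact: (measurable_dotr mf mDv).
    by apply: measurable_funM; [exact: measurable_cst|exact: (measurable_dotr mf mDu)].
  - by apply: filterS (H0_grad_lin k Hu Hv) => x ->; rewrite dotr_linr.
by rewrite mulrDr [RHS]addrACA; exact: congr2 e1 e2.
Qed.

(** Hoelder with the conjugate exponents 2^# and 2^*, followed by the Sobolev inequality, and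
    Cauchy-Schwarz for the vector part. The factors [Cs] and 1 become those of the stability
    estimate. *)
Lemma load_bound v : H0 s U v -> `|load s U f0 f v| <=
  (Cs * Lpnorm (sobolev_dual_exponent n s)%:E U f0 + vLpnorm 2%:E gd f) * H0norm s v.
Proof.
move=> Hv; have [Lv leq] := H0_sobolev Hv; rewrite loadE mulrDl.
apply: (le_trans (ler_normD _ _)); apply: lerD.
  have [int le] := Lfun_mul_integrable q'0 q0 qq' f0_Lp Lv.
  apply: le_trans (le_normr_Rintegral measurableT int) _; apply: (le_trans le).
  rewrite mulrAC [leRHS]mulrC; apply: ler_wpM2l => //; exact: Lnorm_fine_ge0.
have LD := H0_vL2 Hv.
have -> : vLpnorm 2%:E gd f = nrm 2 (fun x => enorm (fg x)).
  by rewrite /vLpnorm /Lpnorm -enorm_vrestrict.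
rewrite H0norm_enorm.
have h2 : 2^-1 + 2^-1 = 1 :> R by rewrite [RHS]splitr !div1r.
have [int le] := Lfun_mul_integrable (ltr0Sn R 1) (ltr0Sn R 1) h2 (enorm_Lfun2 LfgL2) (enorm_Lfun2 LD).
apply: le_trans le.
apply: (integrable_dominated _ _ int).2.
  exact: (measurable_dotr (vL2_measurable LfgL2) (vL2_measurable LD)).
move=> x; rewrite [leRHS]ger0_norm; first exact: dotr_CS.
by apply: mulr_ge0; exact: enorm_ge0.
Qed.

End load.

Lemma load_sub f0 (f : space -> space) f0' (f' : space -> space) v :
  Lp (sobolev_dual_exponent n s)%:E U f0 -> vLp 2%:E setT f ->
  Lp (sobolev_dual_exponent n s)%:E U f0' -> vLp 2%:E setT f' -> H0 s U v ->
  load s U (f0 \- f0') (fun x => f x - f' x) v = load s U f0 f v - load s U f0' f' v.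
Proof.
move=> Lf0 Lf Lf0' Lf' Hv; rewrite !loadE.
have e1 : \int[mu]_x (((f0 \- f0') \_ U) x * (v \_ U) x) =
    -1 * \int[mu]_x ((f0' \_ U) x * (v \_ U) x) + \int[mu]_x ((f0 \_ U) x * (v \_ U) x).
  rewrite -(Rintegral_lin (-1) (load_integrable Lf0' Hv) (load_integrable Lf0 Hv)).
  by apply: eq_Rintegral => x _; rewrite !patch_indic /=; ring.
have e2 : \int[mu]_x dotr (vrestrict (grad_domain s U) (fun x => f x - f' x) x) (D v x) =
    -1 * \int[mu]_x dotr (vrestrict (grad_domain s U) f' x) (D v x) +
    \int[mu]_x dotr (vrestrict (grad_domain s U) f x) (D v x).
  rewrite -(Rintegral_lin (-1) (load_grad_integrable Lf' Hv) (load_grad_integrable Lf Hv)).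
  apply: eq_Rintegral => x _; rewrite -dotr_linl /vrestrict.
  by rewrite scaleN1r scalerBr addrC.
rewrite e1 e2 !mulN1r opprD [LHS]addrACA addrC; exact: erefl.
Qed.

End forms.

Lemma le_mul3_mid (R : realDomainType) (x y z C N : R) :
  x <= C * N -> 0 <= y -> 0 <= z -> x * y * z <= C * y * N * z.
Proof. by move=> le y0 z0; rewrite (mulrAC C); apply: ler_wpM2r => //; apply: ler_wpM2r. Qed.

Lemma le_mul3_last (R : realDomainType) (x y z C X Y : R) :
  0 <= x -> 0 <= y -> 0 <= z -> y <= C * X -> z <= C * Y ->
  x * y * z <= x * C * C * X * Y.
Proof.
move=> x0 y0 z0 yX zY.
have -> : x * C * C * X * Y = x * (C * X) * (C * Y) by ring.
by apply: ler_pM => //; [exact: mulr_ge0|exact: ler_wpM2l].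
Qed.

(** The integrand of the form at a point, in its first argument: [a], [a'] stand for the principal
    parts, [x], [y] for the values of the two functions combined, [e], [e'] for the products of [b]
    with their gradients, [z] for the value of the other argument and [d] for the product of [dd]
    with its gradient. *)
Lemma form_linl_identity (R : comRingType) (k a a' x y d e e' z c : R) :
  k * a + a' + (k * x + y) * d + ((k * e + e') * z + c * (k * x + y) * z) =
  k * (a + x * d + (e * z + c * x * z)) + (a' + y * d + (e' * z + c * y * z)).
Proof. by ring. Qed.

Lemma form_linr_identity (R : comRingType) (k a a' x d d' e y z c : R) :
  k * a + a' + x * (k * d + d') + (e * (k * y + z) + c * x * (k * y + z)) =
  k * (a + x * d + (e * y + c * x * y)) + (a' + x * d' + (e * z + c * x * z)).
Proof. by ring. Qed.

(** * The bilinear form: boundedness, bilinearity, coercivity *)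

Section bilinear.
Context {R : realType} {n : nat} (s : R) (U : set 'rV[R]_n).
Local Notation space := 'rV[R]_n.
Local Notation mu := (@lebesgue_rV R n).
Local Notation D := (riesz_gradient s).
Local Notation nrm p f := (fine 'N[mu]_p%:E[EFin \o f]).
Implicit Types (u v f phi : space -> R) (w : space -> space).

Hypothesis n_gt0 : (0 < n)%N.
Hypothesis s01 : 0 < s <= 1.
Hypothesis s_lt : 2 * s < n%:R.
Hypothesis oU : open U.
Variable Cs : R.
Hypothesis sobolev : is_sobolev_constant s U Cs.

Variables (A : space -> 'M[R]_n) (b dd : space -> space) (c : space -> R).
Hypothesis A_bounded : forall i j, Lp +oo%E setT (fun x => A x i j).
Hypothesis b_Lp : vLp (n%:R / s)%:E U b.
Hypothesis dd_Lp : vLp (n%:R / s)%:E U dd.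
Hypothesis c_Lp : Lp (n%:R / (2 * s))%:E U c.

Let mU : measurable U.
Proof. exact: open_measurable_rV. Qed.

Let s0 : 0 < s. Proof. by have /andP[] := s01. Qed.

Let nR0 : 0 < n%:R :> R. Proof. by rewrite ltr0n. Qed.

Local Notation q := (sobolev_exponent n s).
Local Notation p := (n%:R / s).
Local Notation r := (n%:R / (2 * s)).

Let q0 : 0 < q. Proof. by rewrite divr_gt0 ?mulr_gt0// subr_gt0. Qed.

Let p0 : 0 < p. Proof. by rewrite divr_gt0. Qed.

Let r0 : 0 < r. Proof. by rewrite divr_gt0// mulr_gt0. Qed.

Let p1 : 1 <= p.
Proof.
rewrite ler_pdivlMr// mul1r; apply: ltW; apply: le_lt_trans s_lt.
by rewrite mulr_natl mulr2n lerDl ltW.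
Qed.

Let ns0 : n%:R - 2 * s != 0. Proof. by rewrite gt_eqF// subr_gt0. Qed.

Let qp2 : q^-1 + p^-1 + 2^-1 = 1.
Proof. by rewrite /sobolev_exponent; field; rewrite ns0 !gt_eqF. Qed.

Let rqq : r^-1 + q^-1 + q^-1 = 1.
Proof. by rewrite /sobolev_exponent; field; rewrite ns0 !gt_eqF. Qed.

Local Notation H0U := (H0 s U).
Local Notation N u := (H0norm s u).

Let N0 u : 0 <= N u. Proof. exact: H0norm_ge0. Qed.

(** Integrability is bundled with the bound because the integral of a sum is split only for
    integrable terms. *)
Definition bounded_form (I : (space -> R) -> (space -> R) -> space -> R) :=
  exists2 M, 0 <= M & forall u v, H0U u -> H0U v ->
    mu.-integrable setT (EFin \o I u v) /\ `|\int[mu]_x I u v x| <= M * N u * N v.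

Lemma bounded_formD I J : bounded_form I -> bounded_form J ->
  bounded_form (fun u v x => I u v x + J u v x).
Proof.
move=> [M M0 HI] [M' M'0 HJ]; exists (M + M'); first exact: addr_ge0.
move=> u v Hu Hv; have [iI bI] := HI u v Hu Hv; have [iJ bJ] := HJ u v Hu Hv.
split.
  have := integrable_lin 1 iI iJ.
  by rewrite (_ : (fun x => _) = (fun x => I u v x + J u v x))//;
    apply/funext => x; rewrite mul1r.
rewrite RintegralD//; apply: (le_trans (ler_normD _ _)).
by rewrite !mulrDl; exact: lerD.
Qed.

Lemma vrestrict_Lfun F : vLp p%:E U F ->
  (fun x => enorm (vrestrict U F x)) \in Lfun mu p%:E /\ vmeasurable (vrestrict U F).
Proof.
move=> LF; have LF' i : (fun x => vrestrict U F x ord0 i) \in Lfun mu p%:E.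
  by rewrite vrestrict_coord; exact: LF.
by split; [exact: enorm_Lfun|move=> i; exact: Lfun_measurable (LF' i)].
Qed.

Definition form1 u v x : R := dotr (mxapp (A x) (D u x)) (D v x).
Definition form2 u v x : R := (u \_ U) x * dotr (vrestrict U dd x) (D v x).
Definition form3 u v x : R := dotr (vrestrict U b x) (D u x) * (v \_ U) x.
Definition form4 u v x : R := (c \_ U) x * (u \_ U) x * (v \_ U) x.

(** The product is expanded over the entries of [A], each essentially bounded and multiplied by two
    L^2 coordinates; the constant is the sum of the essential bounds. *)
Lemma form1_bounded : bounded_form form1.
Proof.
have /boolp.choice[M HM] : forall ij : 'I_n * 'I_n, exists M : R,
    0 <= M /\ {ae mu, forall x, `|A x ij.1 ij.2| <= M}.
  move=> [i j]; have [M M0 HM] := Linfty_bounded ((LpT _ _).1 (A_bounded i j)).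
  by exists M.
exists (\sum_ij M ij); first by apply: sumr_ge0 => ij _; have [] := HM ij.
move=> u v Hu Hv; have LDu := H0_vL2 Hu; have LDv := H0_vL2 Hv.
pose t (ij : 'I_n * 'I_n) x := A x ij.1 ij.2 * D u x ord0 ij.2 * D v x ord0 ij.1.
have form1E x : form1 u v x = \sum_ij t ij x.
  rewrite /form1 /dotr; transitivity (\sum_i \sum_j t (i, j) x).
    apply: eq_bigr => i _; rewrite /mxapp mxE mulr_suml; apply: eq_bigr => j _.
    by rewrite /t mxE /= [D u x ord0 j * _]mulrC.
  by rewrite pair_big; apply: eq_bigr => -[i j].
have tP ij : mu.-integrable setT (EFin \o t ij) /\
    `|\int[mu]_x t ij x| <= M ij * N u * N v.
  have [M0 AM] := HM ij.
  have [L le] := Linfty_mul ((LpT _ _).1 (A_bounded ij.1 ij.2)) M0 AM (LDu ij.2).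
  have h2 : 2^-1 + 2^-1 = 1 :> R by rewrite [RHS]splitr !div1r.
  have [int le2] := Lfun_mul_integrable (ltr0Sn R 1) (ltr0Sn R 1) h2 L (LDv ij.1).
  split; first exact: int.
  apply: le_trans (le_normr_Rintegral measurableT int) _.
  apply: (le_trans le2); apply: ler_pM; [exact: Lnorm_fine_ge0|exact: Lnorm_fine_ge0| |].
    exact: (le_trans le (ler_wpM2l M0 (H0_coord_norm ij.2 Hu))).
  exact: (H0_coord_norm ij.1 Hv).
have ti ij := (tP ij).1.
have e : form1 u v = fun x => \sum_ij t ij x by apply/funext => x; exact: form1E.
rewrite e; split; first exact: integrable_Rsum.
rewrite (Rintegral_sum _ ti) (le_trans (ler_norm_sum _ _ _))// !mulr_suml.
by apply: ler_sum => ij _; have [] := tP ij.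
Qed.

Lemma form2_bounded : bounded_form form2.
Proof.
have [Ld md] := vrestrict_Lfun dd_Lp; have [Cs0 _] := sobolev.
exists (Cs * nrm p (fun x => enorm (vrestrict U dd x))).
  by rewrite mulr_ge0 ?Lnorm_fine_ge0.
move=> u v Hu Hv; have [Lu leu] := H0_sobolev sobolev Hu; have LDv := H0_vL2 Hv.
have [int le] := Lfun_mul3 q0 p0 (ltr0Sn R 1) qp2 Lu Ld (enorm_Lfun2 LDv).
have [||i1 le1] := integrable_dominated _ _ int (f := form2 u v).
- apply: measurable_funM; first exact: Lfun_measurable Lu.
  exact: (measurable_dotr md (vL2_measurable LDv)).
- move=> x; rewrite /form2 -mulrA !normrM; apply: ler_wpM2l => //.
  by rewrite -normrM [leRHS]ger0_norm ?mulr_ge0 ?enorm_ge0//; exact: dotr_CS.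
split; first exact: i1.
apply: (le_trans le1); apply: (le_trans le).
rewrite (H0norm_enorm _ v).
exact: (le_mul3_mid leu (Lnorm_fine_ge0 _ _ _) (Lnorm_fine_ge0 _ _ _)).
Qed.

Lemma form3_bounded : bounded_form form3.
Proof.
have [Lb mb] := vrestrict_Lfun b_Lp; have [Cs0 _] := sobolev.
exists (Cs * nrm p (fun x => enorm (vrestrict U b x))).
  by rewrite mulr_ge0 ?Lnorm_fine_ge0.
move=> u v Hu Hv; have [Lv lev] := H0_sobolev sobolev Hv; have LDu := H0_vL2 Hu.
have [int le] := Lfun_mul3 q0 p0 (ltr0Sn R 1) qp2 Lv Lb (enorm_Lfun2 LDu).
have [||i1 le1] := integrable_dominated _ _ int (f := form3 u v).
- apply: measurable_funM; last exact: Lfun_measurable Lv.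
  exact: (measurable_dotr mb (vL2_measurable LDu)).
- move=> x; rewrite /form3 mulrC -mulrA !normrM; apply: ler_wpM2l => //.
  by rewrite -normrM [leRHS]ger0_norm ?mulr_ge0 ?enorm_ge0//; exact: dotr_CS.
split; first exact: i1.
apply: (le_trans le1); apply: (le_trans le).
rewrite (H0norm_enorm _ u) [leRHS]mulrAC.
exact: (le_mul3_mid lev (Lnorm_fine_ge0 _ _ _) (Lnorm_fine_ge0 _ _ _)).
Qed.

Lemma form4_bounded : bounded_form form4.
Proof.
have [Cs0 _] := sobolev.
exists (nrm r (c \_ U) * Cs * Cs); first by rewrite !mulr_ge0 ?Lnorm_fine_ge0.
move=> u v Hu Hv; have [Lu leu] := H0_sobolev sobolev Hu.
have [Lv lev] := H0_sobolev sobolev Hv.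
have [int le] := Lfun_mul3 r0 q0 q0 rqq c_Lp Lu Lv.
split; first exact: int.
apply: le_trans (le_normr_Rintegral measurableT int) _; apply: (le_trans le).
exact: (le_mul3_last (Lnorm_fine_ge0 _ _ _) (Lnorm_fine_ge0 _ _ _) (Lnorm_fine_ge0 _ _ _) leu lev).
Qed.

Definition form u v x : R := form1 u v x + form2 u v x + (form3 u v x + form4 u v x).

Lemma form_bounded : bounded_form form.
Proof.
apply: bounded_formD.
- exact: (bounded_formD form1_bounded form2_bounded).
- exact: (bounded_formD form3_bounded form4_bounded).
Qed.

Lemma H0_grad_domain u : H0U u -> {ae mu, forall x, ~ grad_domain s U x -> D u x = 0}.
Proof.
move=> Hu; rewrite /grad_domain; case: eqP => s1; last by apply: aeW => x [].
exact: H0_gradient_eq0_off.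
Qed.

Let mgd : measurable (grad_domain s U).
Proof. by rewrite /grad_domain; case: ifP. Qed.

Lemma dotr0 (x : space) : dotr 0 x = 0.
Proof. by rewrite /dotr big1// => i _; rewrite mxE mul0r. Qed.

(** Lower order terms are extended by zero, and for s = 1 the principal part extends to the whole
    space because [D v] vanishes almost everywhere outside [U]. Bilinearity and coercivity become
    statements about a single integrand. *)
Lemma bilinear_formE u v : H0U u -> H0U v ->
  bilinear_form s U A b dd c u v = \int[mu]_x form u v x.
Proof.
move=> Hu Hv.
have [M1 _ /(_ u v Hu Hv)[i1 _]] := form1_bounded.
have [M2 _ /(_ u v Hu Hv)[i2 _]] := form2_bounded.
have [M3 _ /(_ u v Hu Hv)[i3 _]] := form3_bounded.
have [M4 _ /(_ u v Hu Hv)[i4 _]] := form4_bounded.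
have [M12 _ /(_ u v Hu Hv)[i12 _]] := bounded_formD form1_bounded form2_bounded.
have [M34 _ /(_ u v Hu Hv)[i34 _]] := bounded_formD form3_bounded form4_bounded.
rewrite [RHS](RintegralD measurableT i12 i34) (RintegralD measurableT i1 i2).
rewrite /bilinear_form; congr (_ + _ + _).
- rewrite Rintegral_mkcond.
  have m1 : measurable_fun setT (form1 u v) by apply/measurable_EFinP; exact: measurable_int i1.
  apply: ae_eq_Rintegral => //.
    by apply/(measurable_restrictT _ _).1 => //; exact: measurable_funTS.
  apply: filterS (H0_grad_domain Hv) => x hx; rewrite /patch; case: ifPn => //.
  rewrite notin_setE => /hx; rewrite /form1 => ->.
  by rewrite dotrC dotr0.
- rewrite Rintegral_mkcond; apply: eq_Rintegral => x _.
  rewrite /form2 !patch_indic /vrestrict indicE; case: (x \in U).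
    by rewrite !mul1r scale1r.
  by rewrite !mul0r.
- rewrite Rintegral_mkcond; apply: eq_Rintegral => x _.
  rewrite /form3 /form4 !patch_indic /vrestrict indicE; case: (x \in U).
    by rewrite !mul1r scale1r mulrDl.
  by rewrite !mul0r scale0r dotr0 mul0r addr0.
Qed.

Lemma form_integrable u v : H0U u -> H0U v -> mu.-integrable setT (EFin \o form u v).
Proof. by move=> Hu Hv; have [M _ /(_ u v Hu Hv)[]] := form_bounded. Qed.

Lemma form_measurable u v : H0U u -> H0U v -> measurable_fun setT (form u v).
Proof. by move=> Hu Hv; apply/measurable_EFinP; exact: measurable_int (form_integrable Hu Hv). Qed.

Lemma mxapp_lin (M : 'M[R]_n) (k : R) (x y : space) :
  mxapp M (k *: x + y) = k *: mxapp M x + mxapp M y.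
Proof. by rewrite /mxapp mulmxDl scalemxAl. Qed.

Lemma bilinear_form_linl (k : R) u v (w : space -> R) : H0U u -> H0U v -> H0U w ->
  bilinear_form s U A b dd c (k *: u + v) w =
  k * bilinear_form s U A b dd c u w + bilinear_form s U A b dd c v w.
Proof.
move=> Hu Hv Hw; have Huv := H0_lin k Hu Hv.
rewrite (bilinear_formE Huv Hw) (bilinear_formE Hu Hw) (bilinear_formE Hv Hw).
rewrite -(Rintegral_lin k (form_integrable Hu Hw) (form_integrable Hv Hw)).
apply: ae_eq_Rintegral; first exact: form_measurable.
  apply: measurable_funD; last exact: form_measurable.
  by apply: measurable_funM; [exact: measurable_cst|exact: form_measurable].
apply: filterS (H0_grad_lin k Hu Hv) => x e.
rewrite /form /form1 /form2 /form3 /form4 e mxapp_lin !dotr_linl !dotr_linr !patch_lin.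
exact: form_linl_identity.
Qed.

Lemma bilinear_form_linr (k : R) u v (w : space -> R) : H0U u -> H0U v -> H0U w ->
  bilinear_form s U A b dd c w (k *: u + v) =
  k * bilinear_form s U A b dd c w u + bilinear_form s U A b dd c w v.
Proof.
move=> Hu Hv Hw; have Huv := H0_lin k Hu Hv.
rewrite (bilinear_formE Hw Huv) (bilinear_formE Hw Hu) (bilinear_formE Hw Hv).
rewrite -(Rintegral_lin k (form_integrable Hw Hu) (form_integrable Hw Hv)).
apply: ae_eq_Rintegral; first exact: form_measurable.
  apply: measurable_funD; last exact: form_measurable.
  by apply: measurable_funM; [exact: measurable_cst|exact: form_measurable].
apply: filterS (H0_grad_lin k Hu Hv) => x e.
rewrite /form /form1 /form2 /form3 /form4 e !dotr_linr !patch_lin.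
exact: form_linr_identity.
Qed.

Lemma bilinear_form_bounded : exists2 M, 0 < M & forall u v, H0U u -> H0U v ->
  `|bilinear_form s U A b dd c u v| <= M * N u * N v.
Proof.
(* The bound is enlarged because the contraction argument divides by quantities that need [M]
   positive. *)
have [M M0 HM] := form_bounded; exists (M + 1); first by rewrite ltr_wpDl.
move=> u v Hu Hv; rewrite bilinear_formE//; have [_ le] := HM u v Hu Hv.
have M1 : M <= M + 1 by rewrite lerDl.
exact: (le_trans le (ler_wpM2r (N0 v) (ler_wpM2r (N0 u) M1))).
Qed.

Section coercivity.
Variables (a : R).
Hypothesis a_gt0 : 0 < a.
Hypothesis A_elliptic : forall xi : space,
  {ae mu, forall x, a * enorm xi ^+ 2 <= dotr (mxapp (A x) xi) xi}.

Let Nbd := vLpnorm p%:E U (fun x => b x + dd x).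
Let Nc := Lpnorm r%:E U (fun x => Num.max 0 (- c x)).

(** One nonnegative function is integrated: the integrand minus [a * g1], plus the absolute lower
    order terms [g5] and [g6]. The integrals of the last two are bounded by Hoelder and Sobolev by
    the amount that [delta] subtracts from [a]. *)
Lemma bilinear_form_coercive v : H0U v ->
  (a - Cs * (Nbd + Cs * Nc)) * gip s v v <= bilinear_form s U A b dd c v v.
Proof.
move=> Hv; have [Cs0 _] := sobolev.
have [Lv lev] := H0_sobolev sobolev Hv; have LDv := H0_vL2 Hv.
pose bd := vrestrict U (fun x => b x + dd x).
have bdE x : bd x = vrestrict U b x + vrestrict U dd x by rewrite /bd /vrestrict scalerDr.
have Lbd : vLp p%:E U (fun x => b x + dd x).
  move=> i; have e : (fun x => (b x + dd x) ord0 i) \_ U =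
      (fun x => ((fun x => b x ord0 i) \_ U) x + ((fun x => dd x ord0 i) \_ U) x).
    by apply/funext => x; rewrite !patch_indic mxE mulrDr.
  by rewrite /Lp e; exact: (Lfun_addr p1 (b_Lp i) (dd_Lp i)).
have [Lebd mbd] := vrestrict_Lfun Lbd.
have NbdE : Nbd = nrm p (fun x => enorm (bd x)).
  by rewrite /Nbd /vLpnorm /Lpnorm /bd enorm_vrestrict.
pose cm := (fun x => Num.max 0 (- c x)) \_ U.
have mc : measurable_fun setT (c \_ U) := Lfun_measurable c_Lp.
have cmE x : cm x = Num.max 0 (- (c \_ U) x).
  rewrite /cm !patch_indic indicE; case: (x \in U); first by rewrite !mul1r.
  by rewrite !mul0r oppr0 maxxx.
have cm0 x : 0 <= cm x by rewrite cmE le_max lexx.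
have mcm : measurable_fun setT cm.
  rewrite (_ : cm = fun x => Num.max 0 (- (c \_ U) x)); last exact/funext.
  by apply: measurable_maxr => //; exact: measurableT_comp.
have Lcm : cm \in Lfun mu r%:E.
  apply: (Lfun_le r0 mcm _ c_Lp).1 => x; rewrite ger0_norm// cmE ge_max normr_ge0/=.
  by rewrite -normrN; exact: ler_norm.
have [i5 le5] := Lfun_mul3 q0 p0 (ltr0Sn R 1) qp2 Lv Lebd (enorm_Lfun2 LDv).
have [i6 le6] := Lfun_mul3 r0 q0 q0 rqq Lcm Lv Lv.
pose V := v \_ U.
pose g1 x := dotr (D v x) (D v x).
pose g5 x := `|V x * enorm (bd x) * enorm (D v x)|.
pose g6 x := `|cm x * V x * V x|.
have j1 : mu.-integrable setT (EFin \o g1) := integrable_dotr LDv LDv.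
have j5 : mu.-integrable setT (EFin \o g5) := integrable_abse i5.
have j6 : mu.-integrable setT (EFin \o g6) := integrable_abse i6.
have j56 := integrable_lin 1 j5 j6.
have jr := integrable_lin (- a) j1 j56.
have jf := form_integrable Hv Hv.
have jt := integrable_lin 1 jf jr.
(* Ellipticity is used at the vector [D v x], which varies with [x]; this is why a null set common
   to all vectors is needed. *)
have pos : 0 <= \int[mu]_x (1 * form v v x + (- a * g1 x + (1 * g5 x + g6 x))).
  apply: Rintegral_ge0_ae; first by apply/measurable_EFinP; exact: measurable_int jt.
  apply: filterS (elliptic_ae n_gt0 A_elliptic) => x ell.
  have h1 : a * g1 x <= form1 v v x by have := ell (D v x); rewrite enorm_sqr.
  (* On the diagonal the two first order terms merge, so that only the sum [b + dd] enters the
     constant. *)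
  have h5 : - g5 x <= form2 v v x + form3 v v x.
    have -> : form2 v v x + form3 v v x = V x * dotr (bd x) (D v x).
      rewrite bdE -(scale1r (vrestrict U b x)) dotr_linl /form2 /form3 -/V; ring.
    have : `|V x * dotr (bd x) (D v x)| <= g5 x.
      rewrite /g5 -mulrA !normrM; apply: ler_wpM2l => //.
      by rewrite -normrM [leRHS]ger0_norm ?mulr_ge0 ?enorm_ge0//; exact: dotr_CS.
    by rewrite ler_norml => /andP[].
  (* The square of [v] is nonnegative, so only the negative part of [c] can lower the form. *)
  have h6 : - g6 x <= form4 v v x.
    rewrite /form4 /g6 -/V -!mulrA normrM (ger0_norm (cm0 x)).
    rewrite (ger0_norm (_ : 0 <= V x * V x)); last by rewrite -expr2 sqr_ge0.
    rewrite -mulNr; apply: ler_wpM2r; first by rewrite -expr2 sqr_ge0.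
    by rewrite cmE lerNl le_max lexx orbT.
  rewrite /form; lra.
rewrite (Rintegral_lin 1 jf jr) (Rintegral_lin (- a) j1 j56) (Rintegral_lin 1 j5 j6) in pos.
rewrite (bilinear_formE Hv Hv).
have N2 : N v ^+ 2 = gip s v v by rewrite H0norm_sqrt sqr_sqrtr// gip_ge0.
have b5 : \int[mu]_x g5 x <= Cs * Nbd * gip s v v.
  apply: (le_trans le5); rewrite -N2 NbdE -H0norm_enorm.
  rewrite expr2 mulrA.
  exact: (le_mul3_mid lev (Lnorm_fine_ge0 _ _ _) (N0 v)).
have b6 : \int[mu]_x g6 x <= Cs * Cs * Nc * gip s v v.
  apply: (le_trans le6); rewrite -N2 (mulrC _ Nc) expr2 !mulrA.
  exact: (le_mul3_last (Lnorm_fine_ge0 _ _ _) (Lnorm_fine_ge0 _ _ _) (Lnorm_fine_ge0 _ _ _) lev lev).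
rewrite -/(gip s v v) in pos.
move: pos b5 b6; set x1 := \int[mu]_x form v v x; set x5 := \int[mu]_x g5 x.
set x6 := \int[mu]_x g6 x; set y := gip s v v; set z := Nbd; set z' := Nc.
move=> pos b5 b6; rewrite (_ : _ * y = a * y - Cs * z * y - Cs * Cs * z' * y); last by ring.
lra.
Qed.

End coercivity.
End bilinear.

(** * The variational inequality *)

Lemma enorm_limit (R : realType) (n : nat) (w_ : nat -> 'rV[R]_n) (w : 'rV[R]_n) (r : R) :
  (forall i, (fun m => w_ m ord0 i) @ \oo --> w ord0 i) ->
  (forall m, enorm (w_ m) <= r) -> enorm w <= r.
Proof.
move=> ww le; have r0 : 0 <= r := le_trans (enorm_ge0 (w_ 0)) (le 0).
have csum (I : Type) (l : seq I) (F : I -> nat -> R) (G : I -> R) :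
    (forall i, F i @ \oo --> G i) ->
    (fun m => \sum_(i <- l) F i m) @ \oo --> \sum_(i <- l) G i.
  move=> FG; elim: l => [|i l IH].
    by rewrite big_nil; under eq_fun do rewrite big_nil; exact: cvg_cst.
  by rewrite big_cons; under eq_fun do rewrite big_cons; exact: cvgD.
have cd : (fun m => dotr (w_ m) (w_ m)) @ \oo --> dotr w w.
  by apply: csum => i; exact: cvgM.
rewrite -ler_sqr ?nnegrE ?enorm_ge0// enorm_sqr; apply: (cvgr_to_le cd).
by apply: nearW => m; rewrite -enorm_sqr ler_sqr ?nnegrE ?enorm_ge0.
Qed.

(** The argument has the shape produced by two uses of [H0_grad_lin] on [t *: (v - u) + u]. *)
Lemma enorm_convex (R : realType) (n : nat) (t r : R) (x y : 'rV[R]_n) :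
  0 <= t -> t <= 1 -> enorm x <= r -> enorm y <= r ->
  enorm (t *: (-1 *: x + y) + x) <= r.
Proof.
move=> t0 t1 xr yr.
have -> : t *: (-1 *: x + y) + x = (1 - t) *: x + t *: y.
  by rewrite scaleN1r scalerDr scalerN scalerBl scale1r addrC addrA.
have t1' : 0 <= 1 - t by rewrite subr_ge0.
apply: (le_trans (enormD _ _)); rewrite !enormZ !ger0_norm//.
have -> : r = (1 - t) * r + t * r by ring.
by apply: lerD; apply: ler_wpM2l.
Qed.

(** Here [x], [y] are the first load at u', u and [z], [t] the second load at u, u'; [a], [b] are
    the form at (u, u'), (u, u) and [c], [d] at (u', u), (u', u'). The conclusion compares the form
    at (u - u', u - u') with the difference of the loads at u - u'. *)
Lemma add_test_inequalities (R : realDomainType) (a b c d x y z t : R) :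
  x - y <= a - b -> z - t <= c - d -> b - a - (c - d) <= y - x - (z - t).
Proof. by move=> *; lra. Qed.

(** One factor [N] is cancelled, so [N = 0] is treated apart; then the nonnegativity of the
    right-hand side suffices. *)
Lemma quotient_bound (R : realFieldType) (delta C P Q N : R) : 0 < delta ->
  0 <= C -> 0 <= P -> 0 <= Q -> 0 <= N -> delta * N ^+ 2 <= (C * P + Q) * N ->
  N <= C / delta * P + 1 / delta * Q.
Proof.
move=> d0 C0 P0 Q0; rewrite le_eqVlt => /predU1P[<- _|N0].
  by rewrite addr_ge0// mulr_ge0// divr_ge0// ltW.
rewrite expr2 mulrA ler_pM2r// => le.
have -> : C / delta * P + 1 / delta * Q = (C * P + Q) / delta by field; rewrite gt_eqF.
by rewrite ler_pdivlMr// mulrC.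
Qed.

Section assembly.
Context {R : realType} {n : nat} (s : R) (U : set 'rV[R]_n).
Local Notation space := 'rV[R]_n.
Local Notation mu := (@lebesgue_rV R n).
Local Notation D := (riesz_gradient s).
Implicit Types (u v : space -> R).

Hypothesis n_gt0 : (0 < n)%N.
Hypothesis s01 : 0 < s <= 1.
Hypothesis s_lt : 2 * s < n%:R.
Hypothesis oU : open U.
Hypothesis bU : bounded_set U.
Variable Cs : R.
Hypothesis sobolev : is_sobolev_constant s U Cs.

Section constraint.
Variable g : space -> R.
Local Notation K := (gradient_constraint s U g).

Lemma gradient_constraint_convex (t : R) u v : K u -> K v -> 0 <= t <= 1 ->
  K (t *: (v - u) + u).
Proof.
move=> [Hu gu] [Hv gv] /andP[t0 t1].
have Hvu := H0_sub Hv Hu; split; first exact: H0_lin.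
have evu := H0_grad_lin (-1) Hu Hv; rewrite scaleN1r [- u + v]addrC in evu.
apply: filterS2 (filterI gu gv) (filterI evu (H0_grad_lin t Hvu Hu)).
move=> x [ux vx] [-> ->].
exact: (enorm_convex t0 t1 ux vx).
Qed.

Lemma gradient_constraint0 : {ae mu, forall x, 0 <= g x} -> K 0.
Proof.
move=> g0; have H := H0_0 U n_gt0 s01; split; first exact: H.
(* The gradient of the zero function is a choice too: linearity applied to [0 = -1 *: 0 + 0] shows
   that it vanishes almost everywhere. *)
have := H0_grad_lin (-1) H H; rewrite scaler0 addr0.
apply: filterS2 g0 => x gx; rewrite scaleN1r addNr => ->.
by rewrite enorm0.
Qed.

Lemma gradient_constraint_complete (u_ : nat -> space -> R) (C k : R) : 0 < k < 1 ->
  (forall m, K (u_ m)) ->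
  (forall m, H0norm s (u_ m.+1 - u_ m) <= C * k ^+ m) ->
  exists2 v, K v & (fun m => H0norm s (u_ m - v)) @ \oo --> (0 : R).
Proof.
move=> k01 Ku uC.
have [v [Hv cv av]] := H0_complete n_gt0 s01 s_lt oU bU sobolev k01 (fun m => (Ku m).1) uC.
exists v; last exact: cv.
split; first exact: Hv.
have ag : {ae mu, forall x, forall m, enorm (D (u_ m) x) <= g x}.
  by apply: ae_foralln => m; exact: (Ku m).2.
by apply: filterS2 ag av => x gx cx; exact: (enorm_limit cx gx).
Qed.

End constraint.

Variables (A : space -> 'M[R]_n) (b dd : space -> space) (c g : space -> R).
Variables (a delta : R).
Hypothesis A_bounded : forall i j, Lp +oo%E setT (fun x => A x i j).
Hypothesis b_Lp : vLp (n%:R / s)%:E U b.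
Hypothesis dd_Lp : vLp (n%:R / s)%:E U dd.
Hypothesis c_Lp : Lp (n%:R / (2 * s))%:E U c.
Hypothesis a_gt0 : 0 < a.
Hypothesis A_elliptic : forall xi : space,
  {ae mu, forall x, a * enorm xi ^+ 2 <= dotr (mxapp (A x) xi) xi}.
Hypothesis deltaE : delta =
  a - Cs * (vLpnorm (n%:R / s)%:E U (fun x => b x + dd x) +
            Cs * Lpnorm (n%:R / (2 * s))%:E U (fun x => Num.max 0 (- c x))).
Hypothesis delta_gt0 : 0 < delta.
Hypothesis g_ge0 : {ae mu, forall x, 0 <= g x}.

Local Notation K := (gradient_constraint s U g).
Local Notation B := (bilinear_form s U A b dd c).
Local Notation N u := (H0norm s u).
Local Notation H0U := (H0 s U).

Let B_coercive u : H0U u -> delta * gip s u u <= B u u.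
Proof.
rewrite deltaE; exact: (bilinear_form_coercive n_gt0 s01 s_lt oU sobolev A_bounded
  b_Lp dd_Lp c_Lp A_elliptic).
Qed.

Let B_linl w : H0U w -> linear_on H0U (B ^~ w).
Proof.
move=> Hw k u v Hu Hv.
exact: (bilinear_form_linl n_gt0 s01 s_lt oU sobolev A_bounded b_Lp dd_Lp c_Lp k Hu Hv Hw).
Qed.

Let B_linr w : H0U w -> linear_on H0U (B w).
Proof.
move=> Hw k u v Hu Hv.
exact: (bilinear_form_linr n_gt0 s01 s_lt oU sobolev A_bounded b_Lp dd_Lp c_Lp k Hu Hv Hw).
Qed.

Lemma Lp_dual_sub f0 f0' : Lp (sobolev_dual_exponent n s)%:E U f0 ->
  Lp (sobolev_dual_exponent n s)%:E U f0' ->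
  Lp (sobolev_dual_exponent n s)%:E U (f0 \- f0').
Proof.
have s0 : 0 < s by case/andP: s01.
have nR0 : 0 < n%:R :> R by rewrite ltr0n.
(* The bound 2n/(n + 2s) >= 1 amounts to 2s <= n. *)
have q1 : 1 <= sobolev_dual_exponent n s.
  rewrite /sobolev_dual_exponent ler_pdivlMr; last by rewrite addr_gt0// mulr_gt0.
  by move: s_lt; rewrite mul1r; lra.
move=> Lf0 Lf0'.
have -> : f0 \- f0' = fun x => f0 x + - f0' x by [].
have e : (fun x => f0 x + - f0' x) \_ U = fun x => (f0 \_ U) x + (- (f0' \_ U) x).
  by apply/funext => x; rewrite !patch_indic mulrDr mulrN.
rewrite /Lp e; apply: (Lfun_addr q1 Lf0).
have m : measurable_fun setT (fun x => - (f0' \_ U) x).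
  by apply: measurableT_comp => //; exact: Lfun_measurable Lf0'.
apply: (Lfun_le (lt_le_trans ltr01 q1) m _ Lf0').1 => x.
by rewrite normrN.
Qed.

Lemma vLp2_sub (f f' : space -> space) :
  vLp 2%:E setT f -> vLp 2%:E setT f' -> vLp 2%:E setT (fun x => f x - f' x).
Proof.
move=> /vLpT Lf /vLpT Lf'; apply/vLpT.
have := vL2_lin (-1) Lf' Lf.
rewrite (_ : (fun x => -1 *: f' x + f x) = (fun x => f x - f' x)); first exact.
by apply/funext => x; rewrite scaleN1r addrC.
Qed.

Section data.
Variables (f0 : space -> R) (f : space -> space).
Hypothesis f0_Lp : Lp (sobolev_dual_exponent n s)%:E U f0.
Hypothesis f_L2 : vLp 2%:E setT f.

Lemma load_linear_on : linear_on H0U (load s U f0 f).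
Proof.
move=> k u v Hu Hv; exact: (load_lin n_gt0 s01 s_lt oU sobolev f0_Lp f_L2 k Hu Hv).
Qed.

Lemma solution_exists : exists u, is_solution s U A b dd c g f0 f u.
Proof.
have [M M0 B_bounded] := bilinear_form_bounded n_gt0 s01 s_lt oU sobolev A_bounded
  b_Lp dd_Lp c_Lp.
pose NF := Cs * Lpnorm (sobolev_dual_exponent n s)%:E U f0 +
  vLpnorm 2%:E (grad_domain s U) f.
have [u Ku HK] : exists2 u, K u & forall v, K v ->
    load s U f0 f (v - u) <= B u (v - u).
  apply: (@stampacchia R (space -> R) H0U (gip s) _ _ _ _ K _ _ _ _ B (load s U f0 f) M NF delta).
  - by move=> k u v Hu Hv; exact: (H0_lin k Hu Hv).
  - by move=> u v _ _; exact: gipC.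
  - by move=> k u v w /H0_hasL2 Hu /H0_hasL2 Hv /H0_hasL2 Hw; exact: (gip_linl k Hu Hv Hw).
  - by move=> u _; exact: gip_ge0.
  - by move=> u [].
  - exact: gradient_constraint_convex.
  - by exists 0; exact: (gradient_constraint0 g_ge0).
  - move=> u_ C k k01 Ku uC.
    have [m|v Kv cv] := gradient_constraint_complete (C := C) k01 Ku.
      by rewrite H0norm_sqrt; exact: (uC m).
    exists v; first exact: Kv.
    by under eq_fun do rewrite -H0norm_sqrt; exact: cv.
  - exact: B_linl.
  - exact: B_linr.
  - exact: load_linear_on.
  - by move=> u v Hu Hv; have := B_bounded u v Hu Hv; rewrite (H0norm_sqrt s u) (H0norm_sqrt s v).
  - by move=> v Hv; have := load_bound n_gt0 s01 s_lt oU sobolev f0_Lp f_L2 Hv; rewrite (H0norm_sqrt s v).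
  - exact: delta_gt0.
  - exact: M0.
  - exact: B_coercive.
by exists u; split; [exact: Ku|exact: HK].
Qed.

End data.

(** The right-hand side stays a load, not yet a norm: estimating it gives stability, and for equal
    data it is exactly 0, which gives uniqueness. *)
Lemma solution_difference f0 (f : space -> space) f0' (f' : space -> space) u u' :
  Lp (sobolev_dual_exponent n s)%:E U f0 -> vLp 2%:E setT f ->
  Lp (sobolev_dual_exponent n s)%:E U f0' -> vLp 2%:E setT f' ->
  is_solution s U A b dd c g f0 f u -> is_solution s U A b dd c g f0' f' u' ->
  delta * N (u - u') ^+ 2 <= load s U (f0 \- f0') (fun x => f x - f' x) (u - u').
Proof.
move=> Lf0 Lf Lf0' Lf' [Ku Su] [Ku' Su'].
have Hu := Ku.1; have Hu' := Ku'.1; have Hw := H0_sub Hu Hu'.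
have L1 : linear_on H0U (load s U f0 f) := load_linear_on Lf0 Lf.
have L2 : linear_on H0U (load s U f0' f') := load_linear_on Lf0' Lf'.
have i1 : load s U f0 f (u' - u) <= B u (u' - u) := Su u' Ku'.
have i2 : load s U f0' f' (u - u') <= B u' (u - u') := Su' u Ku.
have i3 := B_coercive Hw.
rewrite (linear_onB L1 Hu' Hu) (linear_onB (B_linr Hu) Hu' Hu) in i1.
rewrite (linear_onB L2 Hu Hu') (linear_onB (B_linr Hu') Hu Hu') in i2.
have e1 := linear_onB (B_linl Hw) Hu Hu'.
have e2 := linear_onB (B_linr Hu) Hu Hu'.
have e3 := linear_onB (B_linr Hu') Hu Hu'.
have e4 := load_sub n_gt0 s01 s_lt oU sobolev Lf0 Lf Lf0' Lf' Hw.
have e5 := linear_onB L1 Hu Hu'.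
have e6 := linear_onB L2 Hu Hu'.
have e7 : N (u - u') ^+ 2 = gip s (u - u') (u - u').
  by rewrite (H0norm_sqrt s (u - u')) (sqr_sqrtr (gip_ge0 s (u - u'))).
rewrite e4 e5 e6 e7; apply: (le_trans i3).
rewrite e1 e2 e3.
exact: add_test_inequalities i1 i2.
Qed.

Lemma solution_stable f0 (f : space -> space) f0' (f' : space -> space) u u' :
  Lp (sobolev_dual_exponent n s)%:E U f0 -> vLp 2%:E setT f ->
  Lp (sobolev_dual_exponent n s)%:E U f0' -> vLp 2%:E setT f' ->
  is_solution s U A b dd c g f0 f u -> is_solution s U A b dd c g f0' f' u' ->
  N (u - u') <= Cs / delta * Lpnorm (sobolev_dual_exponent n s)%:E U (f0 \- f0') +
    1 / delta * vLpnorm 2%:E (grad_domain s U) (fun x => f x - f' x).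
Proof.
move=> Lf0 Lf Lf0' Lf' Su Su'; have [Cs0 _] := sobolev.
have Hw := H0_sub Su.1.1 Su'.1.1.
have Lf0d : Lp (sobolev_dual_exponent n s)%:E U (f0 \- f0') := Lp_dual_sub Lf0 Lf0'.
have Lfd : vLp 2%:E setT (fun x => f x - f' x) := vLp2_sub Lf Lf'.
have le1 := solution_difference Lf0 Lf Lf0' Lf' Su Su'.
have le2 := load_bound n_gt0 s01 s_lt oU sobolev Lf0d Lfd Hw.
have le := le_trans le1 (le_trans (ler_norm _) le2).
exact: (quotient_bound delta_gt0 Cs0 (Lnorm_fine_ge0 _ _ _) (Lnorm_fine_ge0 _ _ _)
  (H0norm_ge0 s _) le).
Qed.

Lemma solution_unique f0 (f : space -> space) u u' :
  Lp (sobolev_dual_exponent n s)%:E U f0 -> vLp 2%:E setT f ->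
  is_solution s U A b dd c g f0 f u -> is_solution s U A b dd c g f0 f u' ->
  {ae mu, forall x, u' x = u x}.
Proof.
move=> Lf0 Lf Su Su'.
have Hw := H0_sub Su.1.1 Su'.1.1.
have le := solution_difference Lf0 Lf Lf0 Lf Su Su'.
rewrite (load_sub n_gt0 s01 s_lt oU sobolev Lf0 Lf Lf0 Lf Hw) subrr in le.
have Nw0 : N (u - u') = 0.
  by apply/eqP; rewrite -sqrf_eq0 eq_le sqr_ge0 andbT -(pmulr_rle0 _ delta_gt0).
have [P P0 HP] := poincare n_gt0 s01 s_lt oU bU sobolev.
have le2 := HP _ Hw; rewrite Nw0 mulr0 in le2.
have Lw := hasL2_Lfun (H0_hasL2 Hw).
have w0 : fine 'N[mu]_2%:E[EFin \o (u - u')] = 0.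
  by apply/eqP; rewrite eq_le le2 Lnorm_fine_ge0.
have i0 := integral_sqr_fine Lw; rewrite w0 expr0n in i0.
have := ae_eq0_integral_sqr (Lfun_measurable Lw) i0.
by apply: filterS => x /eqP; rewrite subr_eq0 => /eqP.
Qed.

End assembly.

Theorem theorem3p5 (R : realType) (d : nat) (s : R) (Omega : set 'rV[R]_d)
    (A : 'rV[R]_d -> 'M[R]_d) (b dd : 'rV[R]_d -> 'rV[R]_d)
    (c g : 'rV[R]_d -> R) (a Cs delta : R)
    (Omega_open : open Omega) (Omega_bounded : bounded_set Omega)
    (s_gt0 : 0 < s) (s_le1 : s <= 1) (s_lt : 2 * s < d%:R)
    (Omega_ext : extension_property s Omega)
    (A_bounded : forall i j, Lp +oo%E setT (fun x => A x i j))
    (b_Lp : vLp (d%:R / s)%:E Omega b)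
    (dd_Lp : vLp (d%:R / s)%:E Omega dd)
    (c_Lp : Lp (d%:R / (2 * s))%:E Omega c)
    (a_gt0 : 0 < a)
    (A_elliptic : forall xi : 'rV[R]_d,
      {ae lebesgue_rV d, forall x,
        a * enorm xi ^+ 2 <= dotr (mxapp (A x) xi) xi})
    (Cs_sobolev : is_sobolev_constant s Omega Cs)
    (deltaE : delta =
      a - Cs * (vLpnorm (d%:R / s)%:E Omega (fun x => b x + dd x) +
                Cs * Lpnorm (d%:R / (2 * s))%:E Omega
                       (fun x => Num.max 0 (- c x))))
    (delta_gt0 : 0 < delta)
    (g_L2loc : L2loc g)
    (g_ge0 : {ae lebesgue_rV d, forall x, 0 <= g x})
    (f0 : 'rV[R]_d -> R) (f : 'rV[R]_d -> 'rV[R]_d)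
    (f0_Lp : Lp (sobolev_dual_exponent d s)%:E Omega f0)
    (f_L2 : vLp 2%:E setT f) :
  (exists u : 'rV[R]_d -> R,
     is_solution s Omega A b dd c g f0 f u /\
     forall u', is_solution s Omega A b dd c g f0 f u' ->
       {ae lebesgue_rV d, forall x, u' x = u x}) /\
  (forall (f0' : 'rV[R]_d -> R) (f' : 'rV[R]_d -> 'rV[R]_d)
          (u u' : 'rV[R]_d -> R),
     Lp (sobolev_dual_exponent d s)%:E Omega f0' ->
     vLp 2%:E setT f' ->
     is_solution s Omega A b dd c g f0 f u ->
     is_solution s Omega A b dd c g f0' f' u' ->
     H0norm s (u \- u') <=
       Cs / delta * Lpnorm (sobolev_dual_exponent d s)%:E Omega
                      (f0 \- f0') +
       1 / delta * vLpnorm 2%:E (grad_domain s Omega)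
                     (fun x => f x - f' x)).
Proof.
(* Positivity of the dimension is implied by 0 < 2s < d. *)
have d0 : (0 < d)%N by rewrite -(ltr0n R); apply: lt_trans s_lt; exact: mulr_gt0.
have s01 : 0 < s <= 1 by rewrite s_gt0 s_le1.
split.
  have [u Su] := solution_exists d0 s01 s_lt Omega_open Omega_bounded Cs_sobolev
    A_bounded b_Lp dd_Lp c_Lp A_elliptic deltaE delta_gt0 g_ge0 f0_Lp f_L2.
  exists u; split; first exact: Su.
  move=> u' Su'.
  exact: (solution_unique d0 s01 s_lt Omega_open Omega_bounded Cs_sobolev
    A_bounded b_Lp dd_Lp c_Lp A_elliptic deltaE delta_gt0 f0_Lp f_L2 Su Su').
move=> f0' f' u u' Lf0' Lf' Su Su'.
exact: (solution_stable d0 s01 s_lt Omega_open Cs_sobolev A_bounded b_Lp dd_Lp c_Lp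
  A_elliptic deltaE delta_gt0 f0_Lp f_L2 Lf0' Lf' Su Su').
Qed.
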